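(* Let $a,b,c$ be integers with $a>0$, put $-d=b^2-4ac$, and suppose $\tau=\frac{-b+\sqrt{-d}}{2a}$ lies in $C_{J/(J-1),\,\rho}$, where $\rho=e^{2\pi i/3}$ (so $d>0$ and $\sqrt{-d}=i\sqrt d$). Let $J=J(\tau)$, $F={}_{2}F_{1}\left(\frac1{12},\frac7{12};\frac23;\frac{J}{J-1}\right)$ and $\alpha=i\,\eta(\rho)^2\sqrt3$. Then $$-\frac{\tau-\overline\rho}{2\pi\alpha^2\sqrt3}\,\frac{J^{1/3}}{(1-J)^{1/3}}\left(a\,\frac{\tau-\overline\rho}{\sqrt{-d}}-1\right)=F^2\left[\frac{J}{6(1-J)}+\frac{s_2(\tau)}{6}\right]+J\frac{d}{dJ}F^2,$$ where the principal branches of the square and cube roots are used. (Here $\frac{d}{dJ}F^2$ is the derivative of $F^2$ regarded as a function of $J$.)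
   Context: For $\tau$ in the upper half-plane $\mathfrak H$ and $q=e^{2\pi i\tau}$: $E_2(\tau)=1-24\sum_{n\ge1}\frac{nq^n}{1-q^n}$, $E_4(\tau)=1+240\sum_{n\ge1}\frac{n^3q^n}{1-q^n}$, $E_6(\tau)=1-504\sum_{n\ge1}\frac{n^5q^n}{1-q^n}$; the absolute Klein invariant is $J(\tau)=\frac{E_4(\tau)^3}{E_4(\tau)^3-E_6(\tau)^2}$ (so $J=j/12^3$ with $j$ the classical $j$-invariant); $$s_2(\tau)=\frac{E_4(\tau)}{E_6(\tau)}\left(E_2(\tau)-\frac{3}{\pi\,\mathrm{Im}(\tau)}\right);$$ and $\eta(\tau)=e^{2\pi i\tau/24}\prod_{n\ge1}(1-q^n)$ is the Dedekind eta function. ${}_2F_1(a,b;c;z)=\sum_{n\ge0}\frac{(a)_n(b)_n}{(c)_n}\frac{z^n}{n!}$ is the hypergeometric series, with $(x)_n=x(x+1)\cdots(x+n-1)$, $(x)_0=1$. Let $\mathcal F=\{\tau\in\mathfrak H: |\mathrm{Re}(\tau)|<1/2,\ |\tau|>1\}$. $C_{J/(J-1),\,\rho}$ denotes the connected component of the open set $\{\tau\in\mathcal F: |J(\tau)/(J(\tau)-1)|<1\}$ whose closure contains $\rho$ (it is the part of this set with $\mathrm{Re}(\tau)<0$). *)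

(* Defs.v *)
(* Stdlib reals with Coquelicot's complex numbers [C]. *)
From Stdlib Require Import Reals ZArith Lra.
From Coquelicot Require Import Coquelicot.
Open Scope R_scope.

(** * Limits in [C] *)

(* Componentwise limit; arbitrary when the sequence diverges. *)
Definition CLim_seq (u : nat -> C) : C :=
  (real (Lim_seq (fun n => Re (u n))), real (Lim_seq (fun n => Im (u n)))).

Definition CSeries (a : nat -> C) : C := CLim_seq (fun n => sum_n a n).

Lemma CLim_seq_unique (u : nat -> C) (l : C) :
  filterlim u eventually (locally l) -> CLim_seq u = l.
Proof.
  intros H; destruct l as [x y]; unfold CLim_seq.
  assert (Hx : is_lim_seq (fun n => Re (u n)) x).
  { apply is_lim_seq_spec; intros eps.
    specialize (H (ball (x, y) eps) (locally_ball _ eps)).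
    unfold filtermap in H; revert H; apply filter_imp; intros n [h _]; exact h. }
  assert (Hy : is_lim_seq (fun n => Im (u n)) y).
  { apply is_lim_seq_spec; intros eps.
    specialize (H (ball (x, y) eps) (locally_ball _ eps)).
    unfold filtermap in H; revert H; apply filter_imp; intros n [_ h]; exact h. }
  now rewrite (is_lim_seq_unique _ _ Hx), (is_lim_seq_unique _ _ Hy).
Qed.

(** * Exponential and principal roots *)

Definition Cexp (z : C) : C := (exp (Re z) * cos (Im z), exp (Re z) * sin (Im z)).

(* Principal argument, in (-PI, PI].  Off the real axis this is the half-angle
   formula tan (arg z / 2) = Im z / (|z| + Re z); see [Carg_correct]. *)
Definition Carg (z : C) : R :=
  if Req_EM_T (Im z) 0 then (if Rlt_dec (Re z) 0 then PI else 0)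
  else 2 * atan (Im z / (Cmod z + Re z)).

Definition Clog (z : C) : C := (ln (Cmod z), Carg z).

(* Principal branch of z^(1/n), n > 0. *)
Definition Croot (n : nat) (z : C) : C :=
  if Ceq_dec z 0 then RtoC 0 else Cexp (Clog z / RtoC (INR n))%C.

Lemma Carg_correct (z : C) : z <> RtoC 0 ->
  - PI < Carg z <= PI /\ z = Cexp (Clog z).
Proof.
  intros Hz.
  assert (Hm : 0 < Cmod z) by now apply Cmod_gt_0.
  assert (Hm2 := Cmod2_alt z).
  unfold Cexp, Clog; cbn [Re Im fst snd]; rewrite exp_ln by exact Hm.
  assert (HPI := PI_RGT_0).
  destruct z as [x y]; unfold Carg; cbn [Re Im fst snd] in *.
  set (m := Cmod (x, y)) in *.
  destruct (Req_EM_T y 0) as [Hy|Hy].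
  - destruct (Rlt_dec x 0) as [Hx|Hx].
    + rewrite cos_PI, sin_PI; split; [lra|].
      assert (m = - x) by nra. f_equal; lra.
    + rewrite cos_0, sin_0; split; [lra|].
      assert (m = x) by nra. f_equal; lra.
  - assert (Hy2 : 0 < y * y) by nra.
    assert (Hs : 0 < m + x) by nra.
    set (t := y / (m + x)).
    assert (Ht : t * (m + x) = y) by (unfold t; field; lra).
    assert (Hb := atan_bound t).
    split; [lra|].
    rewrite cos_2a, sin_2a.
    assert (Hc : 0 < cos (atan t)) by (apply cos_gt_0; lra).
    assert (Hsin : sin (atan t) = t * cos (atan t)).
    { rewrite <- (tan_atan t) at 2; unfold tan; field; lra. }
    assert (H1 := sin2_cos2 (atan t)); unfold Rsqr in H1.
    rewrite Hsin in H1 |- *.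
    set (k := cos (atan t)) in *.
    assert (Hk : k * k * (1 + t * t) = 1) by lra.
    assert (H2m : k * k * (2 * m) = m + x).
    { assert ((m + x) * (k * k * (2 * m)) = (m + x) * (m + x)); [|nra].
      replace ((m + x) * (m + x))
        with (k * k * (1 + t * t) * ((m + x) * (m + x))) by (rewrite Hk; ring).
      replace (k * k * (1 + t * t) * ((m + x) * (m + x)))
        with (k * k * ((m + x) * (m + x) + (t * (m + x)) * (t * (m + x)))) by ring.
      rewrite Ht; replace (y * y) with (m * m - x * x) by nra; ring. }
    f_equal.
    + replace (m * (k * k - t * k * (t * k)))
        with (m * (2 * (k * k) - k * k * (1 + t * t))) by ring.
      rewrite Hk; lra.
    + replace (m * (2 * (t * k) * k)) with (t * (k * k * (2 * m))) by ring.
      rewrite H2m; lra.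
Qed.

(** * Modular functions *)

Definition qexp (tau : C) : C := Cexp (2 * PI * Ci * tau)%C.

(* sum over n >= 1 of n^k q^n / (1 - q^n) *)
Definition lambert (k : nat) (q : C) : C :=
  CSeries (fun m => let n := S m in
    (RtoC (INR n) ^ k * q ^ n / (1 - q ^ n))%C).

Definition E2 (tau : C) : C := (1 - 24 * lambert 1 (qexp tau))%C.
Definition E4 (tau : C) : C := (1 + 240 * lambert 3 (qexp tau))%C.
Definition E6 (tau : C) : C := (1 - 504 * lambert 5 (qexp tau))%C.

Definition Jinv (tau : C) : C := (E4 tau ^ 3 / (E4 tau ^ 3 - E6 tau ^ 2))%C.

Definition s2 (tau : C) : C :=
  (E4 tau / E6 tau * (E2 tau - RtoC (3 / (PI * Im tau))))%C.

(* (1 - q) (1 - q^2) ... (1 - q^N) *)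
Fixpoint euler_prod (q : C) (N : nat) : C :=
  match N with
  | O => RtoC 1
  | S n => (euler_prod q n * (1 - q ^ S n))%C
  end.

Definition eta (tau : C) : C :=
  (Cexp (2 * PI * Ci * tau / 24) * CLim_seq (euler_prod (qexp tau)))%C.

(** * Gauss hypergeometric series *)

Fixpoint pochhammer (x : C) (n : nat) : C :=
  match n with
  | O => RtoC 1
  | S m => (pochhammer x m * (x + RtoC (INR m)))%C
  end.

Definition hyp2F1 (a b c z : C) : C :=
  CSeries (fun n => (pochhammer a n * pochhammer b n / pochhammer c n
                     * (z ^ n / RtoC (INR (fact n))))%C).

(** * Connected components *)

Definition connected {T : UniformSpace} (A : T -> Prop) : Prop :=
  forall U V : T -> Prop, open U -> open V ->
    (forall x, A x -> U x \/ V x) ->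
    (exists x, A x /\ U x) -> (exists x, A x /\ V x) ->
    exists x, A x /\ U x /\ V x.

Definition connected_component {T : UniformSpace} (A : T -> Prop) (x : T) : T -> Prop :=
  fun y => exists B : T -> Prop,
    connected B /\ (forall z, B z -> A z) /\ B x /\ B y.

Definition closure {T : UniformSpace} (A : T -> Prop) : T -> Prop :=
  fun x => forall U : T -> Prop, open U -> U x -> exists y, A y /\ U y.

(** * The domain *)

Definition rho : C := Cexp (2 * PI * Ci / 3)%C.

Definition fund_domain (tau : C) : Prop :=
  0 < Im tau /\ Rabs (Re tau) < 1 / 2 /\ 1 < Cmod tau.

Definition J_small (tau : C) : Prop :=
  fund_domain tau /\ Cmod (Jinv tau / (Jinv tau - 1))%C < 1.

(* The points whose connected component in [J_small] has [rho] in its closure. *)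
Definition C_rho (tau : C) : Prop :=
  J_small tau /\ closure (connected_component J_small tau) rho.

(* Main.v *)
Require Import Defs.
From Stdlib Require Import Reals ZArith Lra Lia Psatz List Bool Classical.
From Coquelicot Require Import Coquelicot.
Import ListNotations.
Open Scope R_scope.

(* Write P, Q, R for E2, E4, E6, let D = (1 / (2 i PI)) d/dtau, x = J / (J - 1) = Q^3 / R^2 and
   Y = 2F1(1/12, 7/12; 2/3; x).  By Ramanujan's equations for DP, DQ, DR, the functions R^(1/6) and
   tau R^(1/6) span the solutions of the hypergeometric equation pulled back along x; near rho,
   where Q vanishes, Y is the combination const * (tau - conj rho) R^(1/6), because
   P(rho) = 2 sqrt 3 / PI.  Differentiating this relation turns the right-hand side of the theorem
   into an explicit multiple of Q R^(-2/3), and the theorem becomes the statement that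
   J^(1/3) / (1 - J)^(1/3) is the correct cube root.  The cube is right because
   R(rho) = 24 sqrt 3 i eta(rho)^12; the branch is right because x is never real on the component:
   the second solution shows that ((tau - rho) / (tau - conj rho))^3 is x times a function of x which
   is real on the reals, and that cube is real only on the geodesics through rho that bound the domain.

   Ramanujan's equations come from Skoruppa's combinatorial proof of the convolution identities for
   divisor sums; Q(rho) = 0 and P(rho) from the Lipschitz formula in weight 4, which gives
   Q(-1/tau) = tau^4 Q(tau), and its first two derivatives at the fixed point rho. *)


(** Identities between functions are obtained throughout by showing that a quotient or a combination
    has derivative 0 and then fixing one value. The second-order equation is treated in the same
    way. Put lambda = DR / (6 R). For Y as above, Z = lambda Y - DY satisfies DZ = lambda Z, and so
    does 2 i PI (tau - conj rho) Z + Y; the latter vanishes at rho because lambda(rho) = 1 / (2 sqrt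
    3 PI), hence identically.

    The obstacles are topological. R^(1/6) is multivalued and the shape of the component is not
    known, so only sixth powers divided by integral powers of R are compared; they are locally
    constant and can be carried along a connected set. The point rho lies in the closure only, so
    everything is first proved on a full neighbourhood of rho and transferred from there. The zeros
    of R, which the convention for division by zero admits into [J_small], must be kept out of that
    connected set. Finally, the quotient of the principal cube root by its predicted value is a
    continuous cube root of 1, so one sector estimate near rho decides it everywhere. *)

(** * Limits of complex-valued functions along a filter *)

Definition clim {T : Type} (F : (T -> Prop) -> Prop) (f : T -> C) (l : C) : Prop :=
  forall eps : R, 0 < eps -> F (fun t => Cmod (f t - l) < eps).

Section Clim.
Context {T : Type} {F : (T -> Prop) -> Prop} {FF : Filter F}.

Lemma clim_ext (f g : T -> C) (l : C) : F (fun t => f t = g t) -> clim F f l -> clim F g l.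
Proof.
  intros He Hf eps Heps. generalize (filter_and _ _ He (Hf eps Heps)).
  apply filter_imp. intros t [H1 H2]. now rewrite <- H1.
Qed.

Lemma clim_ext_all (f g : T -> C) (l : C) : (forall t, f t = g t) -> clim F f l -> clim F g l.
Proof. intros H. apply clim_ext. now apply filter_forall. Qed.

Lemma clim_const (l : C) : clim F (fun _ => l) l.
Proof.
  intros eps H. apply filter_forall. intros _.
  replace (l - l)%C with (RtoC 0) by ring. now rewrite Cmod_0.
Qed.

Lemma clim_plus (f g : T -> C) (l m : C) :
  clim F f l -> clim F g m -> clim F (fun t => f t + g t)%C (l + m)%C.
Proof.
  intros Hf Hg eps He. assert (He2 : 0 < eps / 2) by lra.
  generalize (filter_and _ _ (Hf _ He2) (Hg _ He2)). apply filter_imp. intros t [H1 H2].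
  replace (f t + g t - (l + m))%C with ((f t - l) + (g t - m))%C by ring.
  eapply Rle_lt_trans; [apply Cmod_triangle|lra].
Qed.

Lemma clim_bounded (f : T -> C) (l : C) : clim F f l -> F (fun t => Cmod (f t) < Cmod l + 1).
Proof.
  intros Hf. generalize (Hf 1 Rlt_0_1). apply filter_imp. intros t H.
  replace (f t) with ((f t - l) + l)%C by ring.
  eapply Rle_lt_trans; [apply Cmod_triangle|lra].
Qed.

Lemma clim_mult (f g : T -> C) (l m : C) :
  clim F f l -> clim F g m -> clim F (fun t => f t * g t)%C (l * m)%C.
Proof.
  intros Hf Hg eps He.
  assert (Hl := Cmod_ge_0 l). assert (Hm := Cmod_ge_0 m).
  set (K := Cmod l + 1 + Cmod m + 1).
  assert (HK : 0 < K) by (unfold K; lra).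
  assert (He2 : 0 < eps / (2 * K)) by (apply Rdiv_lt_0_compat; lra).
  generalize (filter_and _ _ (clim_bounded _ _ Hf) (filter_and _ _ (Hf _ He2) (Hg _ He2))).
  apply filter_imp. intros t [H0 [H1 H2]].
  replace (f t * g t - l * m)%C with ((f t) * (g t - m) + (f t - l) * m)%C by ring.
  eapply Rle_lt_trans; [apply Cmod_triangle|]. rewrite !Cmod_mult.
  assert (H3 := Cmod_ge_0 (f t)). assert (H4 := Cmod_ge_0 (g t - m)%C).
  assert (H5 := Cmod_ge_0 (f t - l)%C).
  apply Rle_lt_trans with (K * Cmod (g t - m) + Cmod (f t - l) * K).
  - apply Rplus_le_compat; apply Rmult_le_compat; unfold K; lra.
  - apply Rlt_le_trans with (K * (eps / (2 * K)) + eps / (2 * K) * K).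
    + apply Rplus_lt_compat; [apply Rmult_lt_compat_l|apply Rmult_lt_compat_r]; assumption.
    + right. field. lra.
Qed.

Lemma clim_opp (f : T -> C) (l : C) : clim F f l -> clim F (fun t => - f t)%C (- l)%C.
Proof.
  intros Hf. apply clim_ext_all with (fun t => (- (1)) * f t)%C; [intros; ring|].
  replace (- l)%C with (- (1) * l)%C by ring. apply clim_mult; [apply clim_const|exact Hf].
Qed.

Lemma clim_minus (f g : T -> C) (l m : C) :
  clim F f l -> clim F g m -> clim F (fun t => f t - g t)%C (l - m)%C.
Proof. intros. apply clim_plus; [|apply clim_opp]; assumption. Qed.

Lemma clim_pow (f : T -> C) (l : C) (n : nat) : clim F f l -> clim F (fun t => f t ^ n)%C (l ^ n)%C.
Proof.
  intros Hf. induction n as [|n IH]; cbn [Cpow]; [apply clim_const|now apply clim_mult].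
Qed.

Lemma clim_neq0 (f : T -> C) (l : C) : l <> 0 -> clim F f l -> F (fun t => Cmod l / 2 < Cmod (f t)).
Proof.
  intros Hl Hf. apply Cmod_gt_0 in Hl. assert (H2 : 0 < Cmod l / 2) by lra.
  generalize (Hf _ H2). apply filter_imp. intros t H.
  assert (Cmod l <= Cmod (f t) + Cmod (f t - l)); [|lra].
  rewrite <- (Cmod_opp (f t - l)).
  replace l with (f t + - (f t - l))%C at 1 by ring. apply Cmod_triangle.
Qed.

Lemma clim_inv (f : T -> C) (l : C) : l <> 0 -> clim F f l -> clim F (fun t => / f t)%C (/ l)%C.
Proof.
  intros Hl Hf eps He. assert (Hl' := Hl). apply Cmod_gt_0 in Hl'.
  assert (He2 : 0 < eps * (Cmod l * Cmod l / 2)) by (apply Rmult_lt_0_compat; [lra|nra]).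
  generalize (filter_and _ _ (clim_neq0 _ _ Hl Hf) (Hf _ He2)). apply filter_imp.
  intros t [H1 H2].
  assert (Hft : f t <> 0) by (apply Cmod_gt_0; lra).
  replace (/ f t - / l)%C with (- (f t - l) / (f t * l))%C by (field; split; assumption).
  rewrite Cmod_div by (now apply Cmult_neq_0). rewrite Cmod_opp, Cmod_mult.
  apply Rmult_lt_reg_r with (Cmod (f t) * Cmod l); [nra|].
  unfold Rdiv. rewrite Rmult_assoc, Rinv_l by nra. rewrite Rmult_1_r.
  eapply Rlt_le_trans; [exact H2|]. apply Rmult_le_compat_l; [lra|]. nra.
Qed.

Lemma clim_div (f g : T -> C) (l m : C) : m <> 0 ->
  clim F f l -> clim F g m -> clim F (fun t => f t / g t)%C (l / m)%C.
Proof. intros. apply clim_mult; [|apply clim_inv]; assumption. Qed.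

Lemma clim_conj (f : T -> C) (l : C) : clim F f l -> clim F (fun t => Cconj (f t)) (Cconj l).
Proof.
  intros Hf eps He. generalize (Hf eps He). apply filter_imp. intros t.
  now rewrite <- (Cmod_conj (f t - l)), Cminus_conj.
Qed.

Lemma clim_re (f : T -> C) (l : C) (eps : R) : 0 < eps -> clim F f l ->
  F (fun t => Rabs (Re (f t) - Re l) < eps).
Proof.
  intros He Hf. generalize (Hf eps He). apply filter_imp. intros t H.
  eapply Rle_lt_trans; [|exact H]. apply (re_le_Cmod (f t - l)).
Qed.

Lemma clim_unique {PF : ProperFilter F} (f : T -> C) (l m : C) : clim F f l -> clim F f m -> l = m.
Proof.
  intros Hl Hm. destruct (Ceq_dec l m) as [E|E]; [exact E|exfalso].
  assert (H : (l - m)%C <> 0) by (intros E'; apply E; replace l with (l - m + m)%C by ring; rewrite E'; ring).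
  apply Cmod_gt_0 in H. assert (H2 : 0 < Cmod (l - m) / 2) by lra.
  destruct (filter_ex _ (filter_and _ _ (Hl _ H2) (Hm _ H2))) as [t [H3 H4]].
  assert (Cmod (l - m) <= Cmod (f t - l) + Cmod (f t - m)); [|lra].
  rewrite <- (Cmod_opp (f t - l)).
  replace (l - m)%C with (- (f t - l) + (f t - m))%C by ring. apply Cmod_triangle.
Qed.

Lemma clim_mod_le {PF : ProperFilter F} (f : T -> C) (l : C) (M : R) :
  clim F f l -> F (fun t => Cmod (f t) <= M) -> Cmod l <= M.
Proof.
  intros Hl HM. apply Rnot_lt_le. intros H. assert (H2 : 0 < Cmod l - M) by lra.
  destruct (filter_ex _ (filter_and _ _ (Hl _ H2) HM)) as [t [H3 H4]].
  assert (Cmod l <= Cmod (f t - l) + Cmod (f t)); [|lra].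
  rewrite <- (Cmod_opp (f t - l)).
  replace l with (- (f t - l) + f t)%C at 1 by ring. apply Cmod_triangle.
Qed.

End Clim.

Lemma clim_comp {T U : Type} (F : (T -> Prop) -> Prop) (G : (U -> Prop) -> Prop) (g : T -> U)
  (f : U -> C) (l : C) : (forall P, G P -> F (fun t => P (g t))) -> clim G f l -> clim F (fun t => f (g t)) l.
Proof. intros H Hf eps He. apply (H _ (Hf eps He)). Qed.

(** * Neighbourhoods in [C] *)

(** Discs for [Cmod] keep all estimates in terms of the modulus; the comparison with the square
    balls of [C_UniformSpace] is postponed to [cnbhs_locally]. The centre belongs to the disc, so a
    property near [z] includes the property at [z]. *)
Definition cnbhs (z : C) (P : C -> Prop) : Prop :=
  exists d, 0 < d /\ forall w, Cmod (w - z) < d -> P w.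

#[export] Instance cnbhs_filter (z : C) : ProperFilter (cnbhs z).
Proof.
  constructor.
  - intros P [d [Hd H]]. exists z. apply H. replace (z - z)%C with (RtoC 0) by ring. now rewrite Cmod_0.
  - constructor.
    + exists 1. split; [lra|auto].
    + intros P Q [d [Hd H]] [e [He H']]. exists (Rmin d e). split; [now apply Rmin_glb_lt|].
      intros w Hw. split; [apply H|apply H']; eapply Rlt_le_trans; try exact Hw; [apply Rmin_l|apply Rmin_r].
    + intros P Q HPQ [d [Hd H]]. exists d. split; auto.
Qed.

Lemma cnbhs_self (z : C) (P : C -> Prop) : cnbhs z P -> P z.
Proof. intros [d [Hd H]]. apply H. replace (z - z)%C with (RtoC 0) by ring. now rewrite Cmod_0. Qed.

(** Halving the radius. It makes the interior of any set open, which later supplies the open sets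
    that [connected] and [closure] quantify over. *)
Lemma cnbhs_nbhs (z : C) (P : C -> Prop) : cnbhs z P -> cnbhs z (fun w => cnbhs w P).
Proof.
  intros [d [Hd H]]. exists (d / 2). split; [lra|]. intros w Hw.
  exists (d / 2). split; [lra|]. intros v Hv. apply H.
  replace (v - z)%C with ((v - w) + (w - z))%C by ring.
  eapply Rle_lt_trans; [apply Cmod_triangle|lra].
Qed.

Definition ccont (f : C -> C) (z : C) : Prop := clim (cnbhs z) f (f z).

Lemma ccont_id (z : C) : ccont (fun w => w) z.
Proof. intros eps He. exists eps. auto. Qed.

Lemma ccont_const (c z : C) : ccont (fun _ => c) z.
Proof. apply clim_const. Qed.

Lemma ccont_plus (f g : C -> C) (z : C) : ccont f z -> ccont g z -> ccont (fun w => f w + g w)%C z.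
Proof. apply clim_plus. Qed.

Lemma ccont_opp (f : C -> C) (z : C) : ccont f z -> ccont (fun w => - f w)%C z.
Proof. apply clim_opp. Qed.

Lemma ccont_minus (f g : C -> C) (z : C) : ccont f z -> ccont g z -> ccont (fun w => f w - g w)%C z.
Proof. apply clim_minus. Qed.

Lemma ccont_mult (f g : C -> C) (z : C) : ccont f z -> ccont g z -> ccont (fun w => f w * g w)%C z.
Proof. apply clim_mult. Qed.

Lemma ccont_pow (f : C -> C) (z : C) (n : nat) : ccont f z -> ccont (fun w => f w ^ n)%C z.
Proof. apply clim_pow. Qed.

Lemma ccont_div (f g : C -> C) (z : C) : g z <> 0 -> ccont f z -> ccont g z -> ccont (fun w => f w / g w)%C z.
Proof. apply clim_div. Qed.

Lemma ccont_nbhs (f : C -> C) (z : C) (P : C -> Prop) :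
  ccont f z -> cnbhs (f z) P -> cnbhs z (fun w => P (f w)).
Proof.
  intros Hf [d [Hd H]]. generalize (Hf d Hd). apply filter_imp. intros w Hw. now apply H.
Qed.

Lemma ccont_comp (f g : C -> C) (z : C) : ccont g z -> ccont f (g z) -> ccont (fun w => f (g w)) z.
Proof.
  intros Hg Hf. unfold ccont. apply clim_comp with (G := cnbhs (g z)); [|exact Hf].
  intros P HP. now apply ccont_nbhs.
Qed.

Lemma ccont_neq0 (f : C -> C) (z : C) : ccont f z -> f z <> 0 -> cnbhs z (fun w => f w <> 0).
Proof.
  intros Hf Hz. generalize (clim_neq0 _ _ Hz Hf). apply filter_imp. intros w Hw.
  apply Cmod_gt_0 in Hz. apply Cmod_gt_0. lra.
Qed.

Lemma ccont_mod_lt (f : C -> C) (z : C) (r : R) : ccont f z -> Cmod (f z) < r -> cnbhs z (fun w => Cmod (f w) < r).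
Proof.
  intros Hf Hz. assert (He : 0 < r - Cmod (f z)) by lra. generalize (Hf _ He). apply filter_imp.
  intros w Hw. replace (f w) with ((f w - f z) + f z)%C by ring.
  eapply Rle_lt_trans; [apply Cmod_triangle|lra].
Qed.

Lemma im_le_Cmod (c : C) : Rabs (Im c) <= Cmod c.
Proof. eapply Rle_trans; [|apply Rmax_Cmod]. apply Rmax_r. Qed.

(** * Complex derivatives *)

(* Caratheodory's formulation: near [z], [g] is the difference quotient. *)
Definition cderiv (f : C -> C) (z l : C) : Prop :=
  exists g, cnbhs z (fun w => f w - f z = (w - z) * g w)%C /\ g z = l /\ ccont g z.

Lemma cderiv_val (f : C -> C) (z l m : C) : cderiv f z l -> l = m -> cderiv f z m.
Proof. now intros H <-. Qed.

Lemma cderiv_const (c z : C) : cderiv (fun _ => c) z 0.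
Proof.
  exists (fun _ => RtoC 0). repeat split; [|apply ccont_const].
  apply filter_forall. intros w. ring.
Qed.

Lemma cderiv_id (z : C) : cderiv (fun w => w) z 1.
Proof.
  exists (fun _ => RtoC 1). repeat split; [|apply ccont_const].
  apply filter_forall. intros w. ring.
Qed.

Lemma cderiv_ccont (f : C -> C) (z l : C) : cderiv f z l -> ccont f z.
Proof.
  intros [g [H1 [H2 H3]]]. unfold ccont.
  apply clim_ext with (fun w => f z + (w - z) * g w)%C.
  - revert H1. apply filter_imp. intros w Hw. rewrite <- Hw. ring.
  - enough (H : clim (cnbhs z) (fun w => f z + (w - z) * g w)%C (f z + (z - z) * g z)%C)
      by (now replace (f z + (z - z) * g z)%C with (f z) in H by ring).
    apply clim_plus; [apply clim_const|]. apply clim_mult; [|exact H3].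
    apply clim_minus; [apply ccont_id|apply clim_const].
Qed.

Lemma cderiv_local (f g : C -> C) (z l : C) : cnbhs z (fun w => f w = g w) -> cderiv f z l -> cderiv g z l.
Proof.
  intros He [k [H1 [H2 H3]]]. exists k. repeat split; auto.
  generalize (filter_and _ _ He H1). apply filter_imp. intros w [Hw Hw'].
  rewrite <- Hw, <- (cnbhs_self _ _ He). exact Hw'.
Qed.

Lemma cderiv_ext (f g : C -> C) (z l : C) : (forall w, f w = g w) -> cderiv f z l -> cderiv g z l.
Proof. intros H. apply cderiv_local. now apply filter_forall. Qed.

Lemma cderiv_plus (f g : C -> C) (z l m : C) :
  cderiv f z l -> cderiv g z m -> cderiv (fun w => f w + g w)%C z (l + m)%C.
Proof.
  intros [h [H1 [H2 H3]]] [k [G1 [G2 G3]]]. exists (fun w => h w + k w)%C. repeat split.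
  - generalize (filter_and _ _ H1 G1). apply filter_imp. intros w [Hw Hw'].
    replace (f w + g w - (f z + g z))%C with ((f w - f z) + (g w - g z))%C by ring.
    rewrite Hw, Hw'. ring.
  - now rewrite H2, G2.
  - now apply ccont_plus.
Qed.

Lemma cderiv_mult (f g : C -> C) (z l m : C) :
  cderiv f z l -> cderiv g z m -> cderiv (fun w => f w * g w)%C z (l * g z + f z * m)%C.
Proof.
  intros Hf Hg. assert (Cg := cderiv_ccont _ _ _ Hg).
  destruct Hf as [h [H1 [H2 H3]]], Hg as [k [G1 [G2 G3]]].
  exists (fun w => h w * g w + f z * k w)%C. repeat split.
  - generalize (filter_and _ _ H1 G1). apply filter_imp. intros w [Hw Hw'].
    replace (f w * g w - (f z * g z))%C with ((f w - f z) * g w + f z * (g w - g z))%C by ring.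
    rewrite Hw, Hw'. ring.
  - now rewrite H2, G2.
  - apply ccont_plus; apply ccont_mult; auto. apply ccont_const.
Qed.

Lemma cderiv_scal (c : C) (f : C -> C) (z l : C) : cderiv f z l -> cderiv (fun w => c * f w)%C z (c * l)%C.
Proof.
  intros H. replace (c * l)%C with (0 * f z + c * l)%C by ring.
  apply (cderiv_mult (fun _ => c) f); [apply cderiv_const|exact H].
Qed.

Lemma cderiv_opp (f : C -> C) (z l : C) : cderiv f z l -> cderiv (fun w => - f w)%C z (- l)%C.
Proof.
  intros H. apply cderiv_ext with (fun w => - (1) * f w)%C; [intros; ring|].
  replace (- l)%C with (- (1) * l)%C by ring. now apply cderiv_scal.
Qed.

Lemma cderiv_minus (f g : C -> C) (z l m : C) :
  cderiv f z l -> cderiv g z m -> cderiv (fun w => f w - g w)%C z (l - m)%C.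
Proof. intros. apply cderiv_plus; [|apply cderiv_opp]; assumption. Qed.

Lemma cderiv_pow (f : C -> C) (z l : C) (n : nat) :
  cderiv f z l -> cderiv (fun w => f w ^ n)%C z (RtoC (INR n) * f z ^ pred n * l)%C.
Proof.
  intros H. induction n as [|n IH].
  - cbn [Cpow INR]. replace (RtoC 0 * f z ^ pred 0 * l)%C with (RtoC 0) by ring. apply cderiv_const.
  - cbn [Cpow pred]. replace (RtoC (INR (S n)) * f z ^ n * l)%C
      with (l * f z ^ n + f z * (RtoC (INR n) * f z ^ pred n * l))%C.
    + now apply cderiv_mult.
    + rewrite S_INR, RtoC_plus. destruct n as [|n]; cbn [Cpow pred INR]; ring.
Qed.

Lemma cderiv_comp (f g : C -> C) (z l m : C) :
  cderiv f (g z) l -> cderiv g z m -> cderiv (fun w => f (g w)) z (l * m)%C.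
Proof.
  intros Hf Hg. assert (Cg := cderiv_ccont _ _ _ Hg).
  destruct Hf as [h [H1 [H2 H3]]], Hg as [k [G1 [G2 G3]]].
  exists (fun w => h (g w) * k w)%C. repeat split.
  - generalize (filter_and _ _ (ccont_nbhs _ _ _ Cg H1) G1). apply filter_imp. intros w [Hw Hw'].
    rewrite Hw, Hw'. ring.
  - now rewrite H2, G2.
  - apply ccont_mult; auto. now apply (ccont_comp h g).
Qed.

Lemma cderiv_inv (f : C -> C) (z l : C) : f z <> 0 ->
  cderiv f z l -> cderiv (fun w => / f w)%C z (- l / (f z) ^ 2)%C.
Proof.
  intros Hz Hf. assert (Cf := cderiv_ccont _ _ _ Hf). destruct Hf as [h [H1 [H2 H3]]].
  exists (fun w => - h w / (f w * f z))%C. repeat split.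
  - generalize (filter_and _ _ H1 (ccont_neq0 _ _ Cf Hz)). apply filter_imp. intros w [Hw Hw'].
    replace (/ f w - / f z)%C with (- (f w - f z) / (f w * f z))%C by (field; auto).
    rewrite Hw. field. auto.
  - rewrite H2. field. auto.
  - apply ccont_div; [now apply Cmult_neq_0|now apply ccont_opp|].
    apply ccont_mult; [exact Cf|apply ccont_const].
Qed.

Lemma cderiv_div (f g : C -> C) (z l m : C) : g z <> 0 ->
  cderiv f z l -> cderiv g z m -> cderiv (fun w => f w / g w)%C z ((l * g z - f z * m) / (g z) ^ 2)%C.
Proof.
  intros Hz Hf Hg.
  replace ((l * g z - f z * m) / g z ^ 2)%C with (l * / g z + f z * (- m / g z ^ 2))%C by (field; auto).
  apply (cderiv_mult f (fun w => / g w)%C); [exact Hf|now apply (cderiv_inv g)].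
Qed.

(** Two slopes of [f] differ by a slope of the zero function. If that difference were nonzero at
    [z], it would be nonzero nearby, and the point [z + d / 2] gives a contradiction. *)
Lemma cderiv_unique (f : C -> C) (z l m : C) : cderiv f z l -> cderiv f z m -> l = m.
Proof.
  intros [g [H1 [H2 H3]]] [k [G1 [G2 G3]]].
  assert (E : cderiv (fun _ => 0) z (l - m)).
  { exists (fun w => g w - k w)%C. repeat split; [|now rewrite H2, G2|now apply ccont_minus].
    generalize (filter_and _ _ H1 G1). apply filter_imp. intros w [Hw Hw'].
    replace ((w - z) * (g w - k w))%C with ((w - z) * g w - (w - z) * k w)%C by ring.
    rewrite <- Hw, <- Hw'. ring. }
  destruct E as [u [E1 [E2 E3]]].
  destruct (Ceq_dec l m) as [E|E]; [exact E|exfalso].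
  assert (N : u z <> 0).
  { rewrite E2. intros E'. apply E. replace l with (l - m + m)%C by ring. rewrite E'. ring. }
  destruct (filter_and _ _ E1 (ccont_neq0 _ _ E3 N)) as [d [Hd H]].
  assert (Hw : Cmod (z + RtoC (d / 2) - z) < d).
  { replace (z + RtoC (d / 2) - z)%C with (RtoC (d / 2)) by ring. rewrite Cmod_R, Rabs_right; lra. }
  destruct (H _ Hw) as [Ha Hb]. apply Hb.
  assert (Hd2 : RtoC (d / 2) <> 0) by (intros X; apply RtoC_inj in X; lra).
  replace (z + RtoC (d / 2) - z)%C with (RtoC (d / 2)) in Ha by ring.
  replace (u (z + RtoC (d / 2))%C) with (/ RtoC (d / 2) * (RtoC (d / 2) * u (z + RtoC (d / 2))))%C
    by (field; exact Hd2).
  rewrite <- Ha. ring.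
Qed.

(** The bridge to the [C_derive] of the theorem, crossed once, for the derivative with respect to
    J. *)
Lemma cderiv_C_derive (f : C -> C) (z l : C) : cderiv f z l -> C_derive f z = l.
Proof.
  intros [g [H1 [H2 H3]]]. apply is_C_derive_unique.
  split; [apply is_linear_scal_l|].
  intros x Hx. apply (@is_filter_lim_locally_unique C_AbsRing (AbsRing_NormedModule C_AbsRing)) in Hx. subst x.
  intros eps. destruct (filter_and _ _ H1 (H3 eps (cond_pos eps))) as [d [Hd H]].
  exists (mkposreal d Hd). intros w Hw.
  specialize (H w Hw). destruct H as [Ha Hb].
  change (Cmod (f w - f z - (w - z) * l) <= eps * Cmod (w - z)).
  rewrite Ha, <- H2. replace ((w - z) * g w - (w - z) * g z)%C with ((w - z) * (g w - g z))%C by ring.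
  rewrite Cmod_mult, Rmult_comm. apply Rmult_le_compat_r; [apply Cmod_ge_0|lra].
Qed.

(* Along the segment from [z0] to [z], the mean value theorem applies to real and imaginary parts. *)
Lemma cderiv_0_const (f : C -> C) (z0 : C) (r : R) :
  (forall z, Cmod (z - z0) < r -> cderiv f z 0) -> forall z, Cmod (z - z0) < r -> f z = f z0.
Proof.
  intros Hd z Hz.
  set (p := fun t : R => (z0 + RtoC t * (z - z0))%C).
  assert (Hp : forall t, 0 <= t <= 1 -> cderiv f (p t) 0).
  { intros t Ht. apply Hd. unfold p. replace (z0 + RtoC t * (z - z0) - z0)%C with (RtoC t * (z - z0))%C by ring.
    rewrite Cmod_mult, Cmod_R, Rabs_right by lra. assert (H := Cmod_ge_0 (z - z0)). nra. }
  assert (Hq : forall t, 0 <= t <= 1 -> forall eps, 0 < eps -> exists d, 0 < d /\ forall s, Rabs (s - t) < d ->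
     Cmod (f (p s) - f (p t)) <= eps * Rabs (s - t)).
  { intros t Ht eps He. destruct (Hp t Ht) as [g [H1 [H2 H3]]].
    assert (Hm := Cmod_ge_0 (z - z0)).
    assert (He' : 0 < eps / (Cmod (z - z0) + 1)) by (apply Rdiv_lt_0_compat; lra).
    destruct (filter_and _ _ H1 (H3 _ He')) as [d [Hd0 H]].
    exists (d / (Cmod (z - z0) + 1)). split; [apply Rdiv_lt_0_compat; lra|].
    intros s Hs.
    assert (Eq : (p s - p t)%C = (RtoC (s - t) * (z - z0))%C) by (unfold p; rewrite RtoC_minus; ring).
    assert (Hs' : Cmod (p s - p t) < d).
    { rewrite Eq, Cmod_mult, Cmod_R. apply Rle_lt_trans with (Rabs (s - t) * (Cmod (z - z0) + 1)).
      - apply Rmult_le_compat_l; [apply Rabs_pos|lra].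
      - apply Rmult_lt_reg_r with (/ (Cmod (z - z0) + 1)); [apply Rinv_0_lt_compat; lra|].
        rewrite Rmult_assoc, Rinv_r by lra. now rewrite Rmult_1_r. }
    destruct (H _ Hs') as [Ha Hb]. rewrite Ha, Eq, !Cmod_mult, Cmod_R.
    rewrite H2 in Hb. replace (g (p s) - 0)%C with (g (p s)) in Hb by ring.
    assert (Hr := Rabs_pos (s - t)).
    apply Rle_trans with (Rabs (s - t) * (Cmod (z - z0) + 1) * (eps / (Cmod (z - z0) + 1))).
    - apply Rmult_le_compat; [apply Rmult_le_pos; lra|apply Cmod_ge_0|apply Rmult_le_compat_l; lra|lra].
    - right. field. lra. }
  (* A real function with increments o(s - t) has derivative 0. The general [F] serves for both the
     real and the imaginary part of [f] along the segment. *)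
  assert (Hcore : forall F : R -> R, (forall t, 0 <= t <= 1 -> forall eps, 0 < eps -> exists d, 0 < d /\ forall s, Rabs (s - t) < d ->
     Rabs (F s - F t) <= eps * Rabs (s - t)) -> F 1 = F 0).
  { intros F HF. assert (HD : forall t, 0 <= t <= 1 -> derivable_pt_lim F t 0).
    { intros t Ht eps He. destruct (HF t Ht (eps / 2)) as [d [Hd0 H]]; [lra|].
      exists (mkposreal d Hd0). intros h Hh Hhd. cbn in Hhd.
      specialize (H (t + h)). replace (t + h - t) with h in H by ring. specialize (H Hhd).
      rewrite Rminus_0_r. unfold Rdiv. rewrite Rabs_mult, Rabs_inv.
      assert (0 < Rabs h) by now apply Rabs_pos_lt.
      apply Rmult_lt_reg_r with (Rabs h); [assumption|]. rewrite Rmult_assoc, Rinv_l by lra. nra. }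
    destruct (MVT_cor2 F (fun _ => 0) 0 1) as [c [Hc _]]; [lra|exact HD|lra]. }
  assert (E0 : p 0 = z0) by (unfold p; ring).
  assert (E1 : p 1 = z) by (unfold p; ring).
  rewrite <- E1, <- E0.
  assert (HRe : Re (f (p 1)) = Re (f (p 0))).
  { apply (Hcore (fun t => Re (f (p t)))). intros t Ht eps He. destruct (Hq t Ht eps He) as [d [Hd0 H]].
    exists d. split; [exact Hd0|]. intros s Hs. eapply Rle_trans; [|now apply H].
    apply (re_le_Cmod (f (p s) - f (p t))). }
  assert (HIm : Im (f (p 1)) = Im (f (p 0))).
  { apply (Hcore (fun t => Im (f (p t)))). intros t Ht eps He. destruct (Hq t Ht eps He) as [d [Hd0 H]].
    exists d. split; [exact Hd0|]. intros s Hs. eapply Rle_trans; [|now apply H].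
    apply (im_le_Cmod (f (p s) - f (p t))). }
  now apply injective_projections.
Qed.


(** * Series *)

(** The index [n] is excluded, unlike in [sum_n]; hence the shift by one in [sum_n_psum]. *)
Fixpoint psum (a : nat -> C) (n : nat) : C :=
  match n with O => RtoC 0 | S m => (psum a m + a m)%C end.

Fixpoint rsum (a : nat -> R) (n : nat) : R :=
  match n with O => 0 | S m => rsum a m + a m end.

Definition csum (a : nat -> C) (l : C) : Prop := clim eventually (psum a) l.

Lemma CLim_seq_clim (u : nat -> C) (l : C) : clim eventually u l -> CLim_seq u = l.
Proof.
  intros H. apply CLim_seq_unique. intros P [eps HP]. unfold filtermap. generalize (H eps (cond_pos eps)).
  apply filter_imp. intros n Hn. apply HP. now apply C_NormedModule_mixin_compat1.
Qed.

Lemma psum_ext (a b : nat -> C) (n : nat) : (forall k, (k < n)%nat -> a k = b k) -> psum a n = psum b n.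
Proof. induction n as [|n IH]; intros H; cbn; [reflexivity|]. rewrite IH, H; auto. Qed.

Lemma rsum_ext (a b : nat -> R) (n : nat) : (forall k, (k < n)%nat -> a k = b k) -> rsum a n = rsum b n.
Proof. induction n as [|n IH]; intros H; cbn; [reflexivity|]. rewrite IH, H; auto. Qed.

Lemma psum_plus (a b : nat -> C) (n : nat) : psum (fun k => a k + b k)%C n = (psum a n + psum b n)%C.
Proof. induction n as [|n IH]; cbn; [ring|]. rewrite IH; ring. Qed.

Lemma psum_scal (c : C) (a : nat -> C) (n : nat) : psum (fun k => c * a k)%C n = (c * psum a n)%C.
Proof. induction n as [|n IH]; cbn; [ring|]. rewrite IH; ring. Qed.

Lemma psum_app (a : nat -> C) (n m : nat) : psum a (n + m) = (psum a n + psum (fun k => a (n + k)%nat) m)%C.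
Proof.
  induction m as [|m IH]; [rewrite Nat.add_0_r; cbn; ring|].
  rewrite Nat.add_succ_r; cbn. rewrite IH; ring.
Qed.

Lemma psum_RtoC (a : nat -> R) (n : nat) : psum (fun k => RtoC (a k)) n = RtoC (rsum a n).
Proof. induction n as [|n IH]; cbn; [reflexivity|]. now rewrite IH, RtoC_plus. Qed.

Lemma rsum_le (a b : nat -> R) (n : nat) : (forall k, (k < n)%nat -> a k <= b k) -> rsum a n <= rsum b n.
Proof. induction n as [|n IH]; intros H; cbn; [lra|]. apply Rplus_le_compat; auto. Qed.

Lemma rsum_const (c : R) (n : nat) : rsum (fun _ => c) n = INR n * c.
Proof. induction n as [|n IH]; [cbn; ring|]. rewrite S_INR; cbn [rsum]. rewrite IH; ring. Qed.

Lemma rsum_scal (c : R) (a : nat -> R) (n : nat) : rsum (fun k => c * a k) n = c * rsum a n.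
Proof. induction n as [|n IH]; cbn; [ring|]. rewrite IH; ring. Qed.

Lemma psum_mod (a : nat -> C) (M : nat -> R) (n : nat) :
  (forall k, (k < n)%nat -> Cmod (a k) <= M k) -> Cmod (psum a n) <= rsum M n.
Proof.
  induction n as [|n IH]; intros H; cbn; [rewrite Cmod_0; lra|].
  eapply Rle_trans; [apply Cmod_triangle|]. apply Rplus_le_compat; auto.
Qed.

Lemma sum_n_psum (a : nat -> C) (n : nat) : sum_n a n = psum a (S n).
Proof.
  induction n as [|n IH]; [rewrite sum_O; cbn; ring|].
  rewrite sum_Sn, IH. reflexivity.
Qed.

Lemma sum_n_rsum (a : nat -> R) (n : nat) : sum_n a n = rsum a (S n).
Proof.
  induction n as [|n IH]; [rewrite sum_O; cbn; ring|].
  rewrite sum_Sn, IH. reflexivity.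
Qed.

Lemma csum_CSeries (a : nat -> C) (l : C) : csum a l -> CSeries a = l.
Proof.
  intros H. apply CLim_seq_clim. apply clim_ext_all with (fun n => psum a (S n)).
  - intros n. now rewrite sum_n_psum.
  - intros eps He. destruct (H eps He) as [N HN]. exists N. intros n Hn. apply HN. lia.
Qed.

Lemma csum_unique (a : nat -> C) (l m : C) : csum a l -> csum a m -> l = m.
Proof. apply clim_unique. Qed.

Lemma csum_ext (a b : nat -> C) (l : C) : (forall n, a n = b n) -> csum a l -> csum b l.
Proof. intros H. apply clim_ext_all. intros n. apply psum_ext. auto. Qed.

Lemma CSeries_ext (a b : nat -> C) : (forall n, a n = b n) -> CSeries a = CSeries b.
Proof.
  intros H. unfold CSeries, CLim_seq.
  f_equal; f_equal; apply Lim_seq_ext; intros n; now rewrite (sum_n_ext a b).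
Qed.

Lemma csum_plus (a b : nat -> C) (l m : C) : csum a l -> csum b m -> csum (fun n => a n + b n)%C (l + m)%C.
Proof.
  intros H1 H2. apply clim_ext_all with (fun n => psum a n + psum b n)%C.
  - intros n. now rewrite psum_plus.
  - now apply clim_plus.
Qed.

Lemma csum_scal (c : C) (a : nat -> C) (l : C) : csum a l -> csum (fun n => c * a n)%C (c * l)%C.
Proof.
  intros H. apply clim_ext_all with (fun n => c * psum a n)%C.
  - intros n. now rewrite psum_scal.
  - apply clim_mult; [apply clim_const|exact H].
Qed.

Lemma csum_zero : csum (fun _ => RtoC 0) 0.
Proof.
  apply clim_ext_all with (fun _ => RtoC 0); [|apply clim_const].
  induction t as [|n IH]; cbn; [reflexivity|]. rewrite <- IH; ring.
Qed.

Lemma csum_incr (a : nat -> C) (l : C) : csum (fun n => a (S n)) l <-> csum a (a O + l)%C.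
Proof.
  assert (E : forall n, psum a (S n) = (a O + psum (fun k => a (S k)) n)%C).
  { intros n. change (S n) with (1 + n)%nat. rewrite psum_app. cbn. ring. }
  split; intros H eps He; destruct (H eps He) as [N HN].
  - exists (S N). intros [|n] Hn; [lia|]. rewrite E.
    replace (a O + psum (fun k => a (S k)) n - (a O + l))%C with (psum (fun k => a (S k)) n - l)%C by ring.
    apply HN; lia.
  - exists N. intros n Hn. specialize (HN (S n)). rewrite E in HN.
    replace (a O + psum (fun k => a (S k)) n - (a O + l))%C with (psum (fun k => a (S k)) n - l)%C in HN by ring.
    apply HN; lia.
Qed.

Lemma rsum_lim (M : nat -> R) : ex_series M -> is_lim_seq (rsum M) (Series M).
Proof.
  intros H. apply is_lim_seq_incr_1. apply Series_correct in H.
  apply is_lim_seq_ext with (sum_n M); [|exact H]. intros n. apply sum_n_rsum.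
Qed.

Lemma rsum_mono (M : nat -> R) (n m : nat) : (forall k, 0 <= M k) -> (n <= m)%nat -> rsum M n <= rsum M m.
Proof. intros HM H. induction H as [|m H IH]; [lra|]. cbn. specialize (HM m). lra. Qed.

Lemma rsum_le_Series (M : nat -> R) (n : nat) : (forall k, 0 <= M k) -> ex_series M -> rsum M n <= Series M.
Proof.
  intros HM H. apply rsum_lim in H.
  apply (is_lim_seq_le_loc (fun _ => rsum M n) (rsum M) (rsum M n) (Series M)); [|apply is_lim_seq_const|exact H].
  exists n. intros m Hm. now apply rsum_mono.
Qed.

Lemma ex_csum (a : nat -> C) (M : nat -> R) :
  (forall n, Cmod (a n) <= M n) -> ex_series M -> csum a (CSeries a).
Proof.
  intros H HM.
  assert (HR : ex_series (fun n => Re (a n))).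
  { apply (ex_series_le (K := R_AbsRing) (V := R_CompleteNormedModule) _ M); [|exact HM].
    intros n. eapply Rle_trans; [apply re_le_Cmod|apply H]. }
  assert (HI : ex_series (fun n => Im (a n))).
  { apply (ex_series_le (K := R_AbsRing) (V := R_CompleteNormedModule) _ M); [|exact HM].
    intros n. eapply Rle_trans; [apply im_le_Cmod|apply H]. }
  set (l := (Series (fun n => Re (a n)), Series (fun n => Im (a n))) : C).
  assert (Hl : csum a l).
  { intros eps He. apply rsum_lim in HR, HI.
    apply is_lim_seq_spec in HR, HI. assert (He2 : 0 < eps / 2) by lra.
    generalize (filter_and _ _ (HR (mkposreal _ He2)) (HI (mkposreal _ He2))).
    apply filter_imp. intros n [H1 H2]. cbn in H1, H2.
    assert (E : psum a n = (rsum (fun n => Re (a n)) n, rsum (fun n => Im (a n)) n)).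
    { clear. induction n as [|n IH]; cbn; [reflexivity|]. rewrite IH. reflexivity. }
    rewrite E. eapply Rle_lt_trans; [apply Cmod_2Rmax|]. unfold l; cbn.
    assert (Hs : sqrt 2 < 2). { rewrite <- (sqrt_square 2) at 2 by lra. apply sqrt_lt_1; lra. }
    assert (Hs0 := sqrt_pos 2).
    apply Rlt_le_trans with (2 * (eps / 2)); [|lra].
    apply Rle_lt_trans with (2 * Rmax (Rabs (rsum (fun n => Re (a n)) n + - Series (fun n => Re (a n))))
      (Rabs (rsum (fun n => Im (a n)) n + - Series (fun n => Im (a n))))).
    - apply Rmult_le_compat_r; [|lra]. eapply Rle_trans; [apply Rabs_pos|apply Rmax_l].
    - apply Rmult_lt_compat_l; [lra|]. now apply Rmax_lub_lt. }
  now rewrite (csum_CSeries _ _ Hl).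
Qed.

Lemma csum_mod_le (a : nat -> C) (M : nat -> R) (l : C) :
  (forall n, Cmod (a n) <= M n) -> ex_series M -> csum a l -> Cmod l <= Series M.
Proof.
  intros H HM Hl. apply (clim_mod_le _ _ _ Hl). apply filter_forall. intros n.
  eapply Rle_trans; [apply psum_mod; intros; apply H|]. apply rsum_le_Series; [|exact HM].
  intros k. eapply Rle_trans; [apply Cmod_ge_0|apply H].
Qed.

(** The bound involves the majorant alone, so it is uniform over any family with a common majorant;
    [tannery] relies on this. *)
Lemma csum_tail (a : nat -> C) (M : nat -> R) (l : C) (N : nat) :
  (forall n, Cmod (a n) <= M n) -> ex_series M -> csum a l -> Cmod (l - psum a N) <= Series M - rsum M N.
Proof.
  intros H HM Hl.
  apply (clim_mod_le (F := eventually) (fun n => psum a n - psum a N)%C).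
  - apply clim_minus; [exact Hl|apply clim_const].
  - exists N. intros n Hn. replace n with (N + (n - N))%nat by lia. rewrite psum_app.
    replace (psum a N + psum (fun k => a (N + k)%nat) (n - N) - psum a N)%C
      with (psum (fun k => a (N + k)%nat) (n - N)) by ring.
    assert (E : rsum M (N + (n - N)) = rsum M N + rsum (fun k => M (N + k)%nat) (n - N)).
    { generalize (n - N)%nat. intros k. clear. induction k as [|k IH]; [rewrite Nat.add_0_r; cbn; ring|].
      rewrite Nat.add_succ_r; cbn. rewrite IH; ring. }
    assert (HM0 : forall k, 0 <= M k) by (intros k; eapply Rle_trans; [apply Cmod_ge_0|apply H]).
    assert (H1 := rsum_le_Series M (N + (n - N)) HM0 HM). rewrite E in H1.
    eapply Rle_trans; [apply (psum_mod _ (fun k => M (N + k)%nat)); auto|lra].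
Qed.

Section Tannery.
Context {T : Type} {F : (T -> Prop) -> Prop} {FF : ProperFilter F}.

Lemma clim_psum (a : T -> nat -> C) (b : nat -> C) (N : nat) :
  (forall n, clim F (fun t => a t n) (b n)) -> clim F (fun t => psum (a t) N) (psum b N).
Proof. intros H. induction N as [|N IH]; cbn; [apply clim_const|now apply clim_plus]. Qed.

(** Dominated convergence for series: both tails are below eps / 3 through [M], and the finite head
    converges term by term. Exchange of double sums, differentiation of power series and the
    Lipschitz formula all reduce to it. *)
Lemma tannery (a : T -> nat -> C) (b : nat -> C) (M : nat -> R) (S : T -> C) :
  ex_series M -> F (fun t => forall n, Cmod (a t n) <= M n) ->
  (forall n, clim F (fun t => a t n) (b n)) ->
  F (fun t => csum (a t) (S t)) -> clim F S (CSeries b) /\ csum b (CSeries b).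
Proof.
  intros HM Ha Hb HS.
  assert (Hb' : forall n, Cmod (b n) <= M n).
  { intros n. apply (clim_mod_le _ _ _ (Hb n)). revert Ha. apply filter_imp. auto. }
  assert (Hs := ex_csum b M Hb' HM). split; [|exact Hs].
  intros eps He.
  assert (HN : exists N, Series M - rsum M N < eps / 3).
  { assert (HL := rsum_lim M HM). apply is_lim_seq_spec in HL.
    assert (He3 : 0 < eps / 3) by lra. destruct (HL (mkposreal _ He3)) as [N HN].
    exists N. specialize (HN N (le_n _)). cbn in HN. apply Rabs_def2 in HN. lra. }
  destruct HN as [N HN]. assert (He3 : 0 < eps / 3) by lra.
  generalize (filter_and _ _ Ha (filter_and _ _ HS (clim_psum a b N Hb _ He3))).
  apply filter_imp. intros t [H1 [H2 H3]].
  assert (T1 := csum_tail _ M _ N H1 HM H2). assert (T2 := csum_tail _ M _ N Hb' HM Hs).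
  replace (S t - CSeries b)%C
    with ((S t - psum (a t) N) + (psum (a t) N - psum b N) + - (CSeries b - psum b N))%C by ring.
  eapply Rle_lt_trans; [apply Cmod_triangle|]. rewrite Cmod_opp.
  assert (T3 := Cmod_triangle (S t - psum (a t) N) (psum (a t) N - psum b N)). lra.
Qed.

End Tannery.

Lemma psum_csum (a : nat -> nat -> C) (r : nat -> C) (M : nat) :
  (forall m, csum (a m) (r m)) -> csum (fun n => psum (fun m => a m n) M) (psum r M).
Proof.
  intros H. induction M as [|M IH]; cbn; [apply csum_zero|now apply csum_plus].
Qed.

(** [tannery] with the number [M] of rows as parameter; accordingly [B] dominates the partial column
    sums uniformly in [M]. *)
Lemma fubini (a : nat -> nat -> C) (r c : nat -> C) (B : nat -> R) :
  ex_series B ->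
  (forall m, csum (a m) (r m)) -> (forall n, csum (fun m => a m n) (c n)) ->
  (forall M n, Cmod (psum (fun m => a m n) M) <= B n) ->
  csum r (CSeries c) /\ csum c (CSeries c).
Proof.
  intros HB Hr Hc HBd.
  apply (tannery (F := eventually) (fun M n => psum (fun m => a m n) M) c B (psum r)); auto.
  - now apply filter_forall.
  - apply filter_forall. intros M. now apply psum_csum.
Qed.

(** * Power series with coefficients of polynomial growth *)

(** A class containing divisor sums, hypergeometric coefficients and the coefficients of the
    logarithm. It is stable under sum, product, shift, derivative and convolution, and it guarantees
    convergence on the whole unit disc. *)
Definition polyg (a : nat -> C) : Prop :=
  exists (K : R) (k : nat), 0 <= K /\ forall n, Cmod (a n) <= K * (INR n + 1) ^ k.

Lemma ex_series_poly_geom (k : nat) (r : R) : 0 <= r < 1 -> ex_series (fun n => (INR n + 1) ^ k * r ^ n).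
Proof.
  (* The ratio test is applied with [s] in place of [r]: it needs nonzero terms, and [r] may be
     0. *)
  intros Hr. set (s := (1 + r) / 2). assert (Hs : 0 < s < 1 /\ r <= s) by (unfold s; lra).
  assert (Hp : forall n, 0 < INR n + 1) by (intros n; assert (H := pos_INR n); lra).
  apply (ex_series_le (K := R_AbsRing) (V := R_CompleteNormedModule) _ (fun n => Rabs ((INR n + 1) ^ k * s ^ n))).
  { intros n. change (Rabs ((INR n + 1) ^ k * r ^ n) <= Rabs ((INR n + 1) ^ k * s ^ n)).
    specialize (Hp n). assert (0 < (INR n + 1) ^ k) by now apply pow_lt.
    assert (0 <= r ^ n <= s ^ n). { split; [apply pow_le; lra|apply pow_incr; lra]. }
    rewrite !Rabs_right; nra. }
  apply ex_series_DAlembert with s; [lra| |].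
  - intros n. specialize (Hp n). apply Rgt_not_eq. apply Rmult_lt_0_compat; apply pow_lt; lra.
  - apply is_lim_seq_ext with (fun n => (1 + / (INR n + 1)) ^ k * s).
    + intros n. specialize (Hp n).
      replace ((INR (S n) + 1) ^ k * s ^ S n / ((INR n + 1) ^ k * s ^ n)) with ((1 + / (INR n + 1)) ^ k * s).
      * rewrite Rabs_right; [reflexivity|]. apply Rle_ge, Rmult_le_pos; [|lra].
        apply pow_le. assert (0 < / (INR n + 1)) by now apply Rinv_0_lt_compat. lra.
      * rewrite S_INR. replace (INR n + 1 + 1) with ((1 + / (INR n + 1)) * (INR n + 1)) by (field; lra).
        rewrite Rpow_mult_distr. cbn [pow]. field. split; apply pow_nonzero; lra.
    + replace (Finite s) with (Rbar_mult (1 ^ k) s) by (cbn; f_equal; rewrite pow1; ring).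
      apply is_lim_seq_mult'; [|apply is_lim_seq_const].
      assert (L : is_lim_seq (fun n => 1 + / (INR n + 1)) 1).
      { replace (Finite 1) with (Rbar_plus 1 0) by (cbn; f_equal; ring).
        apply is_lim_seq_plus'; [apply is_lim_seq_const|].
        replace (Finite 0) with (Rbar_inv p_infty) by reflexivity.
        apply is_lim_seq_inv; [|discriminate].
        apply is_lim_seq_ext with (fun n => INR (S n)); [intros; apply S_INR|].
        apply -> is_lim_seq_incr_1. apply is_lim_seq_INR. }
      induction k as [|k IH]; cbn [pow]; [apply is_lim_seq_const|].
      now apply is_lim_seq_mult'.
Qed.

Lemma polyg_dom (a : nat -> C) : polyg a -> forall r, 0 <= r < 1 ->
  exists M, ex_series M /\ forall n z, Cmod z <= r -> Cmod (a n * z ^ n) <= M n.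
Proof.
  intros [K [k [HK H]]] r Hr. exists (fun n => K * ((INR n + 1) ^ k * r ^ n)). split.
  - apply (ex_series_scal_l (V := R_NormedModule) K). now apply ex_series_poly_geom.
  - intros n z Hz. rewrite Cmod_mult, Cmod_pow, <- Rmult_assoc.
    apply Rmult_le_compat; [apply Cmod_ge_0|apply pow_le, Cmod_ge_0|apply H|].
    apply pow_incr. split; [apply Cmod_ge_0|exact Hz].
Qed.

Definition PS (a : nat -> C) (z : C) : C := CSeries (fun n => a n * z ^ n)%C.

Lemma PS_csum (a : nat -> C) (z : C) : polyg a -> Cmod z < 1 -> csum (fun n => a n * z ^ n)%C (PS a z).
Proof.
  intros Ha Hz. destruct (polyg_dom a Ha (Cmod z)) as [M [HM H]].
  - split; [apply Cmod_ge_0|exact Hz].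
  - apply ex_csum with M; [|exact HM]. intros n. apply H. lra.
Qed.

Lemma PS_unique (a : nat -> C) (z l : C) : csum (fun n => a n * z ^ n)%C l -> PS a z = l.
Proof. apply csum_CSeries. Qed.

Lemma PS_ext (a b : nat -> C) (z : C) : (forall n, a n = b n) -> PS a z = PS b z.
Proof. intros H. apply CSeries_ext. intros n. now rewrite H. Qed.

Lemma polyg_ext (a b : nat -> C) : (forall n, a n = b n) -> polyg a -> polyg b.
Proof. intros H [K [k [HK Ha]]]. exists K, k. split; [exact HK|]. intros n. now rewrite <- H. Qed.

Lemma INR1_pow_le (n k l : nat) : (k <= l)%nat -> (INR n + 1) ^ k <= (INR n + 1) ^ l.
Proof. intros H. apply Rle_pow; [|exact H]. assert (H' := pos_INR n). lra. Qed.

Lemma INR1_pow_pos (n k : nat) : 0 < (INR n + 1) ^ k.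
Proof. apply pow_lt. assert (H' := pos_INR n). lra. Qed.

Lemma polyg_plus (a b : nat -> C) : polyg a -> polyg b -> polyg (fun n => a n + b n)%C.
Proof.
  intros [K [k [HK Ha]]] [L [l [HL Hb]]]. exists (K + L), (k + l)%nat. split; [lra|].
  intros n. eapply Rle_trans; [apply Cmod_triangle|]. rewrite Rmult_plus_distr_r.
  apply Rplus_le_compat; [eapply Rle_trans; [apply Ha|]|eapply Rle_trans; [apply Hb|]];
    apply Rmult_le_compat_l; try assumption; apply INR1_pow_le; lia.
Qed.

Lemma polyg_mult (a b : nat -> C) : polyg a -> polyg b -> polyg (fun n => a n * b n)%C.
Proof.
  intros [K [k [HK Ha]]] [L [l [HL Hb]]]. exists (K * L), (k + l)%nat. split; [nra|].
  intros n. rewrite Cmod_mult, pow_add.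
  replace (K * L * ((INR n + 1) ^ k * (INR n + 1) ^ l)) with ((K * (INR n + 1) ^ k) * (L * (INR n + 1) ^ l)) by ring.
  apply Rmult_le_compat; auto using Cmod_ge_0.
Qed.

Lemma polyg_const (c : C) : polyg (fun _ => c).
Proof. exists (Cmod c), O. split; [apply Cmod_ge_0|]. intros n. cbn. lra. Qed.

Lemma polyg_scal (c : C) (a : nat -> C) : polyg a -> polyg (fun n => c * a n)%C.
Proof. intros H. apply polyg_mult; [apply polyg_const|exact H]. Qed.

Lemma polyg_INR : polyg (fun n => RtoC (INR n)).
Proof.
  exists 1, 1%nat. split; [lra|]. intros n. rewrite Cmod_R, Rabs_right by (apply Rle_ge, pos_INR).
  cbn. lra.
Qed.

Lemma polyg_shift (a : nat -> C) : polyg a -> polyg (fun n => a (S n)).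
Proof.
  intros [K [k [HK Ha]]]. exists (K * 2 ^ k), k. split; [apply Rmult_le_pos; [lra|apply pow_le; lra]|].
  intros n. eapply Rle_trans; [apply Ha|]. rewrite Rmult_assoc, <- Rpow_mult_distr.
  apply Rmult_le_compat_l; [lra|]. rewrite S_INR. assert (H := pos_INR n). apply pow_incr. lra.
Qed.

Lemma PS_plus (a b : nat -> C) (z : C) : polyg a -> polyg b -> Cmod z < 1 ->
  PS (fun n => a n + b n)%C z = (PS a z + PS b z)%C.
Proof.
  intros Ha Hb Hz. apply PS_unique.
  apply csum_ext with (fun n => a n * z ^ n + b n * z ^ n)%C; [intros; ring|].
  apply csum_plus; now apply PS_csum.
Qed.

Lemma PS_scal (c : C) (a : nat -> C) (z : C) : polyg a -> Cmod z < 1 ->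
  PS (fun n => c * a n)%C z = (c * PS a z)%C.
Proof.
  intros Ha Hz. apply PS_unique.
  apply csum_ext with (fun n => c * (a n * z ^ n))%C; [intros; ring|].
  apply csum_scal; now apply PS_csum.
Qed.

Lemma PS_decr (a : nat -> C) (z : C) : polyg a -> Cmod z < 1 ->
  PS a z = (a O + z * PS (fun n => a (S n)) z)%C.
Proof.
  intros Ha Hz. apply PS_unique.
  replace (a O + z * PS (fun n => a (S n)) z)%C
    with (a O * z ^ 0 + z * PS (fun n => a (S n)) z)%C by (cbn; ring).
  apply (csum_incr (fun n => a n * z ^ n)%C).
  apply csum_ext with (fun n => z * (a (S n) * z ^ n))%C; [intros; cbn; ring|].
  apply csum_scal, PS_csum; [now apply polyg_shift|exact Hz].
Qed.

Lemma PS_0 (a : nat -> C) : polyg a -> PS a 0 = a O.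
Proof. intros Ha. rewrite PS_decr; [ring|exact Ha|]. rewrite Cmod_0; lra. Qed.

(** The quotient (w^n - z^n) / (w - z) as a polynomial, meaningful also for w = z: the slope of the
    n-th power. *)
Fixpoint pdq (n : nat) (w z : C) : C :=
  match n with O => RtoC 0 | S m => (w ^ m + z * pdq m w z)%C end.

Lemma pdq_spec (n : nat) (w z : C) : (w ^ n - z ^ n = (w - z) * pdq n w z)%C.
Proof.
  induction n as [|n IH]; cbn [pdq Cpow]; [ring|].
  replace ((w - z) * (w ^ n + z * pdq n w z))%C with ((w - z) * w ^ n + z * ((w - z) * pdq n w z))%C by ring.
  rewrite <- IH. ring.
Qed.

Lemma pdq_mod (n : nat) (w z : C) (r : R) : 0 <= r ->
  Cmod w <= r -> Cmod z <= r -> Cmod (pdq n w z) <= INR n * r ^ pred n.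
Proof.
  intros Hr Hw Hz. induction n as [|n IH]; [cbn; rewrite Cmod_0; lra|].
  cbn [pdq pred]. eapply Rle_trans; [apply Cmod_triangle|]. rewrite S_INR, Cmod_mult, Cmod_pow.
  assert (H1 : Cmod w ^ n <= r ^ n) by (apply pow_incr; split; [apply Cmod_ge_0|exact Hw]).
  assert (H2 : Cmod z * Cmod (pdq n w z) <= r * (INR n * r ^ pred n))
    by (apply Rmult_le_compat; auto using Cmod_ge_0).
  assert (H3 : r * (INR n * r ^ pred n) = INR n * r ^ n) by (destruct n; cbn [pred pow INR]; ring).
  lra.
Qed.

Lemma pdq_diag (n : nat) (z : C) : pdq n z z = (RtoC (INR n) * z ^ pred n)%C.
Proof.
  induction n as [|n IH]; [cbn; ring|].
  cbn [pdq pred]. rewrite IH, S_INR, RtoC_plus. destruct n; cbn [pred Cpow INR]; ring.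
Qed.

Lemma pdq_cont (n : nat) (z : C) : ccont (fun w => pdq n w z) z.
Proof.
  induction n as [|n IH]; cbn [pdq]; [apply ccont_const|].
  apply ccont_plus; [apply ccont_pow, ccont_id|]. apply ccont_mult; [apply ccont_const|exact IH].
Qed.

Definition dcoef (a : nat -> C) (n : nat) : C := (RtoC (INR (S n)) * a (S n))%C.

Lemma polyg_dcoef (a : nat -> C) : polyg a -> polyg (dcoef a).
Proof.
  intros Ha. apply (polyg_shift (fun n => RtoC (INR n) * a n)%C).
  apply polyg_mult; [apply polyg_INR|exact Ha].
Qed.

(** The slope is the series of the slopes [pdq]. On the disc of radius [r], midway between |z| and
    1, it is dominated by n |a n| r^(n-1), and [tannery] gives its continuity at [z]. *)
Lemma PS_deriv (a : nat -> C) (z : C) : polyg a -> Cmod z < 1 -> cderiv (PS a) z (PS (dcoef a) z).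
Proof.
  intros Ha Hz. assert (Hz0 := Cmod_ge_0 z).
  set (r := (1 + Cmod z) / 2). assert (Hr : 0 < r < 1 /\ Cmod z < r) by (unfold r; lra).
  destruct (polyg_dom (fun n => RtoC (INR n) * a n)%C) with (r := r) as [M [HM HMb]];
    [apply polyg_mult; [apply polyg_INR|exact Ha]|lra|].
  assert (Hdom : forall n w, Cmod w <= r -> Cmod (a n * pdq n w z) <= / r * M n).
  { intros n w Hw. rewrite Cmod_mult.
    assert (Hp := pdq_mod n w z r ltac:(lra) Hw ltac:(lra)).
    specialize (HMb n (RtoC r)). rewrite Cmod_R, Rabs_right in HMb by lra. specialize (HMb ltac:(lra)).
    rewrite !Cmod_mult, Cmod_pow, !Cmod_R, (Rabs_right r) in HMb by lra.
    rewrite (Rabs_right (INR n)) in HMb by (apply Rle_ge, pos_INR).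
    assert (HE : INR n * r ^ pred n = / r * (INR n * r ^ n)).
    { destruct n; cbn [pred pow INR]; [ring|field; lra]. }
    apply Rle_trans with (Cmod (a n) * (/ r * (INR n * r ^ n))).
    - apply Rmult_le_compat_l; [apply Cmod_ge_0|lra].
    - replace (Cmod (a n) * (/ r * (INR n * r ^ n))) with (/ r * (INR n * Cmod (a n) * r ^ n)) by ring.
      apply Rmult_le_compat_l; [|exact HMb]. apply Rlt_le, Rinv_0_lt_compat; lra. }
  assert (HM' : ex_series (fun n => / r * M n)) by now apply (ex_series_scal_l (V := R_NormedModule) (/ r)).
  assert (Hnb : cnbhs z (fun w => Cmod w <= r)).
  { assert (Cz := ccont_mod_lt (fun w => w) z r (ccont_id z)). cbn in Cz. destruct Cz as [d [Hd H]]; [lra|].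
    exists d. split; [exact Hd|]. intros w Hw. apply Rlt_le, H, Hw. }
  set (g := fun w => CSeries (fun n => a n * pdq n w z)%C).
  assert (Hg : forall w, Cmod w <= r -> csum (fun n => a n * pdq n w z)%C (g w)).
  { intros w Hw. apply ex_csum with (fun n => / r * M n); [|exact HM']. intros n. now apply Hdom. }
  exists g. repeat split.
  - revert Hnb. apply filter_imp. intros w Hw.
    apply (csum_unique (fun n => (w - z) * (a n * pdq n w z))%C).
    + apply csum_ext with (fun n => a n * w ^ n + - (1) * (a n * z ^ n))%C.
      { intros n. replace ((w - z) * (a n * pdq n w z))%C with (a n * ((w - z) * pdq n w z))%C by ring.
        rewrite <- pdq_spec. ring. }
      replace (PS a w - PS a z)%C with (PS a w + - (1) * PS a z)%C by ring.
      apply csum_plus; [apply PS_csum; [exact Ha|lra]|]. apply csum_scal, PS_csum; [exact Ha|lra].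
    + apply csum_scal. now apply Hg.
  - symmetry. apply PS_unique. apply csum_ext with (fun n => a (S n) * pdq (S n) z z)%C.
    + intros n. rewrite pdq_diag. unfold dcoef. cbn [pred]. ring.
    + apply (csum_incr (fun n => a n * pdq n z z)%C). cbn [pdq].
      replace (a O * 0 + g z)%C with (g z) by ring. apply Hg. lra.
  - apply (tannery (F := cnbhs z) (fun w n => a n * pdq n w z)%C (fun n => a n * pdq n z z)%C
      (fun n => / r * M n) g HM').
    + revert Hnb. apply filter_imp. intros w Hw n. now apply Hdom.
    + intros n. apply clim_mult; [apply clim_const|apply pdq_cont].
    + revert Hnb. apply filter_imp. apply Hg.
Qed.

Definition conv (a b : nat -> C) (n : nat) : C := psum (fun m => a m * b (n - m)%nat)%C (S n).

Lemma csum_finite (a : nat -> C) (N : nat) : (forall n, (N <= n)%nat -> a n = 0) -> csum a (psum a N).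
Proof.
  intros H eps He. exists N. intros n Hn. replace n with (N + (n - N))%nat by lia. rewrite psum_app.
  assert (E : forall k, psum (fun k => a (N + k)%nat) k = 0).
  { induction k as [|k IH]; cbn; [reflexivity|]. rewrite IH, H by lia. ring. }
  rewrite E. replace (psum a N + 0 - psum a N)%C with (RtoC 0) by ring. now rewrite Cmod_0.
Qed.

(** Uniformity in [M] is what [fubini] asks for; the extra 1 in the exponent counts the n + 1
    nonzero terms. *)
Lemma conv_mod (a b : nat -> C) (K L : R) (k l n : nat) : 0 <= K -> 0 <= L ->
  (forall n, Cmod (a n) <= K * (INR n + 1) ^ k) -> (forall n, Cmod (b n) <= L * (INR n + 1) ^ l) ->
  forall M, Cmod (psum (fun m => if (m <=? n)%nat then a m * b (n - m)%nat else 0)%C M)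
    <= K * L * (INR n + 1) ^ (1 + k + l).
Proof.
  intros HK HL Ha Hb M.
  set (c := K * L * (INR n + 1) ^ (k + l)).
  assert (Hc : 0 <= c).
  { unfold c. apply Rmult_le_pos; [now apply Rmult_le_pos|]. apply Rlt_le, INR1_pow_pos. }
  apply Rle_trans with (rsum (fun m => if (m <=? n)%nat then c else 0) M).
  - apply psum_mod. intros m _. destruct (Nat.leb_spec m n) as [Hm|Hm]; [|rewrite Cmod_0; lra].
    rewrite Cmod_mult. unfold c. rewrite pow_add.
    replace (K * L * ((INR n + 1) ^ k * (INR n + 1) ^ l)) with ((K * (INR n + 1) ^ k) * (L * (INR n + 1) ^ l)) by ring.
    assert (Hle : forall i j p, (i <= j)%nat -> (INR i + 1) ^ p <= (INR j + 1) ^ p).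
    { intros i j p Hij. apply pow_incr. apply le_INR in Hij. assert (Hi := pos_INR i). lra. }
    apply Rmult_le_compat; auto using Cmod_ge_0.
    + eapply Rle_trans; [apply Ha|]. apply Rmult_le_compat_l; [exact HK|apply Hle; lia].
    + eapply Rle_trans; [apply Hb|]. apply Rmult_le_compat_l; [exact HL|apply Hle; lia].
  - replace (K * L * (INR n + 1) ^ (1 + k + l)) with ((INR n + 1) * c) by (unfold c; cbn [pow Nat.add]; ring).
    assert (E : forall M, rsum (fun m => if (m <=? n)%nat then c else 0) M = INR (min M (S n)) * c).
    { clear M. induction M as [|M IH]; [cbn; ring|]. cbn [rsum]. rewrite IH.
      destruct (Nat.leb_spec M n) as [Hm|Hm].
      - rewrite !Nat.min_l by lia. rewrite S_INR. ring.
      - rewrite !Nat.min_r by lia. ring. }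
    rewrite E, <- S_INR. apply Rmult_le_compat_r; [exact Hc|]. apply le_INR. lia.
Qed.

Lemma conv_alt (a b : nat -> C) (n : nat) :
  conv a b n = psum (fun m => if (m <=? n)%nat then a m * b (n - m)%nat else 0)%C (S n).
Proof.
  apply psum_ext. intros m Hm. destruct (Nat.leb_spec m n); [reflexivity|lia].
Qed.

Lemma polyg_conv (a b : nat -> C) : polyg a -> polyg b -> polyg (conv a b).
Proof.
  intros [K [k [HK Ha]]] [L [l [HL Hb]]]. exists (K * L), (1 + k + l)%nat. split; [nra|].
  intros n. rewrite conv_alt. now apply conv_mod.
Qed.

Lemma PS_mult (a b : nat -> C) (z : C) : polyg a -> polyg b -> Cmod z < 1 ->
  (PS a z * PS b z)%C = PS (conv a b) z.
Proof.
  intros Ha Hb Hz.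
  (* Row m is a m z^m times the second series, shifted by m places; column n then sums to the n-th
     term of the Cauchy product. *)
  set (t := fun m n => ((if (m <=? n)%nat then a m * b (n - m)%nat else 0) * z ^ n)%C).
  assert (Hrow : forall m, csum (t m) (a m * z ^ m * PS b z)%C).
  { intros m. unfold t.
    assert (G : forall j, csum (fun n => (if (j <=? n)%nat then a m * b (n - j)%nat else 0) * z ^ n)%C
       (a m * z ^ j * PS b z)%C).
    { induction j as [|j IH].
      - apply csum_ext with (fun n => a m * (b n * z ^ n))%C.
        + intros n. rewrite Nat.sub_0_r. cbn. ring.
        + replace (a m * z ^ 0 * PS b z)%C with (a m * PS b z)%C by (cbn; ring).
          apply csum_scal. now apply PS_csum.
      - replace (a m * z ^ S j * PS b z)%C with
          ((fun n => (if (S j <=? n)%nat then a m * b (n - S j)%nat else 0) * z ^ n)%C O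
            + z * (a m * z ^ j * PS b z))%C by (cbn; ring).
        apply csum_incr. apply (csum_scal z) in IH. revert IH. apply csum_ext. intros n. cbn. ring. }
    apply G. }
  destruct Ha as [K [k [HK Ha']]]. destruct Hb as [L [l [HL Hb']]].
  assert (Ha : polyg a) by now exists K, k. assert (Hb : polyg b) by now exists L, l.
  destruct (fubini t (fun m => a m * z ^ m * PS b z)%C (fun n => conv a b n * z ^ n)%C
    (fun n => K * L * ((INR n + 1) ^ (1 + k + l) * Cmod z ^ n))) as [H1 H2].
  - apply (ex_series_scal_l (V := R_NormedModule) (K * L)). apply ex_series_poly_geom.
    split; [apply Cmod_ge_0|exact Hz].
  - exact Hrow.
  - intros n. rewrite conv_alt, Cmult_comm, <- psum_scal.
    rewrite (psum_ext _ (fun m => t m n)) by (intros; unfold t; ring).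
    apply csum_finite. intros m Hm. unfold t. destruct (Nat.leb_spec m n); [lia|ring].
  - intros M n. unfold t.
    rewrite (psum_ext _ (fun m => z ^ n * (if (m <=? n)%nat then a m * b (n - m)%nat else 0))%C)
      by (intros; ring).
    rewrite psum_scal, Cmod_mult, Cmod_pow.
    replace (K * L * ((INR n + 1) ^ (1 + k + l) * Cmod z ^ n)) with
      (Cmod z ^ n * (K * L * (INR n + 1) ^ (1 + k + l))) by ring.
    apply Rmult_le_compat_l; [apply pow_le, Cmod_ge_0|]. now apply conv_mod.
  - unfold PS at 3. apply (csum_unique (fun m => a m * z ^ m * PS b z)%C); [|exact H1].
    apply csum_ext with (fun m => PS b z * (a m * z ^ m))%C; [intros; ring|].
    rewrite Cmult_comm. apply csum_scal. now apply PS_csum.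
Qed.


(** * Convolution identities for divisor sums *)

Fixpoint sumL {A : Type} (f : A -> R) (l : list A) : R :=
  match l with nil => 0 | t :: l' => f t + sumL f l' end.

Lemma sumL_ext {A : Type} (f g : A -> R) (l : list A) : (forall t, In t l -> f t = g t) -> sumL f l = sumL g l.
Proof. induction l as [|t l IH]; intros H; cbn; [reflexivity|]. rewrite H, IH; cbn; auto. intros; apply H; cbn; auto. Qed.

Lemma sumL_plus {A : Type} (f g : A -> R) (l : list A) : sumL (fun t => f t + g t) l = sumL f l + sumL g l.
Proof. induction l as [|t l IH]; cbn; [ring|]. rewrite IH; ring. Qed.

Lemma sumL_scal {A : Type} (c : R) (f : A -> R) (l : list A) : sumL (fun t => c * f t) l = c * sumL f l.
Proof. induction l as [|t l IH]; cbn; [ring|]. rewrite IH; ring. Qed.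

Lemma sumL_minus {A : Type} (f g : A -> R) (l : list A) : sumL (fun t => f t - g t) l = sumL f l - sumL g l.
Proof. induction l as [|t l IH]; cbn; [ring|]. rewrite IH; ring. Qed.

Lemma sumL_const {A : Type} (c : R) (l : list A) : sumL (fun _ => c) l = INR (length l) * c.
Proof. induction l as [|t l IH]; [cbn; ring|]. cbn [sumL length]. rewrite S_INR, IH; ring. Qed.

Lemma sumL_app {A : Type} (f : A -> R) (l l' : list A) : sumL f (l ++ l') = sumL f l + sumL f l'.
Proof. induction l as [|t l IH]; cbn; [ring|]. rewrite IH; ring. Qed.

Lemma sumL_split {A : Type} (p : A -> bool) (f : A -> R) (l : list A) :
  sumL f l = sumL f (filter p l) + sumL f (filter (fun t => negb (p t)) l).
Proof. induction l as [|t l IH]; cbn; [ring|]. destruct (p t); cbn; rewrite IH; ring. Qed.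

Lemma sumL_mult {A B : Type} (f : A -> R) (g : B -> R) (l : list A) (l' : list B) :
  sumL f l * sumL g l' = sumL (fun t => f (fst t) * g (snd t)) (list_prod l l').
Proof.
  induction l as [|t l IH]; cbn; [ring|]. rewrite sumL_app, <- IH.
  assert (E : forall k, sumL (fun u => f (fst u) * g (snd u)) (map (fun y => (t, y)) k) = f t * sumL g k).
  { induction k as [|y k IHk]; cbn; [ring|]. rewrite IHk; ring. }
  rewrite E. ring.
Qed.

(** Induction on [l]: the image of the head is cut out of [l'], and the inverse map shows that no
    other element is sent to it. *)
Lemma sumL_bij {A B : Type} (phi : A -> B) (psi : B -> A) (f : A -> R) (g : B -> R) (l : list A) (l' : list B) :
  NoDup l -> NoDup l' ->
  (forall t, In t l -> In (phi t) l' /\ psi (phi t) = t /\ f t = g (phi t)) ->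
  (forall u, In u l' -> In (psi u) l /\ phi (psi u) = u) ->
  sumL f l = sumL g l'.
Proof.
  revert l'. induction l as [|t l IH]; intros l' Hl Hl' H1 H2.
  - destruct l' as [|u l']; [reflexivity|]. destruct (H2 u (or_introl eq_refl)) as [[] _].
  - destruct (H1 t (or_introl eq_refl)) as [Hi [Hpp Hf]].
    destruct (in_split _ _ Hi) as [m1 [m2 E]]. subst l'.
    assert (Hm := NoDup_remove _ _ _ Hl'). destruct Hm as [Hm Hni]. inversion Hl as [|? ? Hn Hl1]; subst.
    rewrite sumL_app. cbn [sumL]. rewrite Hf, (IH (m1 ++ m2) Hl1 Hm).
    + rewrite sumL_app. ring.
    + intros s Hs. destruct (H1 s (or_intror Hs)) as [Ha [Hb Hc]]. split; [|auto].
      apply in_app_or in Ha. apply in_or_app. destruct Ha as [Ha|[Ha|Ha]]; auto.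
      exfalso. apply Hn. rewrite <- Hpp, Ha, Hb. exact Hs.
    + intros u Hu. assert (Hu' : In u (m1 ++ phi t :: m2)).
      { apply in_app_or in Hu. apply in_or_app. cbn. tauto. }
      destruct (H2 u Hu') as [[Ha|Ha] Hb]; auto.
      exfalso. apply Hni. rewrite Ha, Hb. exact Hu.
Qed.

Lemma sumL_fiber {A : Type} (h : A -> nat) (f : A -> R) (P : list nat) (l : list A) :
  NoDup P -> (forall t, In t l -> In (h t) P) ->
  sumL f l = sumL (fun p => sumL f (filter (fun t => (h t =? p)%nat) l)) P.
Proof.
  intros HP. induction l as [|t l IH]; intros H; cbn [filter sumL].
  - rewrite sumL_const. ring.
  - rewrite IH by (intros; apply H; cbn; auto). symmetry.
    rewrite (sumL_ext _ (fun p => (if (h t =? p)%nat then f t else 0) + sumL f (filter (fun t => (h t =? p)%nat) l)) P)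
      by (intros p _; destruct (h t =? p)%nat; cbn [sumL]; [reflexivity|symmetry; apply Rplus_0_l]).
    rewrite sumL_plus. f_equal. symmetry.
    assert (Ht := H t (or_introl eq_refl)). clear - HP Ht.
    induction P as [|p P IH]; [destruct Ht|]. cbn. inversion HP as [|? ? Hn HP']; subst.
    destruct (Nat.eqb_spec (h t) p) as [E|E].
    + rewrite (sumL_ext _ (fun _ => 0)); [rewrite sumL_const; ring|].
      intros p' Hp'. destruct (Nat.eqb_spec (h t) p'); [|reflexivity]. subst. contradiction.
    + destruct Ht as [Ht|Ht]; [congruence|]. rewrite <- IH by assumption. ring.
Qed.

Lemma NoDup_prod {A B : Type} (l : list A) (l' : list B) : NoDup l -> NoDup l' -> NoDup (list_prod l l').
Proof.
  intros Hl Hl'. induction Hl as [|t l Hn Hl IH]; cbn; [constructor|].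
  apply NoDup_app; [|exact IH|].
  - apply NoDup_map_NoDup_ForallPairs; [|exact Hl']. intros x y _ _ E. congruence.
  - intros [x y] H1 H2. apply in_map_iff in H1. destruct H1 as [z [E _]]. apply in_prod_iff in H2.
    inversion E; subst. tauto.
Qed.

Definition quads (n : nat) : list (nat * nat * nat * nat) :=
  filter (fun t => let '(a, b, x, y) := t in (a * x + b * y =? n)%nat)
    (list_prod (list_prod (list_prod (seq 1 n) (seq 1 n)) (seq 1 n)) (seq 1 n)).

Definition pairs (n : nat) : list (nat * nat) :=
  filter (fun t => let '(e, x) := t in (e * x =? n)%nat) (list_prod (seq 1 n) (seq 1 n)).

Lemma in_quads (n a b x y : nat) :
  In (a, b, x, y) (quads n) <-> (1 <= a /\ 1 <= b /\ 1 <= x /\ 1 <= y /\ a * x + b * y = n)%nat.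
Proof.
  unfold quads. rewrite filter_In, !in_prod_iff, !in_seq, Nat.eqb_eq. split; [lia|].
  intros (Ha & Hb & Hx & Hy & E). repeat split; try lia; nia.
Qed.

Lemma in_pairs (n e x : nat) : In (e, x) (pairs n) <-> (1 <= e /\ 1 <= x /\ e * x = n)%nat.
Proof.
  unfold pairs. rewrite filter_In, !in_prod_iff, !in_seq, Nat.eqb_eq. split; [lia|].
  intros (Ha & Hb & E). repeat split; try lia; nia.
Qed.

Lemma NoDup_quads (n : nat) : NoDup (quads n).
Proof. apply NoDup_filter. repeat apply NoDup_prod; apply seq_NoDup. Qed.

Lemma NoDup_pairs (n : nat) : NoDup (pairs n).
Proof. apply NoDup_filter. repeat apply NoDup_prod; apply seq_NoDup. Qed.

#[local] Hint Resolve NoDup_quads NoDup_pairs NoDup_filter seq_NoDup NoDup_prod : core.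

Lemma pairs_fiber_one (n e x : nat) : (1 <= e)%nat -> (1 <= x)%nat -> (e * x = n)%nat ->
  filter (fun t : nat * nat => (fst t =? e)%nat) (pairs n) = [(e, x)].
Proof.
  intros He Hx Hn. assert (Hin : In (e, x) (pairs n)) by (apply in_pairs; auto).
  set (l := filter (fun t : nat * nat => (fst t =? e)%nat) (pairs n)).
  assert (HN : NoDup l) by (unfold l; auto).
  assert (Hall : forall t, In t l -> t = (e, x)).
  { intros [e' x']. unfold l. rewrite filter_In, in_pairs, Nat.eqb_eq. cbn. intros [(? & ? & ?) ?]. subst e'. f_equal. nia. }
  assert (Hin' : In (e, x) l) by (apply filter_In; split; [exact Hin|cbn; apply Nat.eqb_refl]).
  destruct l as [|t [|u l]]; [destruct Hin'| |].
  - f_equal. apply Hall. now left.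
  - exfalso. inversion HN as [|? ? Hni _]; subst. apply Hni. left.
    rewrite (Hall t), (Hall u); cbn; auto.
Qed.

Lemma filter_nil {A : Type} (p : A -> bool) (l : list A) : (forall t, In t l -> p t = false) -> filter p l = [].
Proof. induction l as [|t l IH]; intros H; cbn; [reflexivity|]. rewrite H by now left. apply IH. intros. apply H. now right. Qed.

Lemma pairs_fiber_nil (n e : nat) : n mod e <> O ->
  filter (fun t : nat * nat => (fst t =? e)%nat) (pairs n) = [].
Proof.
  intros Hd. apply filter_nil. intros [e' x'] Hin. apply in_pairs in Hin. cbn. apply Nat.eqb_neq.
  intros ->. apply Hd. apply Nat.Div0.mod_divides. exists x'. lia.
Qed.

Definition fq (f : R -> R -> R) (t : nat * nat * nat * nat) : R :=
  let '(a, b, x, y) := t in f (INR a) (INR b).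

Definition sumQ (f : R -> R -> R) (n : nat) : R := sumL (fq f) (quads n).

Definition sumD (G : nat -> nat -> R) (n : nat) : R := sumL (fun t => G (fst t) (snd t)) (pairs n).

(* Skoruppa's argument: [a x + b y = a (x - y) + (a + b) y] matches the solutions with [x > y] to
   those with [a < b], and symmetrically for [x < y]; only the two diagonals remain. *)
Lemma sumQ_diag (f g : R -> R -> R) (n : nat) :
  (forall a b, f a (b - a) = g a b) -> (forall a b, f (a - b) b = g a b) ->
  sumQ f n - sumQ g n =
  sumD (fun e x => sumL (fun a => f (INR a) (INR e - INR a)) (seq 1 (e - 1)) - INR (x - 1) * g (INR e) (INR e)) n.
Proof.
  intros H1 H2. unfold sumQ, sumD.
  set (px := fun t : nat * nat * nat * nat => let '(a, b, x, y) := t in (y <? x)%nat).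
  set (py := fun t : nat * nat * nat * nat => let '(a, b, x, y) := t in (x <? y)%nat).
  set (pa := fun t : nat * nat * nat * nat => let '(a, b, x, y) := t in (a <? b)%nat).
  set (pb := fun t : nat * nat * nat * nat => let '(a, b, x, y) := t in (b <? a)%nat).
  rewrite (sumL_split px (fq f)), (sumL_split py (fq f) (filter (fun t => negb (px t)) _)).
  rewrite (sumL_split pa (fq g)), (sumL_split pb (fq g) (filter (fun t => negb (pa t)) _)).
  set (q := quads n).
  assert (E1 : sumL (fq f) (filter px q) = sumL (fq g) (filter pa q)).
  { apply (sumL_bij (fun t => let '(a, b, x, y) := t in (a, a + b, x - y, y)%nat)
      (fun t => let '(a, b, x, y) := t in (a, b - a, x + y, y)%nat)); unfold q; auto.
    - intros [[[a b] x] y]. rewrite !filter_In. cbn [px pa]. rewrite !in_quads, !Nat.ltb_lt.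
      intros [(Ha & Hb & Hx & Hy & E) Hlt]. split; [|split].
      + repeat split; try lia; nia.
      + repeat f_equal; lia.
      + cbn. rewrite plus_INR, <- H1. f_equal. ring.
    - intros [[[a b] x] y]. rewrite !filter_In. cbn [px pa]. rewrite !in_quads, !Nat.ltb_lt.
      intros [(Ha & Hb & Hx & Hy & E) Hlt]. split; [repeat split; try lia; nia|repeat f_equal; lia]. }
  assert (E2 : sumL (fq f) (filter py (filter (fun t => negb (px t)) q))
    = sumL (fq g) (filter pb (filter (fun t => negb (pa t)) q))).
  { apply (sumL_bij (fun t => let '(a, b, x, y) := t in (a + b, b, x, y - x)%nat)
      (fun t => let '(a, b, x, y) := t in (a - b, b, x, x + y)%nat)); unfold q; auto.
    - intros [[[a b] x] y]. rewrite !filter_In. cbn [px pa py pb]. rewrite !in_quads, !negb_true_iff, !Nat.ltb_lt, !Nat.ltb_ge.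
      intros [[(Ha & Hb & Hx & Hy & E) Hlt'] Hlt]. split; [|split].
      + repeat split; try lia; nia.
      + repeat f_equal; lia.
      + cbn. rewrite plus_INR, <- H2. f_equal. ring.
    - intros [[[a b] x] y]. rewrite !filter_In. cbn [px pa py pb]. rewrite !in_quads, !negb_true_iff, !Nat.ltb_lt, !Nat.ltb_ge.
      intros [[(Ha & Hb & Hx & Hy & E) Hlt'] Hlt]. split; [repeat split; try lia; nia|repeat f_equal; lia]. }
  rewrite E1, E2. rewrite sumL_minus.
  (* The diagonal x = y: the equation reads (a + b) x = n, so the solutions over a factorization n =
     e x are the splittings e = a + b. *)
  assert (E3 : sumL (fq f) (filter (fun t => negb (py t)) (filter (fun t => negb (px t)) q))
    = sumL (fun t => sumL (fun a => f (INR a) (INR (fst t) - INR a)) (seq 1 (fst t - 1))) (pairs n)).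
  { rewrite (sumL_fiber (fun t => let '(a, b, x, y) := t in (a + b)%nat) _ (seq 1 n)); auto.
    - rewrite (sumL_fiber fst _ (seq 1 n) (pairs n)); auto.
      + apply sumL_ext. intros e He. apply in_seq in He.
        destruct (Nat.eq_dec (n mod e) 0) as [Hd|Hd].
        * apply Nat.Div0.mod_divides in Hd. destruct Hd as [x Hx].
          rewrite (pairs_fiber_one n e x) by nia. cbn [sumL fst]. rewrite Rplus_0_r.
          apply (sumL_bij (fun t => let '(a, b, x, y) := t in a) (fun a => (a, e - a, x, x)%nat)); unfold q; auto.
          -- intros [[[a b] x'] y]. rewrite !filter_In. cbn [px py]. rewrite in_quads, !negb_true_iff, !Nat.ltb_ge, Nat.eqb_eq, in_seq.
             intros [[[(Ha & Hb & Hx' & Hy & E) Hlt'] Hlt] Hab]. assert (x' = y) by lia. subst y e.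
             assert (x' = x) by nia. subst x'. split; [lia|]. split; [repeat f_equal; lia|].
             cbn. rewrite plus_INR. f_equal. ring.
          -- intros a. rewrite !filter_In, in_seq. intros Ha. split; [|reflexivity].
             cbn [px py]. rewrite in_quads, !negb_true_iff, !Nat.ltb_ge, Nat.eqb_eq. repeat split; try lia; nia.
        * rewrite pairs_fiber_nil by exact Hd. cbn [sumL].
          rewrite filter_nil; [reflexivity|].
          intros [[[a b] x'] y] Hin. apply Nat.eqb_neq. intros Hab. revert Hin. rewrite !filter_In.
          cbn [px py pa pb]. unfold q. rewrite in_quads, !negb_true_iff, !Nat.ltb_ge.
          intros [[(Ha & Hb & Hx' & Hy & E') Hlt'] Hlt]. apply Hd. assert (x' = y) by lia. subst.
          apply Nat.Div0.mod_divides. exists y. lia.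
      + intros [e x] Hin. apply in_pairs in Hin. apply in_seq. cbn. nia.
    - intros [[[a b] x'] y]. rewrite !filter_In. cbn [px py]. unfold q.
      rewrite in_quads, in_seq. intros [[(Ha & Hb & Hx' & Hy & E') Hlt'] Hlt]. nia. }
  (* The diagonal a = b = e: the equation reads e (x' + y) = n, so a factorization n = e x leaves x
     - 1 choices for y. *)
  assert (E4 : sumL (fq g) (filter (fun t => negb (pb t)) (filter (fun t => negb (pa t)) q))
    = sumL (fun t => INR (snd t - 1) * g (INR (fst t)) (INR (fst t))) (pairs n)).
  { rewrite (sumL_fiber (fun t => let '(a, b, x, y) := t in a) _ (seq 1 n)); auto.
    - rewrite (sumL_fiber fst _ (seq 1 n) (pairs n)); auto.
      + apply sumL_ext. intros e He. apply in_seq in He.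
        destruct (Nat.eq_dec (n mod e) 0) as [Hd|Hd].
        * apply Nat.Div0.mod_divides in Hd. destruct Hd as [x Hx].
          rewrite <- (sumL_bij (fun y => (e, x)) (fun _ => O) (fun _ : nat => INR (x - 1) * g (INR e) (INR e)) _ [O]); auto.
          -- cbn [sumL]. rewrite Rplus_0_r.
             transitivity (sumL (fun _ : nat => g (INR e) (INR e)) (seq 1 (x - 1))).
             ++ apply (sumL_bij (fun t => let '(a, b, x, y) := t in y) (fun y => (e, e, x - y, y)%nat)); unfold q; auto.
                ** intros [[[a b] x'] y]. rewrite !filter_In. cbn [pa pb]. rewrite in_quads, !negb_true_iff, !Nat.ltb_ge, Nat.eqb_eq, in_seq.
                   intros [[[(Ha & Hb & Hx' & Hy & E) Hlt'] Hlt] Hab]. assert (a = b) by lia. subst a b.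
                   assert (x = x' + y)%nat by nia. subst x. split; [lia|]. split; [repeat f_equal; lia|].
                   reflexivity.
                ** intros y. rewrite !filter_In, in_seq. intros Hy. split; [|reflexivity].
                   cbn [pa pb]. rewrite in_quads, !negb_true_iff, !Nat.ltb_ge, Nat.eqb_eq. repeat split; try lia; nia.
             ++ rewrite sumL_const, length_seq. reflexivity.
          -- constructor; [easy|constructor].
          -- intros t [Ht|[]]. subst t. rewrite filter_In, in_pairs. cbn. rewrite Nat.eqb_refl. repeat split; nia.
          -- intros [e' x']. rewrite filter_In, in_pairs, Nat.eqb_eq. cbn. intros [(? & ? & ?) ?]. subst e'.
             split; [auto|]. f_equal. nia.
        * rewrite pairs_fiber_nil by exact Hd. cbn [sumL].
          rewrite filter_nil; [reflexivity|].
          intros [[[a b] x'] y] Hin. apply Nat.eqb_neq. intros Hab. revert Hin. rewrite !filter_In.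
          cbn [px py pa pb]. unfold q. rewrite in_quads, !negb_true_iff, !Nat.ltb_ge.
          intros [[(Ha & Hb & Hx' & Hy & E') Hlt'] Hlt]. apply Hd. assert (a = b) by lia. subst.
          apply Nat.Div0.mod_divides. exists (x' + y)%nat. lia.
      + intros [e x] Hin. apply in_pairs in Hin. apply in_seq. cbn. nia.
    - intros [[[a b] x'] y]. rewrite !filter_In. cbn [pa pb]. unfold q.
      rewrite in_quads, in_seq. intros [[(Ha & Hb & Hx' & Hy & E') Hlt'] Hlt]. nia. }
  rewrite E3, E4. ring.
Qed.


(** * Closed forms of the diagonal sums and the resulting identities *)

(** Here and in the next three lemmas the polynomial in m is the Faulhaber sum over 0 <= a < m, and
    the last subtracted term removes a = 0. For k = e - 1 one has m = e, and everything collapses to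
    powers of e. *)
Lemma sum_quadratic (e : R) (k : nat) :
  sumL (fun a => INR a * INR a + INR a * (e - INR a) + (e - INR a) * (e - INR a)) (seq 1 k) =
  let m := INR k + 1 in (1/6)*m + (1/2)*m*e + (1/1)*m*e^2 + (-1/2)*m^2 + (-1/2)*m^2*e + (1/3)*m^3 - e^2.
Proof.
  induction k as [|k IH]; [cbn; field|].
  rewrite seq_S, sumL_app, IH. cbn [sumL]. change (1 + k)%nat with (S k). rewrite S_INR. cbv zeta. field.
Qed.

Lemma sum_quartic (e : R) (k : nat) :
  sumL (fun a => (INR a * INR a + INR a * (e - INR a) + (e - INR a) * (e - INR a)) ^ 2) (seq 1 k) =
  let m := INR k + 1 in (-1/30)*m + (1/2)*m*e^2 + (1/1)*m*e^3 + (1/1)*m*e^4 + (-1/2)*m^2*e + (-3/2)*m^2*e^2 + (-1/1)*m^2*e^3 + (1/3)*m^3 + (1/1)*m^3*e + (1/1)*m^3*e^2 + (-1/2)*m^4 + (-1/2)*m^4*e + (1/5)*m^5 - e^4.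
Proof.
  induction k as [|k IH]; [cbn; field|].
  rewrite seq_S, sumL_app, IH. cbn [sumL]. change (1 + k)%nat with (S k). rewrite S_INR. cbv zeta. field.
Qed.

Lemma sum_sextic (e : R) (k : nat) :
  sumL (fun a => (INR a * INR a + INR a * (e - INR a) + (e - INR a) * (e - INR a)) ^ 3) (seq 1 k) =
  let m := INR k + 1 in (1/42)*m + (-1/5)*m*e^2 + (1/1)*m*e^4 + (3/2)*m*e^5 + (1/1)*m*e^6 + (1/4)*m^2*e + (-7/4)*m^2*e^3 + (-3/1)*m^2*e^4 + (-3/2)*m^2*e^5 + (-1/6)*m^3 + (2/1)*m^3*e^2 + (7/2)*m^3*e^3 + (2/1)*m^3*e^4 + (-5/4)*m^4*e + (-3/1)*m^4*e^2 + (-7/4)*m^4*e^3 + (1/2)*m^5 + (3/2)*m^5*e + (6/5)*m^5*e^2 + (-1/2)*m^6 + (-1/2)*m^6*e + (1/7)*m^7 - e^6.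
Proof.
  induction k as [|k IH]; [cbn; field|].
  rewrite seq_S, sumL_app, IH. cbn [sumL]. change (1 + k)%nat with (S k). rewrite S_INR. cbv zeta. field.
Qed.

Lemma sum_product (e : R) (k : nat) :
  sumL (fun a => (INR a * (e - INR a) * (INR a + (e - INR a))) ^ 2) (seq 1 k) =
  let m := INR k + 1 in (-1/30)*m*e^2 + (1/6)*m*e^4 + (-1/2)*m^2*e^3 + (-1/2)*m^2*e^4 + (1/3)*m^3*e^2 + (1/1)*m^3*e^3 + (1/3)*m^3*e^4 + (-1/2)*m^4*e^2 + (-1/2)*m^4*e^3 + (1/5)*m^5*e^2 - 0.
Proof.
  induction k as [|k IH]; [cbn; field|].
  rewrite seq_S, sumL_app, IH. cbn [sumL]. change (1 + k)%nat with (S k). rewrite S_INR. cbv zeta. field.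
Qed.

Definition sig (k n : nat) : R := sumD (fun e _ => INR e ^ k) n.

(** Grouping the solutions by m = a x splits each into a factorization of m and one of n - m. The
    end terms m = 0 and m = n vanish, as 0 has no positive factorization. *)
Lemma sumQ_conv (p r n : nat) :
  sumQ (fun a b => a ^ p * b ^ r) n = sumL (fun m => sig p m * sig r (n - m)) (seq 0 (S n)).
Proof.
  unfold sumQ. rewrite (sumL_fiber (fun t => let '(a, b, x, y) := t in (a * x)%nat) _ (seq 0 (S n))).
  - apply sumL_ext. intros m Hm. apply in_seq in Hm. unfold sig, sumD. rewrite sumL_mult.
    apply (sumL_bij (fun t => let '(a, b, x, y) := t in ((a, x), (b, y)))
      (fun t => let '((a, x), (b, y)) := t in (a, b, x, y))).
    + apply NoDup_filter, NoDup_quads.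
    + apply NoDup_prod; apply NoDup_pairs.
    + intros [[[a b] x] y]. rewrite filter_In, in_quads, Nat.eqb_eq, in_prod_iff, !in_pairs.
      intros [(Ha & Hb & Hx & Hy & E) Hab]. repeat split; try lia.
    + intros [[a x] [b y]]. rewrite filter_In, in_quads, Nat.eqb_eq, in_prod_iff, !in_pairs.
      intros [(Ha & Hx & E) (Hb & Hy & E')]. repeat split; try lia.
  - apply seq_NoDup.
  - intros [[[a b] x] y]. rewrite in_quads, in_seq. intros (Ha & Hb & Hx & Hy & E). nia.
Qed.

Lemma sumQ_plus (f g : R -> R -> R) (n : nat) : sumQ (fun a b => f a b + g a b) n = sumQ f n + sumQ g n.
Proof.
  unfold sumQ. rewrite <- sumL_plus. apply sumL_ext. intros [[[a b] x] y] _. reflexivity.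
Qed.

Lemma sumQ_scal (c : R) (f : R -> R -> R) (n : nat) : sumQ (fun a b => c * f a b) n = c * sumQ f n.
Proof.
  unfold sumQ. rewrite <- sumL_scal. apply sumL_ext. intros [[[a b] x] y] _. reflexivity.
Qed.

Lemma sumQ_minus (f g : R -> R -> R) (n : nat) : sumQ (fun a b => f a b - g a b) n = sumQ f n - sumQ g n.
Proof.
  unfold sumQ. rewrite <- sumL_minus. apply sumL_ext. intros [[[a b] x] y] _. reflexivity.
Qed.

Lemma sumQ_ext (f g : R -> R -> R) (n : nat) : (forall a b, f a b = g a b) -> sumQ f n = sumQ g n.
Proof. intros H. apply sumL_ext. intros [[[a b] x] y] _. apply H. Qed.

Lemma sumD_ext (f g : nat -> nat -> R) (n : nat) :
  (forall e x, (1 <= e)%nat -> (1 <= x)%nat -> (e * x = n)%nat -> f e x = g e x) -> sumD f n = sumD g n.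
Proof. intros H. apply sumL_ext. intros [e x] Hin. apply in_pairs in Hin. cbn. apply H; tauto. Qed.

Lemma sumD_plus (f g : nat -> nat -> R) (n : nat) : sumD (fun e x => f e x + g e x) n = sumD f n + sumD g n.
Proof. apply sumL_plus. Qed.

Lemma sumD_scal (c : R) (f : nat -> nat -> R) (n : nat) : sumD (fun e x => c * f e x) n = c * sumD f n.
Proof. apply sumL_scal. Qed.

(* [x * e^(k+1)] summed over [e x = n] is [n sigma_k(n)]. *)
Ltac diag_sum n H :=
  unfold sig; rewrite <- !sumD_scal, <- ?sumD_plus; apply sumD_ext; intros e x He Hx En;
  rewrite H; cbv zeta; rewrite !minus_INR by assumption; subst n; rewrite ?mult_INR; cbn [INR]; field.

(** The form a^2 + a b + b^2 becomes a^2 - a b + b^2 under both substitutions of [sumQ_diag], and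
    the two differ by 2 a b. Its square and its cube serve in the same way for the next two
    identities. *)
Lemma sig1_sig1 (n : nat) :
  2 * sumQ (fun a b => a ^ 1 * b ^ 1) n = 5 / 6 * sig 3 n + 1 / 6 * sig 1 n + (- INR n) * sig 1 n.
Proof.
  rewrite <- sumQ_scal.
  rewrite (sumQ_ext _ (fun a b => (a * a + a * b + b * b) - (a * a - a * b + b * b))) by (intros; ring).
  rewrite sumQ_minus, (sumQ_diag _ (fun a b => a * a - a * b + b * b)) by (intros; ring).
  diag_sum n sum_quadratic.
Qed.

Lemma sig1_sig3 (n : nat) :
  4 * sumQ (fun a b => a ^ 3 * b ^ 1) n + 4 * sumQ (fun a b => a ^ 1 * b ^ 3) n
  = 7 / 10 * sig 5 n + 1 / 3 * sig 3 n + (- (1 / 30)) * sig 1 n + (- INR n) * sig 3 n.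
Proof.
  rewrite <- !sumQ_scal, <- sumQ_plus.
  rewrite (sumQ_ext _ (fun a b => (a * a + a * b + b * b) ^ 2 - (a * a - a * b + b * b) ^ 2)) by (intros; ring).
  rewrite sumQ_minus, (sumQ_diag _ (fun a b => (a * a - a * b + b * b) ^ 2)) by (intros; ring).
  diag_sum n sum_quartic.
Qed.

Lemma sig1_sig5 (n : nat) :
  6 * sumQ (fun a b => a ^ 5 * b ^ 1) n + 6 * sumQ (fun a b => a ^ 1 * b ^ 5) n + 14 * sumQ (fun a b => a ^ 3 * b ^ 3) n
  = 83 / 140 * sig 7 n + 1 / 2 * sig 5 n + (- (7 / 60)) * sig 3 n + 1 / 42 * sig 1 n + (- INR n) * sig 5 n.
Proof.
  rewrite <- !sumQ_scal, <- !sumQ_plus.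
  rewrite (sumQ_ext _ (fun a b => (a * a + a * b + b * b) ^ 3 - (a * a - a * b + b * b) ^ 3)) by (intros; ring).
  rewrite sumQ_minus, (sumQ_diag _ (fun a b => (a * a - a * b + b * b) ^ 3)) by (intros; ring).
  diag_sum n sum_sextic.
Qed.

(** The coefficient form of E4^2 = E8, needed to remove the a^3 b^3 term from [sig1_sig5]. The
    square of a b (a + b) is again compatible with both substitutions. *)
Lemma sig3_sig3 (n : nat) :
  4 * sumQ (fun a b => a ^ 3 * b ^ 3) n = 1 / 30 * sig 7 n + (- (1 / 30)) * sig 3 n.
Proof.
  rewrite <- !sumQ_scal.
  rewrite (sumQ_ext _ (fun a b => (a * b * (a + b)) ^ 2 - (a * b * (a - b)) ^ 2)) by (intros; ring).
  rewrite sumQ_minus, (sumQ_diag _ (fun a b => (a * b * (a - b)) ^ 2)) by (intros; ring).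
  diag_sum n sum_product.
Qed.


(** * The complex exponential *)

(** The difference quotient, completed by [l] at [z], is the slope. This form is convenient when the
    derivative comes from real estimates. *)
Lemma cderiv_eps (f : C -> C) (z l : C) :
  (forall eps, 0 < eps -> cnbhs z (fun w => Cmod (f w - f z - (w - z) * l) <= eps * Cmod (w - z))) -> cderiv f z l.
Proof.
  intros H. exists (fun w => if Ceq_dec w z then l else ((f w - f z) / (w - z))%C). split; [|split].
  - apply filter_forall. intros w. destruct (Ceq_dec w z) as [E|E]; [subst; ring|].
    field. intros E'. apply E. replace w with (w - z + z)%C by ring. rewrite E'. ring.
  - destruct (Ceq_dec z z); [reflexivity|contradiction].
  - intros eps He. assert (He2 : 0 < eps / 2) by lra. generalize (H _ He2). apply filter_imp.
    intros w Hw. destruct (Ceq_dec z z) as [_|N]; [|contradiction].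
    destruct (Ceq_dec w z) as [E|E].
    + replace (l - l)%C with (RtoC 0) by ring. rewrite Cmod_0. lra.
    + assert (N : (w - z)%C <> 0).
      { intros E'. apply E. replace w with (w - z + z)%C by ring. rewrite E'. ring. }
      replace ((f w - f z) / (w - z) - l)%C with ((f w - f z - (w - z) * l) / (w - z))%C by (field; exact N).
      rewrite Cmod_div by exact N. apply Cmod_gt_0 in N.
      apply Rle_lt_trans with (eps / 2); [|lra]. apply Rmult_le_reg_r with (Cmod (w - z)); [exact N|].
      unfold Rdiv at 1. rewrite Rmult_assoc, Rinv_l by lra. lra.
Qed.

Lemma Cexp_plus (z w : C) : Cexp (z + w) = (Cexp z * Cexp w)%C.
Proof.
  destruct z as [a b], w as [c d]. unfold Cexp, Cmult, Cplus; cbn [Re Im fst snd].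
  rewrite exp_plus, cos_plus, sin_plus. f_equal; ring.
Qed.

Lemma Cexp_0 : Cexp 0 = 1.
Proof. unfold Cexp; cbn. rewrite exp_0, cos_0, sin_0. unfold RtoC. f_equal; ring. Qed.

Lemma Cexp_mod (z : C) : Cmod (Cexp z) = exp (Re z).
Proof.
  unfold Cexp, Cmod; cbn [fst snd].
  replace ((exp (Re z) * cos (Im z)) ^ 2 + (exp (Re z) * sin (Im z)) ^ 2) with (Rsqr (exp (Re z))).
  - apply sqrt_Rsqr. apply Rlt_le, exp_pos.
  - assert (H := sin2_cos2 (Im z)). unfold Rsqr in *. nra.
Qed.

Lemma Cexp_neq0 (z : C) : Cexp z <> 0.
Proof. apply Cmod_gt_0. rewrite Cexp_mod. apply exp_pos. Qed.

Lemma Cexp_pow (z : C) (n : nat) : (Cexp z ^ n)%C = Cexp (RtoC (INR n) * z).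
Proof.
  induction n as [|n IH]; cbn [Cpow].
  - replace (RtoC (INR 0) * z)%C with (RtoC 0) by (cbn; ring). now rewrite Cexp_0.
  - rewrite IH, <- Cexp_plus, S_INR, RtoC_plus. f_equal. ring.
Qed.

Lemma Cexp_opp (z : C) : Cexp (- z) = (/ Cexp z)%C.
Proof.
  assert (H : (Cexp (- z) * Cexp z = 1)%C).
  { rewrite <- Cexp_plus. replace (- z + z)%C with (RtoC 0) by ring. apply Cexp_0. }
  assert (H' := Cexp_neq0 z). replace (Cexp (- z)) with (Cexp (- z) * Cexp z / Cexp z)%C by (field; auto).
  rewrite H. field. auto.
Qed.

Lemma real_deriv_small (f : R -> R) (l : R) : derivable_pt_lim f 0 l -> forall eps, 0 < eps ->
  exists d, 0 < d /\ forall h, Rabs h < d -> Rabs (f h - f 0 - l * h) <= eps * Rabs h.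
Proof.
  intros H eps He. destruct (H eps He) as [d Hd]. exists d. split; [apply cond_pos|]. intros h Hh.
  destruct (Req_dec h 0) as [E|E].
  - subst. rewrite Rmult_0_r, Rminus_diag, Rminus_0_r, !Rabs_R0. lra.
  - specialize (Hd h E Hh). rewrite Rplus_0_l in Hd.
    replace (f h - f 0 - l * h) with (((f h - f 0) / h - l) * h) by (field; exact E).
    rewrite Rabs_mult. apply Rmult_le_compat_r; [apply Rabs_pos|lra].
Qed.

Lemma Cexp_deriv_0 : cderiv Cexp 0 1.
Proof.
  (* The remainder below is at most 2 * 5 * e * r, so eps / 14 is small enough; e <= 1 keeps
     [Rabs (1 + a + u)] at most 3. *)
  apply cderiv_eps. intros eps He. set (e := Rmin 1 (eps / 14)).
  assert (Hee : 0 < e <= 1 /\ e <= eps / 14).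
  { unfold e. split; [split; [apply Rmin_glb_lt; lra|apply Rmin_l]|apply Rmin_r]. }
  destruct (real_deriv_small exp 1) with (eps := e) as [d1 [Hd1 H1]].
  { rewrite <- exp_0. apply derivable_pt_lim_exp. } { lra. }
  destruct (real_deriv_small sin 1) with (eps := e) as [d2 [Hd2 H2]].
  { rewrite <- cos_0. apply derivable_pt_lim_sin. } { lra. }
  destruct (real_deriv_small cos 0) with (eps := e) as [d3 [Hd3 H3]].
  { replace 0 with (- sin 0) at 2 by (rewrite sin_0; ring). apply derivable_pt_lim_cos. } { lra. }
  exists (Rmin (Rmin d1 d2) (Rmin d3 e)). split; [repeat apply Rmin_glb_lt; lra|].
  intros [a b] Hw. assert (E0 : Cminus (a, b) (RtoC 0) = (a, b)) by (unfold Cminus, Cplus, Copp, RtoC; cbn; f_equal; ring).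
  rewrite E0 in *.
  assert (Ha := re_le_Cmod (a, b)). assert (Hb := im_le_Cmod (a, b)). cbn [Re Im fst snd] in Ha, Hb.
  set (r := Cmod (a, b)) in *.
  assert (Hr : 0 <= r) by apply Cmod_ge_0.
  assert (r < d1 /\ r < d2 /\ r < d3 /\ r < e).
  { repeat split; eapply Rlt_le_trans; try exact Hw;
      [eapply Rle_trans; [apply Rmin_l|apply Rmin_l]|eapply Rle_trans; [apply Rmin_l|apply Rmin_r]
      |eapply Rle_trans; [apply Rmin_r|apply Rmin_l]|eapply Rle_trans; [apply Rmin_r|apply Rmin_r]]. }
  specialize (H1 a ltac:(lra)). specialize (H2 b ltac:(lra)). specialize (H3 b ltac:(lra)).
  rewrite exp_0 in H1. rewrite sin_0 in H2. rewrite cos_0 in H3.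
  set (u := exp a - 1 - 1 * a) in *. set (v := sin b - 0 - 1 * b) in *. set (w := cos b - 1 - 0 * b) in *.
  rewrite Cexp_0. replace (Cexp (a, b) - 1 - (a, b) * 1)%C with
    (u + (1 + a + u) * w, (1 + a + u) * v + (a + u) * b).
  2:{ unfold Cexp, u, v, w, Cminus, Cplus, Copp, Cmult, RtoC; cbn [Re Im fst snd]. f_equal; ring. }
  eapply Rle_trans; [apply Cmod_2Rmax|]. cbn [fst snd].
  assert (Hs : sqrt 2 <= 2). { rewrite <- (sqrt_square 2) at 2 by lra. apply sqrt_le_1; lra. }
  assert (Hs0 := sqrt_pos 2).
  assert (er : e * r <= r) by nra.
  assert (Hu : Rabs u <= e * r) by (eapply Rle_trans; [exact H1|]; apply Rmult_le_compat_l; lra).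
  assert (Hv : Rabs v <= e * r) by (eapply Rle_trans; [exact H2|]; apply Rmult_le_compat_l; lra).
  assert (Hw' : Rabs w <= e * r) by (eapply Rle_trans; [exact H3|]; apply Rmult_le_compat_l; lra).
  assert (Hau : Rabs (a + u) <= 2 * r) by (eapply Rle_trans; [apply Rabs_triang|]; lra).
  assert (H1au : Rabs (1 + a + u) <= 3).
  { replace (1 + a + u) with (1 + (a + u)) by ring. eapply Rle_trans; [apply Rabs_triang|]. rewrite Rabs_R1. lra. }
  assert (P1 : Rabs (u + (1 + a + u) * w) <= 4 * (e * r)).
  { eapply Rle_trans; [apply Rabs_triang|]. rewrite Rabs_mult.
    assert (Rabs (1 + a + u) * Rabs w <= 3 * (e * r)) by (apply Rmult_le_compat; auto using Rabs_pos). lra. }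
  assert (P2 : Rabs ((1 + a + u) * v + (a + u) * b) <= 5 * (e * r)).
  { eapply Rle_trans; [apply Rabs_triang|]. rewrite !Rabs_mult.
    assert (Rabs (1 + a + u) * Rabs v <= 3 * (e * r)) by (apply Rmult_le_compat; auto using Rabs_pos).
    assert (Rabs (a + u) * Rabs b <= 2 * r * r) by (apply Rmult_le_compat; auto using Rabs_pos).
    assert (r * r <= e * r) by (apply Rmult_le_compat_r; lra). lra. }
  assert (P3 : Rmax (Rabs (u + (1 + a + u) * w)) (Rabs ((1 + a + u) * v + (a + u) * b)) <= 5 * (e * r)).
  { apply Rmax_lub; [|exact P2]. assert (0 <= e * r) by (apply Rmult_le_pos; lra). lra. }
  assert (P4 : 0 <= Rmax (Rabs (u + (1 + a + u) * w)) (Rabs ((1 + a + u) * v + (a + u) * b)))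
    by (eapply Rle_trans; [apply Rabs_pos|apply Rmax_l]).
  apply Rle_trans with (2 * (5 * (e * r))); [apply Rmult_le_compat; lra|].
  assert (e * r <= eps / 14 * r) by (apply Rmult_le_compat_r; lra).
  assert (0 <= eps * r) by (apply Rmult_le_pos; lra). lra.
Qed.

Lemma Cexp_deriv (z : C) : cderiv Cexp z (Cexp z).
Proof.
  apply cderiv_ext with (fun w => Cexp z * Cexp (w - z))%C.
  - intros w. rewrite <- Cexp_plus. f_equal. ring.
  - apply cderiv_val with (Cexp z * (1 * 1))%C; [|ring]. apply cderiv_scal.
    apply (cderiv_comp Cexp (fun w => w - z)%C).
    + replace (z - z)%C with (RtoC 0) by ring. apply Cexp_deriv_0.
    + replace (RtoC 1) with (1 - 0)%C by ring. apply cderiv_minus; [apply cderiv_id|apply cderiv_const].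
Qed.

Lemma Cexp_cont (z : C) : ccont Cexp z.
Proof. eapply cderiv_ccont, Cexp_deriv. Qed.

Definition tpi : C := (2 * PI * Ci)%C.

Lemma tpi_neq0 : tpi <> 0.
Proof.
  unfold tpi, Ci, RtoC, Cmult; cbn. intros E. injection E as _ E. assert (H := PI_RGT_0). nra.
Qed.

Lemma qexp_deriv (t : C) : cderiv qexp t (tpi * qexp t).
Proof.
  apply cderiv_val with (qexp t * tpi)%C; [|ring]. apply (cderiv_comp Cexp (fun t => 2 * PI * Ci * t)%C); [apply Cexp_deriv|].
  apply cderiv_val with (tpi * 1)%C; [|ring]. apply cderiv_scal, cderiv_id.
Qed.

Lemma qexp_mod (t : C) : Cmod (qexp t) = exp (- (2 * PI * Im t)).
Proof.
  unfold qexp. rewrite Cexp_mod. f_equal. destruct t. cbn. ring.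
Qed.

Lemma qexp_lt1 (t : C) : 0 < Im t -> Cmod (qexp t) < 1.
Proof.
  intros H. rewrite qexp_mod, <- exp_0. apply exp_increasing. assert (Hp := PI_RGT_0). nra.
Qed.

Lemma Im_nbhs (t : C) : 0 < Im t -> cnbhs t (fun w => 0 < Im w).
Proof.
  intros H. exists (Im t). split; [exact H|]. intros w Hw. assert (Hi := im_le_Cmod (w - t)).
  change (Im (w - t)) with (Im w - Im t) in Hi. assert (Rabs (Im w - Im t) < Im t) by lra.
  apply Rabs_def2 in H0. lra.
Qed.

(** * Lambert series *)

Lemma sumL_seq_rsum (f : nat -> R) (s n : nat) : sumL f (seq s n) = rsum (fun k => f (s + k)%nat) n.
Proof. induction n as [|n IH]; [reflexivity|]. rewrite seq_S, sumL_app, IH. cbn. ring. Qed.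

(** The term of the candidate divisor S m, with 0 for non-divisors, so that a sum over divisors
    becomes one column of a double series. The case n = 0 is separated because every number divides
    0. *)
Definition divq (g : nat -> nat -> R) (n m : nat) : R :=
  if (n mod S m =? 0)%nat then (if (n =? 0)%nat then 0 else g (S m) (n / S m)%nat) else 0.

Lemma sumD_rsum (g : nat -> nat -> R) (n : nat) : sumD g n = rsum (divq g n) n.
Proof.
  unfold sumD. rewrite (sumL_fiber fst _ (seq 1 n)).
  - rewrite sumL_seq_rsum. apply rsum_ext. intros m Hm. cbn [Nat.add]. unfold divq.
    destruct (Nat.eqb_spec (n mod S m) 0) as [E|E].
    + destruct (Nat.eqb_spec n 0) as [E0|E0]; [lia|].
      assert (E' := Nat.div_mod_eq n (S m)). rewrite (pairs_fiber_one n (S m) (n / S m)).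
      * cbn. ring.
      * lia.
      * destruct (n / S m)%nat; lia.
      * lia.
    + now rewrite pairs_fiber_nil.
  - apply seq_NoDup.
  - intros [e x] Hin. apply in_pairs in Hin. apply in_seq. cbn. nia.
Qed.

Definition growth (g : nat -> nat -> R) : Prop :=
  exists (K : R) (k : nat), 0 <= K /\ forall e x, (1 <= e)%nat -> (1 <= x)%nat -> Rabs (g e x) <= K * (INR (e * x) + 1) ^ k.

Lemma growth_fst (k : nat) : growth (fun e _ => INR e ^ k).
Proof.
  exists 1, k. split; [lra|]. intros e x He Hx. rewrite Rmult_1_l, Rabs_right by (apply Rle_ge, pow_le, pos_INR).
  apply pow_incr. split; [apply pos_INR|]. assert (H : INR e <= INR (e * x)) by (apply le_INR; nia). lra.
Qed.

Lemma divq_bound (g : nat -> nat -> R) (K : R) (k : nat) : 0 <= K ->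
  (forall e x, (1 <= e)%nat -> (1 <= x)%nat -> Rabs (g e x) <= K * (INR (e * x) + 1) ^ k) ->
  forall n M, rsum (fun m => Rabs (divq g n m)) M <= K * (INR n + 1) ^ S k.
Proof.
  intros HK Hg n M. set (c := K * (INR n + 1) ^ k).
  assert (Hc : 0 <= c) by (apply Rmult_le_pos; [exact HK|apply Rlt_le, INR1_pow_pos]).
  apply Rle_trans with (rsum (fun m => if (m <? n)%nat then c else 0) M).
  - apply rsum_le. intros m _. unfold divq.
    destruct (Nat.eqb_spec (n mod S m) 0) as [E|E].
    + destruct (Nat.eqb_spec n 0) as [E0|E0].
      * rewrite Rabs_R0. destruct (m <? n)%nat; lra.
      * assert (E' := Nat.div_mod_eq n (S m)). destruct (Nat.ltb_spec m n) as [Hm|Hm].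
        -- assert (H1 : (1 <= n / S m)%nat) by (destruct (n / S m)%nat; lia).
           specialize (Hg (S m) (n / S m)%nat ltac:(lia) H1).
           replace (S m * (n / S m))%nat with n in Hg by lia. exact Hg.
        -- rewrite Nat.mod_small in E by lia. lia.
    + rewrite Rabs_R0. destruct (m <? n)%nat; lra.
  - assert (E : forall M, rsum (fun m => if (m <? n)%nat then c else 0) M = INR (min M n) * c).
    { clear M. induction M as [|M IH]; [cbn; ring|]. cbn [rsum]. rewrite IH.
      destruct (Nat.ltb_spec M n) as [Hm|Hm].
      - rewrite !Nat.min_l by lia. rewrite S_INR. ring.
      - rewrite !Nat.min_r by lia. ring. }
    rewrite E. replace (K * (INR n + 1) ^ S k) with ((INR n + 1) * c) by (unfold c; cbn [pow]; ring).
    apply Rmult_le_compat_r; [exact Hc|]. rewrite <- S_INR. apply le_INR. lia.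
Qed.

Lemma rsum_abs (a : nat -> R) (n : nat) : Rabs (rsum a n) <= rsum (fun k => Rabs (a k)) n.
Proof.
  induction n as [|n IH]; cbn; [rewrite Rabs_R0; lra|].
  eapply Rle_trans; [apply Rabs_triang|]. lra.
Qed.

Lemma polyg_sumD (g : nat -> nat -> R) : growth g -> polyg (fun n => RtoC (sumD g n)).
Proof.
  intros [K [k [HK Hg]]]. exists K, (S k). split; [exact HK|]. intros n. rewrite Cmod_R, sumD_rsum.
  eapply Rle_trans; [apply rsum_abs|]. now apply divq_bound.
Qed.

(** Spreading a series over the multiples of S m only repeats its partial sums. The index 0 is
    skipped, hence the [pred]. *)
Lemma csum_multiples (b : nat -> C) (l : C) (m : nat) : csum b l ->
  csum (fun n => if (n mod S m =? 0)%nat then (if (n =? 0)%nat then RtoC 0 else b (pred (n / S m))) else 0) l.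
Proof.
  intros H. set (t := fun n => _).
  assert (E : forall n, psum t (S n) = psum b (n / S m)).
  { induction n as [|n IH].
    - rewrite Nat.Div0.div_0_l. cbn [psum]. unfold t. rewrite Nat.Div0.mod_0_l. cbn. ring.
    - change (psum t (S (S n))) with (psum t (S n) + t (S n))%C. rewrite IH. unfold t at 1.
      assert (E1 := Nat.div_mod_eq n (S m)). assert (E2 := Nat.div_mod_eq (S n) (S m)).
      assert (B1 := Nat.mod_upper_bound n (S m) ltac:(lia)). assert (B2 := Nat.mod_upper_bound (S n) (S m) ltac:(lia)).
      destruct (Nat.eqb_spec (S n mod S m) 0) as [E0|E0].
      + assert (E3 : (S n / S m = S (n / S m))%nat) by nia. rewrite E3. cbn [Nat.eqb pred psum]. reflexivity.
      + assert (E3 : (S n / S m = n / S m)%nat) by nia. rewrite E3. ring. }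
  intros eps He. destruct (H eps He) as [N HN]. exists (S (N * S m)). intros [|n] Hn; [lia|].
  rewrite E. apply HN. apply Nat.div_le_lower_bound; lia.
Qed.

(** A double sum of g(e, x) q^(e x) regrouped by the product n = e x. It is used with e^k for the
    Lambert series, with x^3 to write E4 through [psi], and with 1 / x for the logarithm of the eta
    product. *)
Lemma lambert_grid (g : nat -> nat -> R) (q : C) (inner : nat -> C) : growth g -> Cmod q < 1 ->
  (forall m, csum (fun d => RtoC (g (S m) (S d)) * q ^ (S m * S d))%C (inner m)) ->
  csum inner (PS (fun n => RtoC (sumD g n)) q).
Proof.
  intros [K [k [HK Hg]]] Hq Hin.
  destruct (fubini (fun m n => RtoC (divq g n m) * q ^ n)%C inner (fun n => RtoC (sumD g n) * q ^ n)%C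
    (fun n => K * ((INR n + 1) ^ S k * Cmod q ^ n))) as [H1 _].
  - apply (ex_series_scal_l (V := R_NormedModule) K). apply ex_series_poly_geom.
    split; [apply Cmod_ge_0|exact Hq].
  - intros m. generalize (csum_multiples _ _ m (Hin m)). apply csum_ext. intros n. unfold divq.
    destruct (Nat.eqb_spec (n mod S m) 0) as [E|E]; [|ring].
    destruct (Nat.eqb_spec n 0) as [E0|E0]; [ring|].
    assert (E' := Nat.div_mod_eq n (S m)).
    assert (E1 : S (pred (n / S m)) = (n / S m)%nat) by (destruct (n / S m)%nat; lia).
    rewrite E1. replace (S m * (n / S m))%nat with n by lia. reflexivity.
  - intros n. rewrite sumD_rsum, <- psum_RtoC, Cmult_comm, <- psum_scal.
    rewrite (psum_ext _ (fun m => RtoC (divq g n m) * q ^ n)%C) by (intros; ring).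
    apply csum_finite. intros m Hm. unfold divq.
    destruct (Nat.eqb_spec (n mod S m) 0) as [E|E]; [|ring].
    destruct (Nat.eqb_spec n 0) as [E0|E0]; [ring|]. rewrite Nat.mod_small in E by lia. lia.
  - intros M n. rewrite (psum_ext _ (fun m => q ^ n * RtoC (divq g n m))%C) by (intros; ring).
    rewrite psum_scal, Cmod_mult, Cmod_pow, psum_RtoC, Cmod_R.
    replace (K * ((INR n + 1) ^ S k * Cmod q ^ n)) with (Cmod q ^ n * (K * (INR n + 1) ^ S k)) by ring.
    apply Rmult_le_compat_l; [apply pow_le, Cmod_ge_0|]. eapply Rle_trans; [apply rsum_abs|]. now apply divq_bound.
  - exact H1.
Qed.

Lemma csum_geom (q : C) : Cmod q < 1 -> csum (fun n => q ^ n)%C (/ (1 - q))%C.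
Proof.
  intros Hq. assert (Hq1 : (1 - q)%C <> 0).
  { intros E. assert (E' : q = 1) by (replace q with (1 - (1 - q))%C by ring; rewrite E; ring).
    rewrite E', Cmod_1 in Hq. lra. }
  assert (H : csum (fun n => 1 * q ^ n)%C (PS (fun _ => RtoC 1) q)) by (apply PS_csum; [apply polyg_const|exact Hq]).
  assert (E := PS_decr (fun _ => RtoC 1) q (polyg_const 1) Hq).
  replace (/ (1 - q))%C with (PS (fun _ => RtoC 1) q).
  - revert H. apply csum_ext. intros. ring.
  - set (s := PS (fun _ => RtoC 1) q) in *. replace s with (s * (1 - q) / (1 - q))%C by (field; auto).
    replace (s * (1 - q))%C with (s - q * s)%C by ring. rewrite E at 1. field. auto.
Qed.

Definition sigc (k n : nat) : C := RtoC (sig k n).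

Lemma polyg_sigc (k : nat) : polyg (sigc k).
Proof. apply polyg_sumD, growth_fst. Qed.

Lemma Cmod_pow_lt1 (q : C) (n : nat) : Cmod q < 1 -> (0 < n)%nat -> Cmod (q ^ n) < 1.
Proof. intros Hq Hn. rewrite Cmod_pow. apply pow_lt_1_compat; [|exact Hn]. split; [apply Cmod_ge_0|exact Hq]. Qed.

Lemma lambert_PS (k : nat) (q : C) : Cmod q < 1 -> lambert k q = PS (sigc k) q.
Proof.
  intros Hq. apply csum_CSeries. apply (lambert_grid (fun e _ => INR e ^ k)); [apply growth_fst|exact Hq|].
  intros m. assert (Hm := Cmod_pow_lt1 q (S m) Hq ltac:(lia)).
  apply csum_ext with (fun d => (RtoC (INR (S m)) ^ k * q ^ S m) * (q ^ S m) ^ d)%C.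
  - intros d. rewrite RtoC_pow, <- Cpow_mult_r. replace (S m * S d)%nat with (S m + S m * d)%nat by lia.
    rewrite Cpow_add_r. ring.
  - apply csum_scal. now apply csum_geom.
Qed.

(** * Ramanujan's differential equations *)

(** The operator q d/dq on coefficients, which is D when q = e^(2 i PI tau). *)
Definition theta (a : nat -> C) (n : nat) : C := (RtoC (INR n) * a n)%C.

Lemma polyg_theta (a : nat -> C) : polyg a -> polyg (theta a).
Proof. apply polyg_mult, polyg_INR. Qed.

Lemma PS_theta (a : nat -> C) (q : C) : polyg a -> Cmod q < 1 -> PS (theta a) q = (q * PS (dcoef a) q)%C.
Proof.
  intros Ha Hq. rewrite PS_decr; [|now apply polyg_theta|exact Hq].
  unfold theta at 1. cbn [INR]. change (fun n => theta a (S n)) with (dcoef a). ring.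
Qed.

Lemma conv_sig (p r n : nat) : conv (sigc p) (sigc r) n = RtoC (sumQ (fun a b => a ^ p * b ^ r) n).
Proof.
  rewrite sumQ_conv, sumL_seq_rsum, <- psum_RtoC. apply psum_ext. intros m _.
  unfold sigc. now rewrite RtoC_mult.
Qed.

Section Ramanujan.
Variable q : C.
Hypothesis Hq : Cmod q < 1.

Let s (k : nat) : C := PS (sigc k) q.
Let ts (k : nat) : C := PS (theta (sigc k)) q.

Lemma s_mult (p r : nat) : (s p * s r)%C = PS (fun n => RtoC (sumQ (fun a b => a ^ p * b ^ r) n)) q.
Proof.
  unfold s. rewrite PS_mult; [|apply polyg_sigc|apply polyg_sigc|exact Hq].
  apply PS_ext. apply conv_sig.
Qed.

Lemma polyg_sumQ (p r : nat) : polyg (fun n => RtoC (sumQ (fun a b => a ^ p * b ^ r) n)).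
Proof. eapply polyg_ext; [apply conv_sig|]. apply polyg_conv; apply polyg_sigc. Qed.

#[local] Hint Resolve polyg_sumQ polyg_sigc polyg_theta polyg_scal polyg_plus : core.

Lemma ramanujan_11 : (2 * (s 1 * s 1) = RtoC (5 / 6) * s 3 + RtoC (1 / 6) * s 1 - ts 1)%C.
Proof.
  rewrite s_mult. unfold s, ts, Cminus.
  replace (- PS (theta (sigc 1)) q)%C with (- (1) * PS (theta (sigc 1)) q)%C by ring.
  rewrite <- !PS_scal, <- !PS_plus; auto 10. apply PS_ext. intros n.
  rewrite <- RtoC_mult, sig1_sig1. unfold theta, sigc. rewrite !RtoC_plus, !RtoC_mult, RtoC_opp. ring.
Qed.

Lemma ramanujan_13 :
  (8 * (s 1 * s 3) = RtoC (7 / 10) * s 5 + RtoC (1 / 3) * s 3 + RtoC (- (1 / 30)) * s 1 - ts 3)%C.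
Proof.
  replace (8 * (s 1 * s 3))%C with (4 * (s 3 * s 1) + 4 * (s 1 * s 3))%C by ring.
  rewrite !s_mult. unfold s, ts, Cminus.
  replace (- PS (theta (sigc 3)) q)%C with (- (1) * PS (theta (sigc 3)) q)%C by ring.
  rewrite <- !PS_scal, <- !PS_plus; auto 10. apply PS_ext. intros n.
  rewrite <- !RtoC_mult, <- RtoC_plus, sig1_sig3. unfold theta, sigc. rewrite !RtoC_plus, !RtoC_mult, !RtoC_opp. ring.
Qed.

Lemma ramanujan_15 :
  (12 * (s 1 * s 5) + 14 * (s 3 * s 3) = RtoC (83 / 140) * s 7 + RtoC (1 / 2) * s 5 + RtoC (- (7 / 60)) * s 3
     + RtoC (1 / 42) * s 1 - ts 5)%C.
Proof.
  replace (12 * (s 1 * s 5) + 14 * (s 3 * s 3))%C with (6 * (s 5 * s 1) + 6 * (s 1 * s 5) + 14 * (s 3 * s 3))%C by ring.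
  rewrite !s_mult. unfold s, ts, Cminus.
  replace (- PS (theta (sigc 5)) q)%C with (- (1) * PS (theta (sigc 5)) q)%C by ring.
  rewrite <- !PS_scal, <- !PS_plus; auto 10. apply PS_ext. intros n.
  rewrite <- !RtoC_mult, <- !RtoC_plus, sig1_sig5. unfold theta, sigc. rewrite !RtoC_plus, !RtoC_mult, !RtoC_opp. ring.
Qed.

Lemma ramanujan_33 : (4 * (s 3 * s 3) = RtoC (1 / 30) * s 7 + RtoC (- (1 / 30)) * s 3)%C.
Proof.
  rewrite !s_mult. unfold s. rewrite <- !PS_scal, <- !PS_plus; auto 10. apply PS_ext. intros n.
  rewrite <- !RtoC_mult, sig3_sig3. unfold sigc. rewrite !RtoC_plus, !RtoC_mult. ring.
Qed.

End Ramanujan.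

Lemma E_deriv (k : nat) (t c : C) : 0 < Im t ->
  cderiv (fun w => 1 + c * lambert k (qexp w))%C t (tpi * (c * PS (theta (sigc k)) (qexp t)))%C.
Proof.
  intros Ht. assert (Hq := qexp_lt1 t Ht).
  apply cderiv_local with (fun w => 1 + c * PS (sigc k) (qexp w))%C.
  - generalize (Im_nbhs t Ht). apply filter_imp. intros w Hw. now rewrite lambert_PS by now apply qexp_lt1.
  - rewrite PS_theta by (apply polyg_sigc || exact Hq).
    replace (tpi * (c * (qexp t * PS (dcoef (sigc k)) (qexp t))))%C
      with (0 + c * (PS (dcoef (sigc k)) (qexp t) * (tpi * qexp t)))%C by ring.
    apply cderiv_plus; [apply cderiv_const|]. apply cderiv_scal.
    apply (cderiv_comp (PS (sigc k)) qexp); [apply PS_deriv; [apply polyg_sigc|exact Hq]|apply qexp_deriv].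
Qed.

Lemma E2_deriv (t : C) : 0 < Im t -> cderiv E2 t (tpi * ((E2 t ^ 2 - E4 t) / 12))%C.
Proof.
  intros Ht. assert (Hq := qexp_lt1 t Ht).
  apply cderiv_ext with (fun w => 1 + - (24) * lambert 1 (qexp w))%C; [intros; unfold E2; ring|].
  replace ((E2 t ^ 2 - E4 t) / 12)%C with (- (24) * PS (theta (sigc 1)) (qexp t))%C; [now apply E_deriv|].
  unfold E2, E4. rewrite !lambert_PS by exact Hq.
  assert (H := ramanujan_11 (qexp t) Hq).
  set (s1 := PS (sigc 1) (qexp t)) in *. set (s3 := PS (sigc 3) (qexp t)) in *. set (ts := PS (theta (sigc 1)) (qexp t)) in *.
  replace ts with (RtoC (5 / 6) * s3 + RtoC (1 / 6) * s1 - 2 * (s1 * s1))%C by (rewrite H; ring).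
  rewrite !RtoC_div by lra. field.
Qed.

Lemma E4_deriv (t : C) : 0 < Im t -> cderiv E4 t (tpi * ((E2 t * E4 t - E6 t) / 3))%C.
Proof.
  intros Ht. assert (Hq := qexp_lt1 t Ht).
  apply cderiv_val with (tpi * (240 * PS (theta (sigc 3)) (qexp t)))%C; [now apply E_deriv|]. f_equal.
  unfold E2, E4, E6. rewrite !lambert_PS by exact Hq.
  assert (H := ramanujan_13 (qexp t) Hq).
  set (s1 := PS (sigc 1) (qexp t)) in *. set (s3 := PS (sigc 3) (qexp t)) in *.
  set (s5 := PS (sigc 5) (qexp t)) in *. set (ts := PS (theta (sigc 3)) (qexp t)) in *.
  replace ts with (RtoC (7 / 10) * s5 + RtoC (1 / 3) * s3 + RtoC (- (1 / 30)) * s1 - 8 * (s1 * s3))%C by (rewrite H; ring).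
  rewrite RtoC_opp, !RtoC_div by lra. field.
Qed.

Lemma E6_deriv (t : C) : 0 < Im t -> cderiv E6 t (tpi * ((E2 t * E6 t - E4 t ^ 2) / 2))%C.
Proof.
  intros Ht. assert (Hq := qexp_lt1 t Ht).
  apply cderiv_ext with (fun w => 1 + - (504) * lambert 5 (qexp w))%C; [intros; unfold E6; ring|].
  apply cderiv_val with (tpi * (- (504) * PS (theta (sigc 5)) (qexp t)))%C; [now apply E_deriv|]. f_equal.
  unfold E2, E4, E6. rewrite !lambert_PS by exact Hq.
  assert (H := ramanujan_15 (qexp t) Hq). assert (H' := ramanujan_33 (qexp t) Hq).
  set (s1 := PS (sigc 1) (qexp t)) in *. set (s3 := PS (sigc 3) (qexp t)) in *. set (s7 := PS (sigc 7) (qexp t)) in *.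
  set (s5 := PS (sigc 5) (qexp t)) in *. set (ts := PS (theta (sigc 5)) (qexp t)) in *.
  (* E8 = E4^2, that is 1 + 480 s7 = (1 + 240 s3)^2, eliminates s7. *)
  assert (E7 : s7 = (120 * (s3 * s3) + s3)%C).
  { replace (120 * (s3 * s3) + s3)%C with (30 * (4 * (s3 * s3)) + s3)%C by ring. rewrite H', RtoC_opp, !RtoC_div by lra. field. }
  replace ts with (RtoC (83 / 140) * s7 + RtoC (1 / 2) * s5 + RtoC (- (7 / 60)) * s3 + RtoC (1 / 42) * s1
    - (12 * (s1 * s5) + 14 * (s3 * s3)))%C by (rewrite H; ring).
  rewrite E7, RtoC_opp, !RtoC_div by lra. field.
Qed.


(** * The Lipschitz formula in weight 4 *)

Lemma C1_neq0 : RtoC 1 <> 0.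
Proof. intros E. apply RtoC_inj in E. lra. Qed.

(** The sum of n^3 u^n for |u| < 1, continued as a rational function; its value at u = -1, on the
    boundary, is what yields zeta(4). *)
Definition phi3 (u : C) : C := (u * (1 + 4 * u + u ^ 2) / (1 - u) ^ 4)%C.

Lemma C1_neq (u : C) : u <> 1 -> (1 - u)%C <> 0.
Proof. intros H E. apply H. replace u with (1 - (1 - u))%C by ring. rewrite E. ring. Qed.

(** In terms of series the odd powers cancel and each even one contributes 2 (2 n)^3 = 16 n^3. *)
Lemma phi3_dup (v : C) : (v * v)%C <> 1 -> (phi3 v + phi3 (- v) = 16 * phi3 (v * v))%C.
Proof.
  intros H. assert (H1 := C1_neq _ H).
  assert (Ha : (1 - v)%C <> 0) by (intros E; apply H1; replace (1 - v * v)%C with ((1 - v) * (1 + v))%C by ring; rewrite E; ring).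
  assert (Hb : (1 + v)%C <> 0) by (intros E; apply H1; replace (1 - v * v)%C with ((1 - v) * (1 + v))%C by ring; rewrite E; ring).
  unfold phi3. replace (1 - - v)%C with (1 + v)%C by ring.
  replace (1 - v * v)%C with ((1 - v) * (1 + v))%C by ring. field. split; assumption.
Qed.

Lemma qexp_plus (z w : C) : qexp (z + w) = (qexp z * qexp w)%C.
Proof. unfold qexp. rewrite <- Cexp_plus. f_equal. ring. Qed.

Lemma qexp_half : qexp (/ 2)%C = (- (1))%C.
Proof.
  unfold qexp. replace (2 * PI * Ci * / 2)%C with ((0, PI) : C).
  - unfold Cexp; cbn. rewrite exp_0, cos_PI, sin_PI. unfold RtoC, Copp; cbn. f_equal; ring.
  - replace (2 * PI * Ci * / 2)%C with (PI * Ci)%C by field. unfold Ci, Cmult, RtoC; cbn. f_equal; ring.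
Qed.

Lemma qexp_1 : qexp 1 = 1.
Proof. replace (RtoC 1) with (/ 2 + / 2)%C at 1 by field. rewrite qexp_plus, qexp_half. ring. Qed.

Lemma qexp_nat (n : nat) : qexp (RtoC (INR n)) = 1.
Proof.
  induction n as [|n IH].
  - unfold qexp. cbn [INR]. rewrite Cmult_0_r. apply Cexp_0.
  - rewrite S_INR, RtoC_plus, qexp_plus, IH, qexp_1. ring.
Qed.

Lemma qexp_sub1 (z : C) : qexp (z - 1) = qexp z.
Proof. replace z with (z - 1 + 1)%C at 2 by ring. rewrite qexp_plus, qexp_1. ring. Qed.

Lemma qexp_pow (z : C) (n : nat) : (qexp z ^ n)%C = qexp (RtoC (INR n) * z).
Proof. unfold qexp. rewrite Cexp_pow. f_equal. ring. Qed.

Definition psi (z : C) : C := phi3 (qexp z).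

Lemma INR_neq0 (n : nat) : (0 < n)%nat -> RtoC (INR n) <> 0.
Proof. intros H E. apply RtoC_inj in E. apply lt_0_INR in H. lra. Qed.

Lemma qexp_div_neq1 (z : C) (m k : nat) : (0 < m)%nat -> qexp z <> 1 -> qexp ((z + RtoC (INR k)) / RtoC (INR m)) <> 1.
Proof.
  intros Hm Hz E. apply Hz. transitivity (qexp (z + RtoC (INR k))).
  { rewrite qexp_plus, qexp_nat. ring. }
  replace (z + RtoC (INR k))%C with (RtoC (INR m) * ((z + RtoC (INR k)) / RtoC (INR m)))%C
    by (field; now apply INR_neq0).
  rewrite <- qexp_pow, E. clear. induction m as [|m IH]; cbn [Cpow]; [reflexivity|]. rewrite IH. ring.
Qed.

Lemma pow2_pos (r : nat) : (0 < 2 ^ r)%nat.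
Proof. induction r; cbn; lia. Qed.

(** Iterated duplication. After division by 16^r every summand approaches the polar part of [psi] at
    0, which turns this relation into the partial fraction expansion. *)
Lemma psi_dist (z : C) (r : nat) : qexp z <> 1 ->
  psum (fun k => psi ((z + RtoC (INR k)) / RtoC (INR (2 ^ r)))) (2 ^ r) = (16 ^ r * psi z)%C.
Proof.
  intros Hz. induction r as [|r IH].
  - cbn [Nat.pow psum INR Cpow]. replace ((z + RtoC 0) / RtoC 1)%C with z by field. ring.
  - replace (2 ^ S r)%nat with (2 ^ r + 2 ^ r)%nat by (cbn; lia). cbn [Cpow]. set (m := (2 ^ r)%nat) in *.
    assert (Hm : (0 < m)%nat) by apply pow2_pos. assert (Hm0 := INR_neq0 m Hm).
    assert (Hm2 : (RtoC (INR m) + RtoC (INR m))%C <> 0).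
    { rewrite <- RtoC_plus, <- plus_INR. apply INR_neq0. lia. }
    rewrite psum_app. rewrite plus_INR, RtoC_plus.
    replace (16 * 16 ^ r * psi z)%C with (16 * (16 ^ r * psi z))%C by ring.
    rewrite <- IH, <- psum_scal, <- psum_plus. apply psum_ext. intros k _. unfold psi.
    set (v := qexp ((z + RtoC (INR k)) / (RtoC (INR m) + RtoC (INR m)))).
    assert (E1 : qexp ((z + RtoC (INR k)) / RtoC (INR m)) = (v * v)%C).
    { unfold v. rewrite <- qexp_plus. f_equal. field. auto. }
    rewrite E1.
    assert (E2 : qexp ((z + RtoC (INR (m + k))) / (RtoC (INR m) + RtoC (INR m))) = (- v)%C).
    { rewrite plus_INR, RtoC_plus.
      replace ((z + (RtoC (INR m) + RtoC (INR k))) / (RtoC (INR m) + RtoC (INR m)))%C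
        with ((z + RtoC (INR k)) / (RtoC (INR m) + RtoC (INR m)) + / 2)%C by (field; auto).
      rewrite qexp_plus, qexp_half. fold v. ring. }
    rewrite E2. apply phi3_dup. rewrite <- E1. now apply qexp_div_neq1.
Qed.

Lemma psum_rev (a : nat -> C) (n : nat) : psum a n = psum (fun k => a (n - 1 - k)%nat) n.
Proof.
  induction n as [|n IH]; [reflexivity|].
  symmetry. change (S n) with (1 + n)%nat. rewrite psum_app. cbn [psum Nat.add]. rewrite IH.
  replace (S n - 1 - 0)%nat with n by lia. rewrite Cplus_0_l, Cplus_comm. f_equal.
  apply psum_ext. intros k Hk. f_equal. lia.
Qed.

(** Periodicity moves the upper half of the residues to the negative side, so that all arguments
    have real part near [-1/2, 1/2] and only the pole at 0 matters in the limit. *)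
Lemma psi_dist_sym (z : C) (r : nat) : qexp z <> 1 ->
  psum (fun k => psi ((z + RtoC (INR k)) / RtoC (INR (2 * 2 ^ r)))
                 + psi ((z - 1 - RtoC (INR k)) / RtoC (INR (2 * 2 ^ r))))%C (2 ^ r)
  = (RtoC (INR (2 * 2 ^ r)) ^ 4 * psi z)%C.
Proof.
  intros Hz. assert (H := psi_dist z (S r) Hz). cbn [Nat.pow] in H.
  assert (E16 : (16 ^ S r)%C = (RtoC (INR (2 * 2 ^ r)) ^ 4)%C).
  { change (2 * 2 ^ r)%nat with (2 ^ S r)%nat. generalize (S r). clear. induction n as [|n IH].
    - cbn [Nat.pow INR Cpow]. ring.
    - cbn [Cpow]. rewrite IH. replace (2 ^ S n)%nat with (2 ^ n + 2 ^ n)%nat by (cbn; lia).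
      rewrite plus_INR, RtoC_plus. ring. }
  rewrite E16 in H. rewrite <- H. set (m := (2 ^ r)%nat).
  assert (Hm : (0 < m)%nat) by apply pow2_pos. assert (Hm0 := INR_neq0 m Hm).
  replace (psum (fun k => psi ((z + RtoC (INR k)) / RtoC (INR (2 * m)))) (2 * m))
    with (psum (fun k => psi ((z + RtoC (INR k)) / RtoC (INR (2 * m)))) (m + m)) by (f_equal; lia).
  rewrite psum_app, psum_plus. f_equal. rewrite (psum_rev _ m). apply psum_ext. intros k Hk.
  unfold psi. f_equal. symmetry. rewrite <- qexp_sub1. f_equal.
  rewrite plus_INR, !minus_INR by lia. rewrite mult_INR. cbn [INR].
  rewrite !RtoC_minus, RtoC_mult, !RtoC_plus. field. auto.
Qed.

(** The range goes beyond PI / 2 because half-angles up to 3 PI / 4 occur in [Cexp_sub1_lower]; the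
    constant is crude on purpose. *)
Lemma sin_lower (x : R) : 0 <= x <= 3 * (PI / 4) -> x / 12 <= sin x.
Proof.
  assert (HP := PI_RGT_0). assert (HP4 := PI_4).
  assert (HP3 : 3 < PI) by (assert (H := PI2_3_2); lra).
  assert (Hsmall : forall y, 0 <= y <= PI / 2 -> y / 4 <= sin y).
  { intros y Hy. destruct (Rle_dec y (PI / 3)) as [H|H].
    - destruct (Req_dec y 0) as [E|E]; [subst; rewrite sin_0; lra|].
      destruct (MVT_cor2 sin cos 0 y) as [c [Hc Hc2]]; [lra|intros; apply derivable_pt_lim_sin|].
      rewrite sin_0 in Hc. assert (H1 : 1 / 2 <= cos c).
      { rewrite <- cos_PI3. apply cos_decr_1; lra. }
      assert (1 / 2 * y <= cos c * y) by (apply Rmult_le_compat_r; lra). lra.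
    - assert (H1 : sin (PI / 3) <= sin y) by (apply sin_incr_1; lra).
      rewrite sin_PI3 in H1. assert (1 <= sqrt 3) by (rewrite <- sqrt_1 at 1; apply sqrt_le_1; lra). lra. }
  intros Hx. destruct (Rle_dec x (PI / 2)) as [H|H].
  - assert (H1 := Hsmall x ltac:(lra)). lra.
  - assert (H1 := Hsmall (PI - x) ltac:(lra)). rewrite sin_PI_x in H1. lra.
Qed.

(** Rests on |1 - e^(-t + i th)|^2 = (1 - e^(-t))^2 + 4 e^(-t) sin(th / 2)^2. The two terms are at
    least t^2 / 9 and th^2 / 432, and 441 = 21^2 exceeds both denominators. *)
Lemma Cexp_sub1_lower (t th : R) : 0 <= t <= 1 -> Rabs th <= 3 * (PI / 2) ->
  Cmod (- t, th) / 21 <= Cmod (1 - Cexp (- t, th)).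
Proof.
  intros Ht Hth.
  assert (HE : / 3 <= exp (- t)).
  { rewrite exp_Ropp. apply Rinv_le_contravar; [apply exp_pos|].
    eapply Rle_trans; [|apply exp_le_3]. destruct (Req_dec t 1) as [->|N]; [lra|]. apply Rlt_le, exp_increasing. lra. }
  assert (HE1 : t / 3 <= 1 - exp (- t)).
  { assert (H := exp_ineq1_le t). assert (H0 : exp (- t) * exp t = 1) by (rewrite <- exp_plus; replace (- t + t) with 0 by ring; apply exp_0).
    assert (exp (- t) * (1 + t) <= 1) by (rewrite <- H0; apply Rmult_le_compat_l; [apply Rlt_le, exp_pos|lra]). nra. }
  assert (Hs : (th / 24) ^ 2 <= sin (th / 2) ^ 2).
  { destruct (Rle_dec 0 th) as [P|P].
    - rewrite Rabs_right in Hth by lra. apply pow_incr. split; [lra|].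
      replace (th / 24) with (th / 2 / 12) by field. apply sin_lower. lra.
    - rewrite Rabs_left in Hth by lra. replace (sin (th / 2) ^ 2) with (sin (- th / 2) ^ 2).
      + replace ((th / 24) ^ 2) with ((- th / 24) ^ 2) by field. apply pow_incr. split; [lra|].
        replace (- th / 24) with (- th / 2 / 12) by field. apply sin_lower. lra.
      + replace (- th / 2) with (- (th / 2)) by field. rewrite sin_neg. ring. }
  assert (E : Cmod (1 - Cexp (- t, th)) ^ 2 = (1 - exp (- t)) ^ 2 + 4 * exp (- t) * sin (th / 2) ^ 2).
  { rewrite Cmod2_alt. unfold Cexp; cbn [Re Im fst snd Cminus Cplus Copp RtoC].
    assert (Hc : cos th = 1 - 2 * sin (th / 2) ^ 2).
    { replace th with (2 * (th / 2)) at 1 by field. rewrite cos_2a_sin. ring. }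
    assert (H1 := sin2_cos2 th). unfold Rsqr in H1.
    replace ((1 + - (exp (- t) * cos th)) ^ 2 + (0 + - (exp (- t) * sin th)) ^ 2)
      with (1 - 2 * exp (- t) * cos th + exp (- t) ^ 2 * (sin th * sin th + cos th * cos th)) by ring.
    rewrite H1, Hc. ring. }
  apply Rsqr_incr_0; [|assert (H := Cmod_ge_0 (- t, th)); lra|apply Cmod_ge_0].
  rewrite !Rsqr_pow2, E. replace ((Cmod (- t, th) / 21) ^ 2) with (Cmod (- t, th) ^ 2 / 441) by field.
  rewrite Cmod2_alt. cbn [Re Im fst snd].
  assert ((t / 3) ^ 2 <= (1 - exp (- t)) ^ 2) by (apply pow_incr; lra).
  assert (4 * / 3 * (th / 24) ^ 2 <= 4 * exp (- t) * sin (th / 2) ^ 2).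
  { apply Rmult_le_compat; [lra|apply pow2_ge_0|lra|exact Hs]. }
  assert (0 <= t ^ 2) by apply pow2_ge_0. assert (0 <= th ^ 2) by apply pow2_ge_0. nra.
Qed.

Lemma phi3_num_le (u : C) : Cmod u <= 1 -> Cmod (u * (1 + 4 * u + u ^ 2)) <= 6.
Proof.
  intros H. assert (H0 := Cmod_ge_0 u). rewrite Cmod_mult.
  assert (Cmod (1 + 4 * u + u ^ 2) <= 6).
  { eapply Rle_trans; [apply Cmod_triangle|]. rewrite Cmod_pow.
    assert (Cmod (1 + 4 * u) <= 5).
    { eapply Rle_trans; [apply Cmod_triangle|]. rewrite Cmod_1, Cmod_mult, Cmod_R, Rabs_right by lra. lra. }
    assert (Cmod u ^ 2 <= 1) by nra. lra. }
  assert (H2 := Cmod_ge_0 (1 + 4 * u + u ^ 2)). nra.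
Qed.

Lemma ex_series_inv_sq : ex_series (fun k => / (INR k + 1) ^ 2).
Proof.
  apply (ex_series_le (K := R_AbsRing) (V := R_CompleteNormedModule) _ (fun k => 2 * (/ (INR k + 1) - / (INR (S k) + 1)))).
  - intros k. change (Rabs (/ (INR k + 1) ^ 2) <= 2 * (/ (INR k + 1) - / (INR (S k) + 1))).
    assert (H := pos_INR k). rewrite S_INR.
    assert (0 < / (INR k + 1) ^ 2) by (apply Rinv_0_lt_compat, pow_lt; lra).
    rewrite Rabs_right by lra.
    replace (2 * (/ (INR k + 1) - / (INR k + 1 + 1))) with (2 * (INR k + 1) / (INR k + 2) * / (INR k + 1) ^ 2) by (field; lra).
    rewrite <- (Rmult_1_l (/ (INR k + 1) ^ 2)) at 1. apply Rmult_le_compat_r; [lra|].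
    apply Rmult_le_reg_r with (INR k + 2); [lra|]. unfold Rdiv. rewrite Rmult_assoc, Rinv_l by lra. lra.
  - apply (ex_series_scal_l (V := R_NormedModule) 2). exists 1.
    change (is_lim_seq (sum_n (fun k => / (INR k + 1) - / (INR (S k) + 1))) 1).
    apply (is_lim_seq_ext (fun n => 1 - / (INR (S n) + 1))).
    + intros n. induction n as [|n IH].
      * rewrite sum_O. cbn. field.
      * rewrite sum_Sn, <- IH. unfold plus; cbn [AbelianMonoid.plus]. rewrite !S_INR. assert (H := pos_INR n). cbn. field. lra.
    + replace (Finite 1) with (Rbar_minus 1 0) by (cbn; f_equal; ring).
      apply is_lim_seq_minus'; [apply is_lim_seq_const|].
      replace (Finite 0) with (Rbar_inv p_infty) by reflexivity.
      apply is_lim_seq_inv; [|discriminate].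
      apply is_lim_seq_ext with (fun n => INR (S (S n))); [intros; apply S_INR|].
      apply -> (is_lim_seq_incr_1 (fun n => INR (S n))). apply -> is_lim_seq_incr_1. apply is_lim_seq_INR.
Qed.

Lemma pow2_large (B : R) : eventually (fun r => B < INR (2 * 2 ^ r)).
Proof.
  destruct (INR_unbounded B) as [n Hn]. exists n. intros r Hr. eapply Rlt_le_trans; [exact Hn|]. apply le_INR.
  assert (H : forall r, (r < 2 ^ r)%nat) by (clear; induction r; cbn; lia). specialize (H r). lia.
Qed.

(** The pole of [psi] at 0 has order 4; the 6 is the numerator 1 + 4 u + u^2 at u = 1. *)
Lemma clim_psi_scaled (w : C) : w <> 0 ->
  clim eventually (fun r => psi (w / RtoC (INR (2 * 2 ^ r))) / RtoC (INR (2 * 2 ^ r)) ^ 4)%C (6 / (tpi * w) ^ 4)%C.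
Proof.
  intros Hw. destruct Cexp_deriv_0 as [g [H1 [H2 H3]]].
  set (M := fun r : nat => RtoC (INR (2 * 2 ^ r))).
  assert (HM : forall r, M r <> 0) by (intros r; apply INR_neq0; assert (H := pow2_pos r); lia).
  set (h := fun r => (tpi * w / M r)%C).
  assert (Hh : clim eventually h 0).
  { intros eps He. assert (Hc := Cmod_ge_0 (tpi * w)).
    generalize (pow2_large (Cmod (tpi * w) / eps)). apply filter_imp. intros r Hr.
    unfold h. replace (tpi * w / M r - 0)%C with (tpi * w / M r)%C by ring. rewrite Cmod_div by apply HM.
    unfold M. rewrite Cmod_R, Rabs_right by (apply Rle_ge, pos_INR).
    assert (0 < INR (2 * 2 ^ r)) by (apply lt_0_INR; assert (H := pow2_pos r); lia).
    apply Rmult_lt_reg_r with (INR (2 * 2 ^ r)); [assumption|]. unfold Rdiv. rewrite Rmult_assoc, Rinv_l by lra.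
    apply Rmult_lt_reg_r with (/ eps); [now apply Rinv_0_lt_compat|]. 
    replace (eps * INR (2 * 2 ^ r) * / eps) with (INR (2 * 2 ^ r)) by (field; lra). lra. }
  assert (Hcomp : forall P, cnbhs 0 P -> eventually (fun r => P (h r))).
  { intros P [d [Hd HP]]. generalize (Hh d Hd). apply filter_imp. intros r Hr. now apply HP. }
  assert (Hu : clim eventually (fun r => Cexp (h r)) 1).
  { rewrite <- Cexp_0. apply (clim_comp eventually (cnbhs 0) h Cexp); [exact Hcomp|]. apply Cexp_cont. }
  assert (Hg : clim eventually (fun r => g (h r)) 1).
  { rewrite <- H2. apply (clim_comp eventually (cnbhs 0) h g); [exact Hcomp|exact H3]. }
  assert (Htw : (tpi * w)%C <> 0) by (apply Cmult_neq_0; [apply tpi_neq0|exact Hw]).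
  apply clim_ext with (fun r => Cexp (h r) * (1 + 4 * Cexp (h r) + Cexp (h r) ^ 2) / (- (tpi * w) * g (h r)) ^ 4)%C.
  - generalize (filter_and _ _ (Hcomp _ H1) (clim_neq0 _ _ C1_neq0 Hg)). apply filter_imp. intros r [Hr Hr'].
    fold (M r). unfold psi, phi3, qexp. replace (2 * PI * Ci * (w / M r))%C with (h r)
      by (unfold h, tpi; field; apply HM).
    assert (Hg0 : g (h r) <> 0) by (apply Cmod_gt_0; assert (H := Cmod_1); lra).
    assert (Hr2 : (1 - Cexp (h r))%C = (- (tpi * w / M r * g (h r)))%C).
    { rewrite Cexp_0 in Hr. change (tpi * w / M r)%C with (h r).
      replace (1 - Cexp (h r))%C with (- (Cexp (h r) - 1))%C by ring. rewrite Hr. ring. }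
    rewrite Hr2. set (u := Cexp (h r)) in *. set (gg := g (h r)) in *.
    field. repeat split; try apply HM; try exact Hw; try apply tpi_neq0; try exact Hg0.
  - replace (6 / (tpi * w) ^ 4)%C with (1 * (1 + 4 * 1 + 1 ^ 2) / (- (tpi * w) * 1) ^ 4)%C by (field; split; [exact Hw|apply tpi_neq0]).
    apply clim_div.
    + replace (- (tpi * w) * 1)%C with (- (tpi * w))%C by ring.
      apply Cpow_nz. intros E. apply Htw. replace (tpi * w)%C with (- (- (tpi * w)))%C by ring. rewrite E. ring.
    + apply clim_mult; [exact Hu|]. apply clim_plus; [|now apply clim_pow].
      apply clim_plus; [apply clim_const|]. apply clim_mult; [apply clim_const|exact Hu].
    + apply clim_pow. apply clim_mult; [apply clim_const|exact Hg].
Qed.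


(** The majorant for [tannery]. The conditions on Im z and Re z put 2 i PI z / M into the range of
    [Cexp_sub1_lower], whose 21 enters to the fourth power; the 6 bounds the numerator of [phi3]. *)
Lemma psi_scaled_bound (w M : R) (z : C) : 0 < M -> 0 <= Im z -> 2 * PI * Im z <= M -> Rabs (Re z) <= 3 * M / 4 ->
  z <> 0 -> Cmod (psi (z / RtoC M) / RtoC M ^ 4) <= 6 * 21 ^ 4 / Cmod z ^ 4.
Proof.
  intros HM Hi1 Hi2 Hr Hz. assert (HP := PI_RGT_0). assert (HP3 : 3 < PI) by (assert (H := PI2_3_2); lra).
  assert (HM0 : RtoC M <> 0) by (intros E; apply RtoC_inj in E; lra).
  assert (Hz' := proj1 (Cmod_gt_0 z) Hz).
  assert (E : (2 * PI * Ci * (z / RtoC M))%C = (- (2 * PI * Im z / M), 2 * PI * Re z / M)).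
  { destruct z as [x y]. rewrite (Cmult_comm _ ((x, y) / M)%C). unfold Cdiv. rewrite <- RtoC_inv by lra.
    unfold Ci, RtoC, Cmult; cbn. f_equal; field; lra. }
  set (t := 2 * PI * Im z / M) in *. set (th := 2 * PI * Re z / M) in *.
  assert (Ht : 0 <= t <= 1).
  { unfold t. split; [apply Rdiv_le_0_compat; [apply Rmult_le_pos; lra|exact HM]|].
    apply Rmult_le_reg_r with M; [exact HM|]. unfold Rdiv. rewrite Rmult_assoc, Rinv_l; lra. }
  assert (Hth : Rabs th <= 3 * (PI / 2)).
  { unfold th, Rdiv. rewrite !Rabs_mult, Rabs_inv, (Rabs_right 2), (Rabs_right PI), (Rabs_right M) by lra.
    apply Rmult_le_reg_r with M; [exact HM|]. rewrite Rmult_assoc, Rinv_l, Rmult_1_r by lra. nra. }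
  assert (Hl := Cexp_sub1_lower t th Ht Hth). rewrite <- E in Hl. fold (qexp (z / RtoC M)) in Hl.
  assert (Hq : Cmod (qexp (z / M)) <= 1).
  { unfold qexp. rewrite E, Cexp_mod. cbn [Re fst]. rewrite <- exp_0.
    destruct (Req_dec t 0) as [->|N]; [rewrite Ropp_0; lra|]. apply Rlt_le, exp_increasing. lra. }
  assert (Hzl : Cmod z / M <= Cmod (2 * PI * Ci * (z / M))).
  { rewrite Cmod_mult, Cmod_div by exact HM0. rewrite (Cmod_R M), Rabs_right by lra.
    rewrite <- (Rmult_1_l (Cmod z / M)) at 1. apply Rmult_le_compat_r; [apply Rdiv_le_0_compat; lra|].
    rewrite !Cmod_mult, !Cmod_R, Cmod_Ci, !Rabs_right; lra. }
  set (u := qexp (z / M)) in *.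
  assert (Hlow : Cmod z / (21 * M) <= Cmod (1 - u)).
  { eapply Rle_trans; [|exact Hl]. apply Rle_trans with (Cmod z / M / 21); [right; field; lra|].
    apply Rmult_le_compat_r; [lra|exact Hzl]. }
  assert (Hp : 0 < Cmod z / (21 * M)) by (apply Rdiv_lt_0_compat; lra).
  assert (Hu1 : (1 - u)%C <> 0) by (apply Cmod_gt_0; lra).
  unfold psi, phi3. fold u. unfold Cdiv. rewrite Cmod_mult, Cmod_mult, !Cmod_inv, !Cmod_pow, Cmod_R, Rabs_right by (try apply Cpow_nz; auto; lra).
  apply Rle_trans with (6 * / (Cmod z / (21 * M)) ^ 4 * / M ^ 4).
  - apply Rmult_le_compat_r; [apply Rlt_le, Rinv_0_lt_compat, pow_lt; exact HM|].
    apply Rmult_le_compat; [apply Cmod_ge_0|apply Rlt_le, Rinv_0_lt_compat, pow_lt; lra|now apply phi3_num_le|].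
    apply Rinv_le_contravar; [apply pow_lt; lra|]. apply pow_incr. lra.
  - right. field. split; lra.
Qed.

Lemma linear_lower (z : C) (d : R) (k : nat) (w : C) : 0 < d -> d <= Cmod w -> INR k <= Cmod w + Cmod z + 1 ->
  (INR k + 1) <= (1 + (Cmod z + 2) / d) * Cmod w.
Proof.
  intros Hd Hw Hk. assert (H := Cmod_ge_0 z).
  assert ((Cmod z + 2) / d * Cmod w >= Cmod z + 2).
  { apply Rle_ge. replace (Cmod z + 2) with ((Cmod z + 2) / d * d) at 1 by (field; lra).
    apply Rmult_le_compat_l; [apply Rdiv_le_0_compat; lra|exact Hw]. }
  lra.
Qed.

Lemma INR_le_Cmod_plus (z : C) (k : nat) : INR k <= Cmod (z + RtoC (INR k)) + Cmod z.
Proof.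
  assert (H : Cmod (RtoC (INR k)) <= Cmod (z + RtoC (INR k)) + Cmod (- z)).
  { eapply Rle_trans; [|apply Cmod_triangle]. right. f_equal. ring. }
  rewrite Cmod_opp, Cmod_R, Rabs_right in H; [exact H|apply Rle_ge, pos_INR].
Qed.

Lemma INR_le_Cmod_minus (z : C) (k : nat) : INR k <= Cmod (z - RtoC (INR k)) + Cmod z.
Proof.
  assert (H : Cmod (RtoC (INR k)) <= Cmod (- (z - RtoC (INR k))) + Cmod z).
  { eapply Rle_trans; [|apply Cmod_triangle]. right. f_equal. ring. }
  rewrite Cmod_opp, Cmod_R, Rabs_right in H; [exact H|apply Rle_ge, pos_INR].
Qed.

Lemma inv_pow4_dom (k : nat) (x K : R) : 0 < x -> 0 <= K -> INR k + 1 <= K * x -> / x ^ 4 <= K ^ 4 * / (INR k + 1) ^ 2.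
Proof.
  intros Hx HK H. assert (Hk := pos_INR k). set (n := INR k + 1) in *. assert (1 <= n) by (unfold n; lra).
  assert (0 < K) by nra.
  assert (H4 : n ^ 4 <= K ^ 4 * x ^ 4) by (rewrite <- Rpow_mult_distr; apply pow_incr; lra).
  assert (H2 : n ^ 2 <= n ^ 4) by (apply Rle_pow; [lra|lia]).
  assert (0 < x ^ 4) by (apply pow_lt; lra). assert (0 < n ^ 2) by (apply pow_lt; lra).
  apply Rmult_le_reg_r with (x ^ 4 * n ^ 2); [nra|].
  replace (/ x ^ 4 * (x ^ 4 * n ^ 2)) with (n ^ 2) by (field; lra).
  replace (K ^ 4 * / n ^ 2 * (x ^ 4 * n ^ 2)) with (K ^ 4 * x ^ 4) by (field; lra). lra.
Qed.

Lemma lipschitz (z : C) (d : R) : 0 <= Im z -> 0 < d -> qexp z <> 1 ->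
  (forall k : nat, d <= Cmod (z + RtoC (INR k)) /\ d <= Cmod (z - 1 - RtoC (INR k))) ->
  csum (fun k => / (z + RtoC (INR k)) ^ 4 + / (z - 1 - RtoC (INR k)) ^ 4)%C (tpi ^ 4 / 6 * psi z)%C.
Proof.
  intros Hz Hd Hq Hdist. assert (HP := PI_RGT_0).
  assert (Hn1 : forall k, (z + RtoC (INR k))%C <> 0) by (intros k; apply Cmod_gt_0; specialize (Hdist k); lra).
  assert (Hn2 : forall k, (z - 1 - RtoC (INR k))%C <> 0) by (intros k; apply Cmod_gt_0; specialize (Hdist k); lra).
  set (M := fun r : nat => RtoC (INR (2 * 2 ^ r))).
  (* The finite sums of [psi_dist_sym] divided by M^4 and padded with zeros to series; their total
     is [psi z] for every r. *)
  set (a := fun r k => if (k <? 2 ^ r)%nat then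
     (psi ((z + RtoC (INR k)) / M r) / M r ^ 4 + psi ((z - 1 - RtoC (INR k)) / M r) / M r ^ 4)%C else RtoC 0).
  set (K := 1 + (Cmod z + 2) / d + ((Cmod (z - 1) + 2) / d)).
  assert (Hz0 := Cmod_ge_0 z). assert (Hz1 := Cmod_ge_0 (z - 1)).
  assert (HKa : 0 <= (Cmod z + 2) / d) by (apply Rdiv_le_0_compat; lra).
  assert (HKb : 0 <= (Cmod (z - 1) + 2) / d) by (apply Rdiv_le_0_compat; lra).
  assert (HK0 : 0 <= K) by (unfold K; lra).
  assert (HK1 : forall k, INR k + 1 <= K * Cmod (z + RtoC (INR k))).
  { intros k. assert (H := linear_lower z d k (z + RtoC (INR k)) Hd (proj1 (Hdist k))).
    assert (H' := INR_le_Cmod_plus z k). assert (H0 := Cmod_ge_0 (z + RtoC (INR k))).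
    eapply Rle_trans; [apply H; lra|]. apply Rmult_le_compat_r; [lra|unfold K; lra]. }
  assert (HK2 : forall k, INR k + 1 <= K * Cmod (z - 1 - RtoC (INR k))).
  { intros k. assert (H := linear_lower (z - 1) d k (z - 1 - RtoC (INR k)) Hd (proj2 (Hdist k))).
    assert (H' := INR_le_Cmod_minus (z - 1) k). assert (H0 := Cmod_ge_0 (z - 1 - RtoC (INR k))).
    eapply Rle_trans; [apply H; lra|]. apply Rmult_le_compat_r; [lra|unfold K; lra]. }
  set (B := 6 * 21 ^ 4 * K ^ 4 + 6 * 21 ^ 4 * K ^ 4).
  assert (Hex : ex_series (fun k => B * / (INR k + 1) ^ 2))
    by (apply (ex_series_scal_l (V := R_NormedModule) B), ex_series_inv_sq).
  assert (HK4 : 0 <= K ^ 4) by now apply pow_le.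
  destruct (tannery (F := eventually) a (fun k => 6 / (tpi * (z + RtoC (INR k))) ^ 4 + 6 / (tpi * (z - 1 - RtoC (INR k))) ^ 4)%C
     (fun k => B * / (INR k + 1) ^ 2) (fun _ => psi z) Hex) as [H1 H2].
  (* For M = 2 * 2^r above 4 (|z| + 1) and k < 2^r, both real parts are bounded by |z| + k + 1 <= M
     / 4 + M / 2. *)
  - generalize (pow2_large (Rmax (2 * PI * Im z) (4 * (Cmod z + 1)))). apply filter_imp. intros r Hr k.
    assert (Hr1 := Rle_lt_trans _ _ _ (Rmax_l _ _) Hr). assert (Hr2 := Rle_lt_trans _ _ _ (Rmax_r _ _) Hr).
    assert (Hk2 : 0 < / (INR k + 1) ^ 2) by (apply Rinv_0_lt_compat, INR1_pow_pos).
    unfold a. destruct (Nat.ltb_spec k (2 ^ r)) as [Hk|Hk].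
    2:{ rewrite Cmod_0. apply Rmult_le_pos; [|lra]. unfold B. assert (H := pow_le 21 4 ltac:(lra)). nra. }
    assert (Hre := re_le_Cmod z).
    assert (HkM : 2 * INR k <= INR (2 * 2 ^ r)).
    { replace 2 with (INR 2) at 1 by (cbn; ring). rewrite <- mult_INR. apply le_INR. lia. }
    assert (HkM' : 2 * (INR k + 1) <= INR (2 * 2 ^ r)).
    { replace 2 with (INR 2) at 1 by (cbn; ring). rewrite <- S_INR, <- mult_INR. apply le_INR. lia. }
    assert (Hk0 := pos_INR k).
    eapply Rle_trans; [apply Cmod_triangle|]. unfold B. rewrite Rmult_plus_distr_r.
    assert (HC : forall x, 0 < x -> INR k + 1 <= K * x -> 6 * 21 ^ 4 / x ^ 4 <= 6 * 21 ^ 4 * K ^ 4 * / (INR k + 1) ^ 2).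
    { intros x Hx Hx'. unfold Rdiv. rewrite (Rmult_assoc (6 * 21 ^ 4)). apply Rmult_le_compat_l; [assert (H := pow_le 21 4 ltac:(lra)); lra|].
      now apply inv_pow4_dom. }
    apply Rplus_le_compat.
    + eapply Rle_trans; [apply (psi_scaled_bound 0)|apply HC; [apply Cmod_gt_0, Hn1|apply HK1]]; try lra.
      * destruct z; cbn in *; lra.
      * destruct z; cbn in *; lra.
      * replace (Re (z + RtoC (INR k))) with (Re z + INR k) by (destruct z; reflexivity).
        eapply Rle_trans; [apply Rabs_triang|]. rewrite (Rabs_right (INR k)) by lra. lra.
      * apply Hn1.
    + eapply Rle_trans; [apply (psi_scaled_bound 0)|apply HC; [apply Cmod_gt_0, Hn2|apply HK2]]; try lra.
      * destruct z; cbn in *; lra.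
      * destruct z; cbn in *; lra.
      * replace (Re (z - 1 - RtoC (INR k))) with (Re z + - (INR k + 1)) by (destruct z; cbn; ring).
        eapply Rle_trans; [apply Rabs_triang|]. rewrite Rabs_Ropp, (Rabs_right (INR k + 1)) by lra. lra.
      * apply Hn2.
  - intros k. apply clim_ext with (fun r => psi ((z + RtoC (INR k)) / M r) / M r ^ 4 + psi ((z - 1 - RtoC (INR k)) / M r) / M r ^ 4)%C.
    + exists k. intros r Hr. unfold a. destruct (Nat.ltb_spec k (2 ^ r)) as [Hk|Hk]; [reflexivity|].
      assert (H : forall r, (r < 2 ^ r)%nat) by (clear; induction r; cbn; lia). specialize (H r). lia.
    + apply clim_plus; apply clim_psi_scaled; [apply Hn1|apply Hn2].
  - apply filter_forall. intros r.
    assert (HM : M r <> 0) by (apply INR_neq0; assert (H := pow2_pos r); lia).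
    replace (psi z) with (psum (a r) (2 ^ r)).
    + apply csum_finite. intros k Hk. unfold a. destruct (Nat.ltb_spec k (2 ^ r)); [lia|reflexivity].
    + rewrite (psum_ext _ (fun k => / M r ^ 4 * (psi ((z + RtoC (INR k)) / M r) + psi ((z - 1 - RtoC (INR k)) / M r)))%C).
      * rewrite psum_scal. unfold M. rewrite psi_dist_sym by exact Hq. field. exact HM.
      * intros k Hk. unfold a. destruct (Nat.ltb_spec k (2 ^ r)); [|lia]. field. exact HM.
  - assert (E : CSeries (fun k => 6 / (tpi * (z + RtoC (INR k))) ^ 4 + 6 / (tpi * (z - 1 - RtoC (INR k))) ^ 4)%C = psi z).
    { apply (clim_unique (F := eventually) (fun _ : nat => psi z)); [exact H1|apply clim_const]. }
    rewrite E in H2. apply (csum_scal (tpi ^ 4 / 6)) in H2. revert H2. apply csum_ext. intros k.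
    field. repeat split; [apply Hn2|apply Hn1|apply tpi_neq0].
Qed.

Lemma qexp_neq1_H (z : C) : 0 < Im z -> qexp z <> 1.
Proof. intros Hz E. assert (H := qexp_lt1 z Hz). rewrite E, Cmod_1 in H. lra. Qed.

Lemma lipschitz_H (z : C) : 0 < Im z ->
  csum (fun k => / (z + RtoC (INR k)) ^ 4 + / (z - 1 - RtoC (INR k)) ^ 4)%C (tpi ^ 4 / 6 * psi z)%C.
Proof.
  intros Hz. apply lipschitz with (Im z); [lra|exact Hz|now apply qexp_neq1_H|].
  intros k. split.
  - assert (H := im_le_Cmod (z + RtoC (INR k))). replace (Im (z + RtoC (INR k))) with (Im z) in H by (destruct z; cbn; ring).
    rewrite Rabs_right in H; lra.
  - assert (H := im_le_Cmod (z - 1 - RtoC (INR k))). replace (Im (z - 1 - RtoC (INR k))) with (Im z) in H by (destruct z; cbn; ring).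
    rewrite Rabs_right in H; lra.
Qed.

(** * The value of zeta(4) *)

Definition zeta4 : C := CSeries (fun k => / RtoC (INR (S k)) ^ 4)%C.

Lemma zeta4_csum : csum (fun k => / RtoC (INR (S k)) ^ 4)%C zeta4.
Proof.
  apply ex_csum with (fun k => / (INR k + 1) ^ 2); [|apply ex_series_inv_sq].
  intros k. rewrite Cmod_inv by (apply Cpow_nz, INR_neq0; lia). rewrite Cmod_pow, Cmod_R, Rabs_right by (apply Rle_ge, pos_INR).
  rewrite S_INR. apply Rinv_le_contravar; [apply INR1_pow_pos|apply INR1_pow_le; lia].
Qed.

(** The Lipschitz formula at z = 1/2, where both terms of a pair equal 16 / (2 k + 1)^4 and [psi]
    takes the value [phi3 (- 1)] = 1/8. *)
Lemma odd4_csum : csum (fun k => / RtoC (INR (2 * k + 1)) ^ 4)%C (tpi ^ 4 / 6 / 256)%C.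
Proof.
  assert (Hq : qexp (/ 2) <> 1).
  { rewrite qexp_half. intros E. assert (E' : (RtoC 1 + 1)%C = 0) by (rewrite <- E at 1; ring).
    rewrite <- RtoC_plus in E'. apply RtoC_inj in E'. lra. }
  assert (E : forall k, (/ 2 + RtoC (INR k))%C = (RtoC (INR (2 * k + 1)) / 2)%C).
  { intros k. rewrite plus_INR, mult_INR. cbn [INR]. rewrite !RtoC_plus, RtoC_mult, RtoC_plus. field. }
  assert (E' : forall k, (/ 2 - 1 - RtoC (INR k))%C = (- (RtoC (INR (2 * k + 1)) / 2))%C).
  { intros k. rewrite plus_INR, mult_INR. cbn [INR]. rewrite !RtoC_plus, RtoC_mult, RtoC_plus. field. }
  assert (Hd : forall k, / 2 <= Cmod (RtoC (INR (2 * k + 1)) / 2)).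
  { intros k. rewrite <- RtoC_div, Cmod_R, Rabs_right by lra || (apply Rle_ge, Rdiv_le_0_compat; [apply pos_INR|lra]).
    assert (1 <= INR (2 * k + 1)) by (replace 1 with (INR 1) by reflexivity; apply le_INR; lia). lra. }
  assert (H := lipschitz (/ 2)%C (/ 2)).
  assert (HH : csum (fun k => / (/ 2 + RtoC (INR k)) ^ 4 + / (/ 2 - 1 - RtoC (INR k)) ^ 4)%C (tpi ^ 4 / 6 * psi (/ 2))%C).
  { apply H; [|lra|exact Hq|].
    - rewrite <- RtoC_inv by lra. cbn. lra.
    - intros k. rewrite E, E', Cmod_opp. split; apply Hd. }
  apply (csum_scal (/ 32)) in HH. clear H.
  replace (tpi ^ 4 / 6 / 256)%C with (/ 32 * (tpi ^ 4 / 6 * psi (/ 2)))%C.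
  - revert HH. apply csum_ext. intros k. rewrite E, E'. assert (Hn : RtoC (INR (2 * k + 1)) <> 0) by (apply INR_neq0; lia).
    field. exact Hn.
  - unfold psi, phi3. rewrite qexp_half. replace (1 - - (1))%C with (RtoC 2) by ring. field.
Qed.

(** PI^4 / 90 in terms of [tpi]: the even terms contribute zeta(4) / 16 and the odd ones are
    [odd4_csum]. *)
Lemma zeta4_val : zeta4 = (tpi ^ 4 / 1440)%C.
Proof.
  assert (H1 := zeta4_csum). assert (H2 := odd4_csum).
  set (a := fun k => (/ RtoC (INR (S k)) ^ 4)%C) in *. set (b := fun k => (/ RtoC (INR (2 * k + 1)) ^ 4)%C) in *.
  assert (E : forall n, psum a (2 * n) = (psum b n + / 16 * psum a n)%C).
  { induction n as [|n IH]; [cbn; ring|].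
    replace (2 * S n)%nat with (S (S (2 * n))) by lia. cbn [psum]. rewrite IH. unfold a, b.
    replace (INR (S (S (2 * n)))) with (2 * INR (S n)).
    - replace (S (2 * n)) with (2 * n + 1)%nat by lia. rewrite RtoC_mult.
      assert (Hn : RtoC (INR (2 * n + 1)) <> 0) by (apply INR_neq0; lia).
      assert (Hn' : RtoC (INR (S n)) <> 0) by (apply INR_neq0; lia). field. split; assumption.
    - rewrite !S_INR, mult_INR. cbn [INR]. ring. }
  assert (L : zeta4 = (tpi ^ 4 / 6 / 256 + / 16 * zeta4)%C).
  { apply (clim_unique (F := eventually) (fun n => psum a (2 * n))).
    - apply (clim_comp eventually eventually (fun n => 2 * n)%nat (psum a)); [|exact H1].
      intros P [N HN]. exists N. intros n Hn. apply HN. lia.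
    - apply clim_ext_all with (fun n => psum b n + / 16 * psum a n)%C; [intros; now rewrite E|].
      apply clim_plus; [exact H2|]. apply clim_mult; [apply clim_const|exact H1]. }
  assert (L2 : (15 / 16 * zeta4)%C = (tpi ^ 4 / 6 / 256)%C).
  { replace (15 / 16 * zeta4)%C with (zeta4 - / 16 * zeta4)%C by field. rewrite L at 1. ring. }
  replace zeta4 with (16 / 15 * (15 / 16 * zeta4))%C by field. rewrite L2. field.
Qed.

(** * Modularity of [E4] *)

Lemma PS_theta_val (a : nat -> C) (f f' : C -> C) : polyg a ->
  (forall u, Cmod u < 1 -> PS a u = f u) -> (forall u, Cmod u < 1 -> cderiv f u (f' u)) ->
  forall u, Cmod u < 1 -> PS (theta a) u = (u * f' u)%C.
Proof.
  intros Ha Hf Hd u Hu. rewrite PS_theta by assumption. f_equal.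
  apply (cderiv_unique f u); [|now apply Hd]. apply cderiv_local with (PS a); [|now apply PS_deriv].
  generalize (ccont_mod_lt (fun w => w) u 1 (ccont_id u) Hu). apply filter_imp. exact Hf.
Qed.

Lemma cube_PS (u : C) : Cmod u < 1 -> PS (theta (theta (theta (fun _ => RtoC 1)))) u = phi3 u.
Proof.
  assert (N : forall u, Cmod u < 1 -> (1 - u)%C <> 0).
  { intros v Hv. apply C1_neq. intros E. rewrite E, Cmod_1 in Hv. lra. }
  assert (P0 : polyg (fun _ => RtoC 1)) by apply polyg_const.
  assert (P1 := polyg_theta _ P0). assert (P2 := polyg_theta _ P1).
  assert (D1 : forall u : C, cderiv (fun w => 1 - w)%C u (0 - 1)) by (intros; apply cderiv_minus; [apply cderiv_const|apply cderiv_id]).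
  assert (H0 : forall u, Cmod u < 1 -> PS (fun _ => RtoC 1) u = (/ (1 - u))%C).
  { intros v Hv. apply PS_unique. generalize (csum_geom v Hv). apply csum_ext. intros. ring. }
  assert (H1 := PS_theta_val _ _ (fun u => / (1 - u) ^ 2)%C P0 H0).
  assert (H1' : forall u, Cmod u < 1 -> PS (theta (fun _ => RtoC 1)) u = (u * / (1 - u) ^ 2)%C).
  { apply H1. intros v Hv. eapply cderiv_val; [apply (cderiv_inv _ _ _ (N v Hv) (D1 v))|]. field. now apply N. }
  assert (H2 := PS_theta_val _ _ (fun u => (1 + u) / (1 - u) ^ 3)%C P1 H1').
  assert (H2' : forall u, Cmod u < 1 -> PS (theta (theta (fun _ => RtoC 1))) u = (u * ((1 + u) / (1 - u) ^ 3))%C).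
  { apply H2. intros v Hv. eapply cderiv_val.
    - apply (cderiv_mult (fun u => u) (fun u => / (1 - u) ^ 2)%C); [apply cderiv_id|].
      apply (cderiv_inv (fun u => (1 - u) ^ 2)%C); [now apply Cpow_nz, N|]. apply (cderiv_pow (fun u => 1 - u)%C), D1.
    - cbn [INR pred]. rewrite RtoC_plus. field. now apply N. }
  assert (H3 := PS_theta_val _ _ (fun u => (1 + 4 * u + u ^ 2) / (1 - u) ^ 4)%C P2 H2').
  intros Hu. rewrite H3; [unfold phi3; field; now apply N| |exact Hu].
  intros v Hv. eapply cderiv_val.
  - apply (cderiv_mult (fun u => u) (fun u => (1 + u) / (1 - u) ^ 3)%C); [apply cderiv_id|].
    apply (cderiv_div (fun u => 1 + u)%C (fun u => (1 - u) ^ 3)%C); [now apply Cpow_nz, N| |apply (cderiv_pow (fun u => 1 - u)%C), D1].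
    apply cderiv_plus; [apply cderiv_const|apply cderiv_id].
  - cbn [INR pred]. rewrite !RtoC_plus. field. now apply N.
Qed.

Lemma growth_snd (k : nat) : growth (fun _ x => INR x ^ k).
Proof.
  exists 1, k. split; [lra|]. intros e x He Hx. rewrite Rmult_1_l, Rabs_right by (apply Rle_ge, pow_le, pos_INR).
  apply pow_incr. split; [apply pos_INR|]. assert (H : INR x <= INR (e * x)) by (apply le_INR; nia). lra.
Qed.

Lemma sumD_swap (g : nat -> nat -> R) (n : nat) : sumD (fun e x => g x e) n = sumD g n.
Proof.
  apply (sumL_bij (fun t => (snd t, fst t)) (fun t => (snd t, fst t))); try apply NoDup_pairs;
    intros [e x]; cbn; rewrite !in_pairs; intros (? & ? & ?); repeat split; lia.
Qed.

(** The Lambert double series with the cube on the inner variable: each inner sum is then a value of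
    [psi], to which the Lipschitz formula applies. *)
Lemma psi_csum (t : C) : 0 < Im t -> csum (fun m => psi (RtoC (INR (S m)) * t))%C (PS (sigc 3) (qexp t)).
Proof.
  intros Ht. assert (Hq := qexp_lt1 t Ht).
  rewrite (PS_ext (sigc 3) (fun n => RtoC (sumD (fun _ x => INR x ^ 3) n))).
  2:{ intros n. unfold sigc, sig. now rewrite <- (sumD_swap (fun _ x => INR x ^ 3)). }
  apply (lambert_grid (fun _ x => INR x ^ 3)); [apply growth_snd|exact Hq|].
  intros m. assert (Hm := Cmod_pow_lt1 (qexp t) (S m) Hq ltac:(lia)). unfold psi. rewrite <- qexp_pow.
  set (u := (qexp t ^ S m)%C) in *. rewrite <- cube_PS by exact Hm.
  assert (P : polyg (theta (theta (theta (fun _ => RtoC 1))))) by (repeat apply polyg_theta; apply polyg_const).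
  assert (H := PS_csum _ u P Hm).
  replace (PS (theta (theta (theta (fun _ => RtoC 1)))) u)
    with ((fun n => theta (theta (theta (fun _ => RtoC 1))) n * u ^ n)%C O + PS (theta (theta (theta (fun _ => RtoC 1)))) u)%C in H
    by (unfold theta at 1; cbn [INR]; ring).
  apply csum_incr in H. revert H. apply csum_ext. intros d. unfold theta, u.
  rewrite <- Cpow_mult_r, RtoC_pow. ring.
Qed.


Lemma Im_scal_plus (x y : R) (t : C) : Im (RtoC x * t + RtoC y) = x * Im t.
Proof. destruct t. cbn. ring. Qed.

Lemma lattice_lower (t : C) : 0 < Im t -> exists K, 0 <= K /\ forall x y : R, 0 <= x ->
  Rabs y + x <= K * Cmod (RtoC x * t + RtoC y).
Proof.
  intros Ht. exists (1 + (1 + Cmod t) / Im t). assert (Ht0 := Cmod_ge_0 t).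
  assert (Hq : 0 <= (1 + Cmod t) / Im t) by (apply Rdiv_le_0_compat; lra).
  split; [lra|]. intros x y Hx.
  assert (H1 := im_le_Cmod (RtoC x * t + RtoC y)). rewrite Im_scal_plus, Rabs_right in H1 by nra.
  assert (H2 : Rabs y <= Cmod (RtoC x * t + RtoC y) + x * Cmod t).
  { rewrite <- (Cmod_R y). replace (RtoC y) with ((RtoC x * t + RtoC y) + - (RtoC x * t))%C at 1 by ring.
    eapply Rle_trans; [apply Cmod_triangle|]. rewrite Cmod_opp, Cmod_mult, Cmod_R, (Rabs_right x) by lra. lra. }
  set (A := Cmod (RtoC x * t + RtoC y)) in *.
  assert (x * (1 + Cmod t) <= (1 + Cmod t) / Im t * A).
  { replace (x * (1 + Cmod t)) with ((1 + Cmod t) / Im t * (x * Im t)) by (field; lra).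
    apply Rmult_le_compat_l; assumption. }
  lra.
Qed.

(** From (M N)^2 <= (M + N)^4 the fourth power of the norm splits into separate squares, giving an
    absolutely summable product majorant. *)
Lemma lattice_inv4 (t : C) : 0 < Im t -> exists K, 0 <= K /\ forall (m n : nat) (y : R), Rabs y = INR (S n) ->
  Cmod (/ (RtoC (INR (S m)) * t + RtoC y) ^ 4) <= K * (/ (INR m + 1) ^ 2 * / (INR n + 1) ^ 2).
Proof.
  intros Ht. destruct (lattice_lower t Ht) as [K [HK H]]. exists (K ^ 4). split; [now apply pow_le|].
  intros m n y Hy. specialize (H (INR (S m)) y (pos_INR _)). rewrite Hy in H. rewrite !S_INR in *.
  set (w := (RtoC (INR m + 1) * t + RtoC y)%C) in *.
  assert (Hm := pos_INR m). assert (Hn := pos_INR n). assert (Hw := Cmod_ge_0 w).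
  assert (Hw0 : 0 < Cmod w). { destruct (Req_dec (Cmod w) 0) as [E|E]; [rewrite E in H; lra|lra]. }
  rewrite Cmod_inv by (now apply Cpow_nz, Cmod_gt_0). rewrite Cmod_pow.
  set (M := INR m + 1) in *. set (N := INR n + 1) in *. assert (1 <= M) by (unfold M; lra). assert (1 <= N) by (unfold N; lra).
  assert (H4 : (N + M) ^ 4 <= K ^ 4 * Cmod w ^ 4) by (rewrite <- Rpow_mult_distr; apply pow_incr; lra).
  assert (H2 : M ^ 2 * N ^ 2 <= (N + M) ^ 4).
  { replace (M ^ 2 * N ^ 2) with ((M * N) ^ 2) by ring. replace ((N + M) ^ 4) with (((N + M) * (N + M)) ^ 2) by ring.
    apply pow_incr. nra. }
  assert (0 < Cmod w ^ 4) by (apply pow_lt; lra). assert (0 < M ^ 2) by (apply pow_lt; lra). assert (0 < N ^ 2) by (apply pow_lt; lra).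
  assert (0 < M ^ 2 * N ^ 2) by nra.
  apply Rmult_le_reg_r with (Cmod w ^ 4 * (M ^ 2 * N ^ 2)); [nra|].
  replace (/ Cmod w ^ 4 * (Cmod w ^ 4 * (M ^ 2 * N ^ 2))) with (M ^ 2 * N ^ 2) by (field; lra).
  replace (K ^ 4 * (/ M ^ 2 * / N ^ 2) * (Cmod w ^ 4 * (M ^ 2 * N ^ 2))) with (K ^ 4 * Cmod w ^ 4) by (field; lra). lra.
Qed.

(** The points (m, n) and (m, -n) of a half lattice without its axes; on this index set t -> -1/t
    just exchanges m and n. *)
Definition lat4 (t : C) (m n : nat) : C :=
  (/ (RtoC (INR (S m)) * t + RtoC (INR (S n))) ^ 4 + / (RtoC (INR (S m)) * t - RtoC (INR (S n))) ^ 4)%C.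

(** The Lipschitz series pairs k with -1 - k, whereas here n is paired with -n and the term at 0 is
    omitted; the partial sums differ by [/ z ^ 4] and one boundary term tending to 0. *)
Lemma lat4_row (z : C) : 0 < Im z ->
  csum (fun n => / (z + RtoC (INR (S n))) ^ 4 + / (z - RtoC (INR (S n))) ^ 4)%C (tpi ^ 4 / 6 * psi z - / z ^ 4)%C.
Proof.
  intros Hz. assert (H := lipschitz_H z Hz).
  set (f := fun k => (/ (z + RtoC (INR k)) ^ 4 + / (z - 1 - RtoC (INR k)) ^ 4)%C) in *.
  apply clim_ext_all with (fun n => psum f n - / z ^ 4 + / (z + RtoC (INR n)) ^ 4)%C.
  - induction t as [|n IH].
    + cbn [psum INR]. replace (z + RtoC 0)%C with z by ring. ring.
    + cbn [psum]. rewrite <- IH. unfold f at 2. rewrite S_INR, RtoC_plus.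
      replace (z - (RtoC (INR n) + 1))%C with (z - 1 - RtoC (INR n))%C by ring. ring.
  - replace (tpi ^ 4 / 6 * psi z - / z ^ 4)%C with (tpi ^ 4 / 6 * psi z - / z ^ 4 + 0)%C by ring.
    apply clim_plus; [apply clim_minus; [exact H|apply clim_const]|].
    assert (HK : forall n, INR n + 1 <= (1 + (Cmod z + 2) / Im z) * Cmod (z + RtoC (INR n))).
    { intros n. apply linear_lower; [exact Hz| |].
      - assert (Hi := im_le_Cmod (z + RtoC (INR n))). replace (Im (z + RtoC (INR n))) with (Im z) in Hi by (destruct z; cbn; ring).
        rewrite Rabs_right in Hi; lra.
      - assert (Hi := INR_le_Cmod_plus z n). lra. }
    assert (Hz0 := Cmod_ge_0 z).
    assert (HK0 : 0 <= 1 + (Cmod z + 2) / Im z) by (assert (0 <= (Cmod z + 2) / Im z) by (apply Rdiv_le_0_compat; lra); lra).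
    set (K := 1 + (Cmod z + 2) / Im z) in *.
    assert (Hl : is_lim_seq (fun n => K ^ 4 * / (INR n + 1) ^ 2) 0).
    { apply ex_series_lim_0. apply (ex_series_scal_l (V := R_NormedModule) (K ^ 4)). apply ex_series_inv_sq. }
    apply is_lim_seq_spec in Hl. intros eps He. generalize (Hl (mkposreal eps He)). apply filter_imp. intros n Hn. change (Rabs (K ^ 4 * / (INR n + 1) ^ 2 - 0) < eps) in Hn.
    replace (/ (z + RtoC (INR n)) ^ 4 - 0)%C with (/ (z + RtoC (INR n)) ^ 4)%C by ring.
    assert (Hp : 0 < Cmod (z + RtoC (INR n))).
    { specialize (HK n). assert (H0 := pos_INR n). assert (H1 := Cmod_ge_0 (z + RtoC (INR n))).
      destruct (Req_dec (Cmod (z + RtoC (INR n))) 0) as [E|E]; [rewrite E in HK; lra|lra]. }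
    rewrite Cmod_inv by (now apply Cpow_nz, Cmod_gt_0). rewrite Cmod_pow.
    eapply Rle_lt_trans; [apply inv_pow4_dom; [exact Hp|exact HK0|apply HK]|].
    apply Rabs_def2 in Hn. lra.
Qed.

Definition lat4_sum (t : C) : C := (tpi ^ 4 / 6 * PS (sigc 3) (qexp t) - / t ^ 4 * zeta4)%C.

Lemma H_neq0 (t : C) : 0 < Im t -> t <> 0.
Proof. intros H E. rewrite E in H. cbn in H. lra. Qed.

Lemma Im_S (t : C) (m : nat) : 0 < Im t -> 0 < Im (RtoC (INR (S m)) * t).
Proof.
  intros Ht. replace (RtoC (INR (S m)) * t)%C with (RtoC (INR (S m)) * t + RtoC 0)%C by ring.
  rewrite Im_scal_plus. apply Rmult_lt_0_compat; [apply lt_0_INR; lia|exact Ht].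
Qed.

Lemma lat4_rows (t : C) : 0 < Im t ->
  csum (fun m => tpi ^ 4 / 6 * psi (RtoC (INR (S m)) * t) - / (RtoC (INR (S m)) * t) ^ 4)%C (lat4_sum t).
Proof.
  intros Ht. unfold lat4_sum, Cminus.
  apply csum_ext with (fun m => tpi ^ 4 / 6 * psi (RtoC (INR (S m)) * t) + (- / t ^ 4) * / RtoC (INR (S m)) ^ 4)%C.
  - intros m. f_equal. rewrite Cpow_mult_l. field. split; [now apply H_neq0|apply INR_neq0; lia].
  - replace (- (/ t ^ 4 * zeta4))%C with (- / t ^ 4 * zeta4)%C by ring.
    apply csum_plus; apply csum_scal; [now apply psi_csum|apply zeta4_csum].
Qed.

Lemma Im_Sinv (t : C) : 0 < Im t -> 0 < Im (- (1) / t).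
Proof.
  intros Ht. destruct t as [x y]. cbn in *. assert (0 < x * (x * 1) + y * (y * 1)) by nra.
  match goal with |- 0 < ?e => replace e with (y / (x * (x * 1) + y * (y * 1))) end.
  - now apply Rdiv_lt_0_compat.
  - field. lra.
Qed.

Lemma lat4_swap (t : C) (m n : nat) : 0 < Im t -> lat4 t m n = (/ t ^ 4 * lat4 (- (1) / t) n m)%C.
Proof.
  intros Ht. assert (Ht0 := H_neq0 t Ht).
  assert (N : forall y : R, (RtoC (INR (S m)) * t + RtoC y)%C <> 0).
  { intros y. apply H_neq0. rewrite Im_scal_plus. apply Rmult_lt_0_compat; [apply lt_0_INR; lia|exact Ht]. }
  assert (N1 := N (INR (S n))). assert (N2 := N (- INR (S n))). rewrite RtoC_opp in N2.
  unfold lat4. set (a := RtoC (INR (S m))) in *. set (b := RtoC (INR (S n))) in *.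
  replace (b * (- (1) / t) + a)%C with ((a * t + - b) / t)%C by (field; exact Ht0).
  replace (b * (- (1) / t) - a)%C with (- (a * t + b) / t)%C by (field; exact Ht0).
  unfold Cminus. field. repeat split; try assumption.
Qed.

(** The same double series summed by rows and by columns; by [lat4_swap] its columns are t^(-4)
    times the rows for -1/t. *)
Lemma lat4_modular (t : C) : 0 < Im t -> lat4_sum t = (/ t ^ 4 * lat4_sum (- (1) / t))%C.
Proof.
  intros Ht. assert (Ht' := Im_Sinv t Ht).
  destruct (lattice_inv4 t Ht) as [K [HK HB]].
  assert (HB' : forall m n, Cmod (lat4 t m n) <= 2 * K * / (INR n + 1) ^ 2 * / (INR m + 1) ^ 2).
  { intros m n. unfold lat4. eapply Rle_trans; [apply Cmod_triangle|].
    assert (B1 := HB m n (INR (S n)) (Rabs_right _ (Rle_ge _ _ (pos_INR _)))).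
    assert (B2 : Rabs (- INR (S n)) = INR (S n)) by (rewrite Rabs_Ropp; apply Rabs_right, Rle_ge, pos_INR).
    apply (HB m n) in B2. rewrite RtoC_opp in B2. unfold Cminus. lra. }
  assert (Hsq := ex_series_inv_sq). assert (Hp : forall k, 0 <= / (INR k + 1) ^ 2) by (intros; apply Rlt_le, Rinv_0_lt_compat, INR1_pow_pos).
  destruct (fubini (lat4 t) (fun m => tpi ^ 4 / 6 * psi (RtoC (INR (S m)) * t) - / (RtoC (INR (S m)) * t) ^ 4)%C
    (fun n => / t ^ 4 * (tpi ^ 4 / 6 * psi (RtoC (INR (S n)) * (- (1) / t)) - / (RtoC (INR (S n)) * (- (1) / t)) ^ 4))%C
    (fun n => 2 * K * Series (fun k => / (INR k + 1) ^ 2) * / (INR n + 1) ^ 2)) as [H1 H2].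
  - apply (ex_series_scal_l (V := R_NormedModule) (2 * K * Series (fun k => / (INR k + 1) ^ 2))). apply ex_series_inv_sq.
  - intros m. apply lat4_row. now apply Im_S.
  - intros n. apply csum_ext with (fun m => / t ^ 4 * lat4 (- (1) / t) n m)%C; [intros m; now rewrite <- lat4_swap|].
    apply csum_scal. apply lat4_row. now apply Im_S.
  - intros M n. eapply Rle_trans; [apply (psum_mod _ (fun m => 2 * K * / (INR n + 1) ^ 2 * / (INR m + 1) ^ 2)); intros; apply HB'|].
    rewrite rsum_scal. assert (H := rsum_le_Series _ M Hp Hsq). specialize (Hp n).
    replace (2 * K * Series (fun k => / (INR k + 1) ^ 2) * / (INR n + 1) ^ 2)
      with (2 * K * / (INR n + 1) ^ 2 * Series (fun k => / (INR k + 1) ^ 2)) by ring.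
    apply Rmult_le_compat_l; [|exact H]. apply Rmult_le_pos; lra.
  - rewrite (csum_unique _ _ _ (lat4_rows t Ht) H1). symmetry. eapply csum_unique; [|exact H2].
    apply csum_scal. now apply lat4_rows.
Qed.

(** As 6 zeta(4) / tpi^4 = 1/240, the axis omitted from the lattice sum restores the constant term 1
    of E4. *)
Lemma E4_S (t : C) : 0 < Im t -> E4 (- (1) / t) = (t ^ 4 * E4 t)%C.
Proof.
  intros Ht. assert (H := lat4_modular t Ht). assert (Ht' := Im_Sinv t Ht). assert (Ht0 := H_neq0 t Ht).
  assert (Htp := tpi_neq0).
  unfold lat4_sum in H. rewrite zeta4_val in H. unfold E4. rewrite !lambert_PS by now apply qexp_lt1.
  set (A := PS (sigc 3) (qexp t)) in *. set (B := PS (sigc 3) (qexp (- (1) / t))) in *.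
  assert (E : (A = / t ^ 4 * B - / 240 + / 240 * / t ^ 4)%C).
  { replace A with (6 / tpi ^ 4 * ((tpi ^ 4 / 6 * A - / t ^ 4 * (tpi ^ 4 / 1440)) + / t ^ 4 * (tpi ^ 4 / 1440)))%C
      by (field; split; assumption).
    rewrite H. field. repeat split; assumption. }
  rewrite E. field. exact Ht0.
Qed.

Lemma E4_T (t : C) : E4 (t + 1) = E4 t.
Proof. unfold E4. now rewrite qexp_plus, qexp_1, Cmult_1_r. Qed.


(** * Values at [rho] *)

Lemma rho_val : rho = (- (1 / 2), sqrt 3 / 2).
Proof.
  unfold rho. replace (2 * PI * Ci / 3)%C with ((0, 2 * (PI / 3)) : C).
  - unfold Cexp; cbn [Re Im fst snd]. rewrite exp_0, cos_2PI3, sin_2PI3. f_equal; field.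
  - unfold Cdiv. rewrite <- RtoC_inv by lra. unfold Ci, Cmult, RtoC; cbn. f_equal; field.
Qed.

Lemma sqrt3_sq : sqrt 3 * sqrt 3 = 3.
Proof. apply sqrt_sqrt. lra. Qed.

Lemma sqrt3_pos : 0 < sqrt 3.
Proof. apply sqrt_lt_R0. lra. Qed.

Lemma rho_Im : 0 < Im rho.
Proof. rewrite rho_val. cbn. assert (H := sqrt3_pos). lra. Qed.

Lemma rho_quad : (rho * rho)%C = (- rho - 1)%C.
Proof.
  rewrite rho_val. unfold Cmult, Cminus, Cplus, Copp, RtoC; cbn. assert (H := sqrt3_sq).
  f_equal; nra.
Qed.

Lemma rho_neq0 : rho <> 0.
Proof. apply H_neq0, rho_Im. Qed.

Lemma rho_fix : (- (1) / rho - 1)%C = rho.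
Proof.
  assert (H := rho_neq0). assert (H' := rho_quad).
  replace (- (1) / rho - 1)%C with ((- rho - 1) / rho)%C by (field; exact H).
  rewrite <- H'. field. exact H.
Qed.

Lemma rho_cub : (rho ^ 3)%C = 1.
Proof.
  replace (rho ^ 3)%C with (rho * (rho * rho))%C by ring. rewrite rho_quad.
  replace (rho * (- rho - 1))%C with (- (rho * rho) - rho)%C by ring. rewrite rho_quad. ring.
Qed.

Lemma rho_neq1 : rho <> 1.
Proof. intros E. assert (H := rho_Im). rewrite E in H. cbn in H. lra. Qed.

Lemma E4_ST (t : C) : 0 < Im t -> E4 (- (1) / t - 1) = (t ^ 4 * E4 t)%C.
Proof.
  intros Ht. rewrite <- E4_T. replace (- (1) / t - 1 + 1)%C with (- (1) / t)%C by ring. now apply E4_S.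
Qed.

(** The fixed point gives E4(rho) = rho^4 E4(rho) = rho E4(rho), and rho is not 1. *)
Lemma E4_rho : E4 rho = 0.
Proof.
  assert (H := E4_ST rho rho_Im). rewrite rho_fix in H.
  replace (rho ^ 4)%C with (rho ^ 3 * rho)%C in H by ring. rewrite rho_cub in H.
  assert (N := C1_neq _ rho_neq1).
  replace (E4 rho) with ((1 - rho) * E4 rho / (1 - rho))%C by (field; exact N).
  replace ((1 - rho) * E4 rho)%C with (E4 rho - 1 * rho * E4 rho)%C by ring. rewrite <- H.
  replace (E4 rho - E4 rho)%C with (RtoC 0) by ring. field. exact N.
Qed.

Lemma ST_deriv (t : C) : 0 < Im t -> cderiv (fun t => - (1) / t - 1)%C t (/ t ^ 2)%C.
Proof.
  intros Ht. assert (Ht0 := H_neq0 t Ht). eapply cderiv_val.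
  - apply cderiv_minus; [|apply cderiv_const].
    apply (cderiv_div (fun _ => - (1))%C (fun t => t)); [exact Ht0|apply cderiv_const|apply cderiv_id].
  - field. exact Ht0.
Qed.

Lemma Im_ST (t : C) : 0 < Im t -> 0 < Im (- (1) / t - 1).
Proof.
  intros Ht. assert (H := Im_Sinv t Ht). destruct (- (1) / t)%C as [x y]. cbn in *. lra.
Qed.

(* The first and second derivatives of [E4_ST] at its fixed point [rho], computed with the
   differential equations, determine [E2 rho]. *)
Lemma E2_rho_mult : (E6 rho * (tpi * E2 rho * (rho - 1) - 12 * rho ^ 2))%C = 0.
Proof.
  set (E4' := fun t => (tpi * ((E2 t * E4 t - E6 t) / 3))%C).
  assert (D1 : forall t, 0 < Im t -> E4' (- (1) / t - 1)%C = (t ^ 6 * E4' t + 4 * t ^ 5 * E4 t)%C).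
  { intros t Ht. assert (Ht0 := H_neq0 t Ht).
    assert (A := cderiv_comp E4 (fun t => - (1) / t - 1)%C t _ _ (E4_deriv _ (Im_ST t Ht)) (ST_deriv t Ht)).
    assert (B : cderiv (fun t => t ^ 4 * E4 t)%C t ((RtoC (INR 4) * t ^ 3 * 1) * E4 t + t ^ 4 * E4' t)%C).
    { apply (cderiv_mult (fun t => t ^ 4)%C E4); [apply (cderiv_pow (fun t => t)), cderiv_id|now apply E4_deriv]. }
    assert (E := cderiv_unique _ _ _ _ (cderiv_local _ _ _ _
      (filter_imp _ _ E4_ST (Im_nbhs t Ht)) A) B).
    fold (E4' (- (1) / t - 1)%C) in E. cbn [INR] in E. rewrite !RtoC_plus in E.
    replace (E4' (- (1) / t - 1)%C) with (t ^ 2 * (E4' (- (1) / t - 1) * / t ^ 2))%C by (field; exact Ht0).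
    rewrite E. ring. }
  assert (DE : forall t, 0 < Im t -> cderiv E4' t (tpi ^ 2 / 3 * ((E2 t ^ 2 - E4 t) / 12 * E4 t + E2 t * ((E2 t * E4 t - E6 t) / 3)
     - (E2 t * E6 t - E4 t ^ 2) / 2))%C).
  { intros t Ht. eapply cderiv_val.
    - apply (cderiv_scal tpi (fun t => (E2 t * E4 t - E6 t) / 3)%C).
      apply (cderiv_div (fun t => E2 t * E4 t - E6 t)%C (fun _ => 3)); [intros E; apply RtoC_inj in E; lra| |apply cderiv_const].
      apply cderiv_minus; [|now apply E6_deriv].
      apply cderiv_mult; [now apply E2_deriv|now apply E4_deriv].
    - field. }
  assert (Hr := rho_Im). assert (Hr0 := rho_neq0). assert (H4 := E4_rho).
  (* At rho the first-derivative identity is empty, since rho^6 = 1 and E4(rho) = 0; one more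
     differentiation brings in E2(rho). *)
  assert (A := cderiv_comp E4' (fun t => - (1) / t - 1)%C rho _ _ (DE _ (Im_ST rho Hr)) (ST_deriv rho Hr)).
  assert (B := cderiv_plus _ _ _ _ _
     (cderiv_mult (fun t => t ^ 6)%C E4' rho _ _ (cderiv_pow (fun t => t) rho _ 6 (cderiv_id rho)) (DE rho Hr))
     (cderiv_mult (fun t => 4 * t ^ 5)%C E4 rho _ _ (cderiv_scal 4 _ rho _ (cderiv_pow (fun t => t) rho _ 5 (cderiv_id rho))) (E4_deriv rho Hr))).
  assert (E := cderiv_unique _ _ _ _ (cderiv_local _ _ _ _ (filter_imp _ _ D1 (Im_nbhs rho Hr)) A) B).
  rewrite rho_fix in E. unfold E4' in E. rewrite H4 in E. cbn [INR pred] in E. rewrite !RtoC_plus in E.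
  assert (C3 := rho_cub).
  set (P := E2 rho) in *. set (R := E6 rho) in *.
  assert (R6 : (rho ^ 6)%C = 1) by (replace (rho ^ 6)%C with (rho ^ 3 * rho ^ 3)%C by ring; rewrite C3; ring).
  assert (R5 : (rho ^ 5)%C = (rho ^ 2)%C) by (replace (rho ^ 5)%C with (rho ^ 3 * rho ^ 2)%C by ring; rewrite C3; ring).
  assert (R2 : (/ rho ^ 2)%C = rho).
  { replace rho with (rho ^ 3 / rho ^ 2)%C at 2 by (field; exact Hr0). rewrite C3. field. exact Hr0. }
  rewrite R2, R6, R5 in E.
  assert (T := tpi_neq0).
  match type of E with ?l = ?r => assert (E' : (l - r)%C = 0) by (rewrite E; ring) end.
  (* The second-derivative identity reads - (5 / 18) tpi times the expression to be annihilated
     equals 0. *)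
  replace (R * (tpi * P * (rho - 1) - 12 * rho ^ 2))%C
    with (- (18 / 5) / tpi * (- (5 / 18) * tpi * (R * (tpi * P * (rho - 1) - 12 * rho ^ 2))))%C by (field; exact T).
  match type of E' with ?l = _ => replace (- (5 / 18) * tpi * (R * (tpi * P * (rho - 1) - 12 * rho ^ 2)))%C with l by field end.
  rewrite E'. ring.
Qed.

(** Since Re rho = -1/2, q is real and negative; this makes E6(rho) and the value of the eta product
    real. *)
Lemma qexp_rho : qexp rho = RtoC (- exp (- (PI * sqrt 3))).
Proof.
  rewrite rho_val. unfold qexp. replace (2 * PI * Ci * ((- (1 / 2))%R, (sqrt 3 / 2)%R))%C with ((- (PI * sqrt 3), - PI) : C).
  - unfold Cexp; cbn [Re Im fst snd]. rewrite cos_neg, sin_neg, cos_PI, sin_PI. unfold RtoC. f_equal; ring.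
  - unfold Ci, Cmult, RtoC; cbn. f_equal; field.
Qed.

Lemma csum_conj (a : nat -> C) (l : C) : csum a l -> csum (fun n => Cconj (a n)) (Cconj l).
Proof.
  intros H. apply clim_ext_all with (fun n => Cconj (psum a n)); [|now apply clim_conj].
  intros n. induction n as [|n IH]; cbn [psum].
  - unfold Cconj, RtoC; cbn. f_equal; ring.
  - now rewrite Cplus_conj, IH.
Qed.

Lemma Cconj_RtoC (x : R) : Cconj (RtoC x) = RtoC x.
Proof. unfold Cconj, RtoC; cbn. f_equal. ring. Qed.

Lemma PS_conj (a : nat -> R) (z : C) : polyg (fun n => RtoC (a n)) -> Cmod z < 1 ->
  Cconj (PS (fun n => RtoC (a n)) z) = PS (fun n => RtoC (a n)) (Cconj z).
Proof.
  intros Ha Hz. symmetry. apply PS_unique.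
  apply csum_ext with (fun n => Cconj (RtoC (a n) * z ^ n)).
  - intros n. rewrite Cmult_conj, Cconj_RtoC. f_equal. induction n as [|n IH]; cbn [Cpow].
    + apply Cconj_RtoC.
    + now rewrite Cmult_conj, IH.
  - apply csum_conj. now apply PS_csum.
Qed.

Lemma conj_real (z : C) : Cconj z = z -> z = RtoC (Re z).
Proof. destruct z as [x y]. unfold Cconj, RtoC; cbn. intros E. injection E as E. f_equal. lra. Qed.

Lemma PS_real (a : nat -> R) (x : R) : polyg (fun n => RtoC (a n)) -> Rabs x < 1 ->
  exists y : R, PS (fun n => RtoC (a n)) (RtoC x) = RtoC y.
Proof.
  intros Ha Hx. eexists. apply conj_real. rewrite PS_conj; [now rewrite Cconj_RtoC|exact Ha|]. now rewrite Cmod_R.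
Qed.

(** From sqrt 3 >= 1.7 and PI > 3 the exponent exceeds 5, and e^5 >= (5/4)^20 > 80. The bound 1/80
    is what the tail estimate in [E6_rho] needs. *)
Lemma exp_rho_small : 0 < exp (- (PI * sqrt 3)) < / 80.
Proof.
  split; [apply exp_pos|]. rewrite exp_Ropp. apply Rinv_lt_contravar; [assert (H := exp_pos (PI * sqrt 3)); lra|].
  assert (H3 : 17 / 10 <= sqrt 3).
  { rewrite <- (sqrt_square (17 / 10)) by lra. apply sqrt_le_1; lra. }
  assert (HP3 : 3 < PI) by (assert (H := PI2_3_2); lra).
  apply Rlt_le_trans with (exp 5).
  - replace 5 with (INR 20 * (1 / 4)) by (cbn; lra).
    assert (E : forall n, exp (INR n * (1 / 4)) = exp (1 / 4) ^ n).
    { induction n as [|n IH]; [cbn; rewrite Rmult_0_l; apply exp_0|]. cbn [pow]. rewrite <- IH, <- exp_plus, S_INR. f_equal. ring. }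
    rewrite E. apply Rlt_le_trans with ((5 / 4) ^ 20); [lra|]. apply pow_incr. split; [lra|].
    assert (H := exp_ineq1_le (1 / 4)). lra.
  - destruct (Req_dec (PI * sqrt 3) 5) as [->|N]; [lra|]. apply Rlt_le, exp_increasing. nra.
Qed.

Lemma sig_le (k n : nat) : Rabs (sig k n) <= INR n ^ S k.
Proof.
  unfold sig. rewrite sumD_rsum. eapply Rle_trans; [apply rsum_abs|].
  eapply Rle_trans; [apply (rsum_le _ (fun _ => INR n ^ k))|rewrite rsum_const; cbn [pow]; lra].
  intros m Hm. assert (Hn : 0 <= INR n ^ k) by (apply pow_le, pos_INR). unfold divq.
  destruct (Nat.eqb_spec (n mod S m) 0); [|now rewrite Rabs_R0].
  destruct (Nat.eqb_spec n 0); [now rewrite Rabs_R0|].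
  rewrite Rabs_right by (apply Rle_ge, pow_le, pos_INR). apply pow_incr. split; [apply pos_INR|apply le_INR; lia].
Qed.

(** The ratio of consecutive terms is at most (3/2)^6 < 12, which gives the tail of E6 a geometric
    majorant. *)
Lemma sixth_power_le (n : nat) : INR (S (S n)) ^ 6 <= 64 * 12 ^ n.
Proof.
  induction n as [|n IH]; [cbn; lra|].
  assert (H : INR (S (S (S n))) <= 3 / 2 * INR (S (S n))) by (rewrite !S_INR; assert (H := pos_INR n); lra).
  apply Rle_trans with ((3 / 2 * INR (S (S n))) ^ 6); [apply pow_incr; split; [apply pos_INR|exact H]|].
  rewrite Rpow_mult_distr. change (12 ^ S n) with (12 * 12 ^ n).
  assert (0 <= INR (S (S n)) ^ 6) by apply pow_le, pos_INR. nra.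
Qed.

(** With q = - r, E6(rho) = 1 + 504 (r - r^2 S2), and r |S2| <= 64 r / (1 - 12 r) < 1 for r < 1/80:
    the first term outweighs the rest. *)
Lemma E6_rho : exists R0 : R, 0 < R0 /\ E6 rho = RtoC R0.
Proof.
  assert (Hr := exp_rho_small). assert (Hq := qexp_lt1 rho rho_Im).
  unfold E6. rewrite lambert_PS by exact Hq. rewrite qexp_rho in *. set (r := exp (- (PI * sqrt 3))) in *.
  assert (Hr1 : Rabs (- r) < 1) by (rewrite Rabs_Ropp, Rabs_right; lra).
  destruct (PS_real (sig 5) (- r) (polyg_sigc 5) Hr1) as [y Hy]. fold (sigc 5) in Hy.
  exists (1 - 504 * y). split; [|change (fun n => RtoC (sig 5 n)) with (sigc 5) in Hy; rewrite Hy, RtoC_minus, RtoC_mult; reflexivity].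
  assert (P1 := polyg_shift _ (polyg_sigc 5)). assert (P2 := polyg_shift _ P1).
  change (fun n => RtoC (sig 5 n)) with (sigc 5) in Hy.
  assert (H := PS_decr (sigc 5) (RtoC (- r)) (polyg_sigc 5) Hq). rewrite (PS_decr _ _ P1 Hq) in H.
  rewrite Hy in H. set (S2 := PS (fun n => sigc 5 (S (S n))) (RtoC (- r))) in *.
  assert (HS2 : Cmod S2 <= 64 * / (1 - 12 * r)).
  { apply Rle_trans with (Series (fun n => 64 * (12 * r) ^ n)).
    - apply (csum_mod_le (fun n => sigc 5 (S (S n)) * RtoC (- r) ^ n)%C).
      + intros n. rewrite Cmod_mult, Cmod_pow, Cmod_R, Rabs_Ropp, (Rabs_right r) by lra.
        rewrite Rpow_mult_distr, <- Rmult_assoc. apply Rmult_le_compat_r; [apply pow_le; lra|].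
        unfold sigc. rewrite Cmod_R. eapply Rle_trans; [apply sig_le|apply sixth_power_le].
      + apply (ex_series_scal_l (V := R_NormedModule) 64). apply ex_series_geom. rewrite Rabs_right; lra.
      + now apply PS_csum.
    - right. rewrite Series_scal_l. f_equal. apply is_series_unique, is_series_geom. rewrite Rabs_right; lra. }
  assert (HrS : r * (64 * / (1 - 12 * r)) < 1).
  { apply Rmult_lt_reg_r with (1 - 12 * r); [lra|]. field_simplify; lra. }
  assert (HRe := re_le_Cmod S2). apply (f_equal Re) in H. clear Hy.
  assert (s0 : sigc 5 0 = 0) by (unfold sigc, sig; reflexivity).
  assert (s1 : sigc 5 1 = 1).
  { unfold sigc, sig. rewrite sumD_rsum. unfold divq; cbn. f_equal. ring. }
  rewrite s0, s1 in H. destruct S2 as [u v]. cbn [Re Im fst snd] in *. cbn in H.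
  assert (Hu : - (64 * / (1 - 12 * r)) <= u <= 64 * / (1 - 12 * r)).
  { apply Rabs_le_between. eapply Rle_trans; [exact HRe|exact HS2]. }
  nra.
Qed.


Lemma E2_rho : (tpi * E2 rho * (rho - 1))%C = (12 * rho ^ 2)%C.
Proof.
  destruct E6_rho as [R0 [HR0 E]]. assert (H := E2_rho_mult).
  assert (N : E6 rho <> 0) by (rewrite E; intros E'; apply RtoC_inj in E'; lra).
  replace (tpi * E2 rho * (rho - 1))%C
    with (/ E6 rho * (E6 rho * (tpi * E2 rho * (rho - 1) - 12 * rho ^ 2)) + 12 * rho ^ 2)%C by (field; exact N).
  rewrite H. ring.
Qed.

(** * The discriminant and the eta function *)

Lemma growth_inv : growth (fun _ x => / INR x).
Proof.
  exists 1, O. split; [lra|]. intros e x He Hx. cbn [pow]. assert (1 <= INR x) by (apply (le_INR 1); exact Hx).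
  rewrite Rabs_right by (apply Rle_ge, Rlt_le, Rinv_0_lt_compat; lra).
  rewrite Rmult_1_r, <- Rinv_1. apply Rinv_le_contravar; lra.
Qed.

(* [Lq q] is minus the logarithm of the product of the 1 - q^n. *)
Definition lcoef (n : nat) : C := RtoC (sumD (fun _ x => / INR x) n).
Definition Lq (q : C) : C := PS lcoef q.

Lemma polyg_lcoef : polyg lcoef.
Proof. apply polyg_sumD, growth_inv. Qed.

Lemma theta_lcoef (n : nat) : theta lcoef n = sigc 1 n.
Proof.
  unfold theta, lcoef, sigc, sig. rewrite <- RtoC_mult. f_equal. rewrite <- sumD_scal. apply sumD_ext.
  intros e x He Hx E. rewrite <- E, mult_INR. cbn [pow]. field. apply not_0_INR. lia.
Qed.

Lemma Lq_deriv (q : C) : Cmod q < 1 -> cderiv Lq q (PS (dcoef lcoef) q).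
Proof. apply PS_deriv, polyg_lcoef. Qed.

Lemma Lq_theta (q : C) : Cmod q < 1 -> (q * PS (dcoef lcoef) q)%C = PS (sigc 1) q.
Proof.
  intros Hq. rewrite <- PS_theta; [|apply polyg_lcoef|exact Hq]. apply PS_ext, theta_lcoef.
Qed.

Lemma Lq_qexp_deriv (t : C) : 0 < Im t -> cderiv (fun t => Lq (qexp t)) t (tpi * PS (sigc 1) (qexp t))%C.
Proof.
  intros Ht. assert (Hq := qexp_lt1 t Ht). eapply cderiv_val.
  - apply (cderiv_comp Lq qexp); [now apply Lq_deriv|apply qexp_deriv].
  - rewrite <- Lq_theta by exact Hq. ring.
Qed.

Definition Delta (t : C) : C := (E4 t ^ 3 - E6 t ^ 2)%C.

Lemma Delta_deriv (t : C) : 0 < Im t -> cderiv Delta t (tpi * (E2 t * Delta t))%C.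
Proof.
  intros Ht. eapply cderiv_val.
  - apply cderiv_minus; [apply (cderiv_pow E4), E4_deriv, Ht|apply (cderiv_pow E6), E6_deriv, Ht].
  - unfold Delta. cbn [INR pred]. rewrite !RtoC_plus. field.
Qed.

Lemma qexp_neq0 (t : C) : qexp t <> 0.
Proof. apply Cexp_neq0. Qed.

(** [cderiv_0_const] works on discs, and the disc of centre i Y and radius Y contains t as soon as
    |t|^2 < 2 Y Im t. *)
Lemma H_const (f : C -> C) : (forall t, 0 < Im t -> cderiv f t 0) ->
  forall t, 0 < Im t -> exists Y0, forall Y, Y0 < Y -> f t = f (0, Y).
Proof.
  intros Hf t Ht. exists ((Cmod t ^ 2 + 1) / (2 * Im t)). intros Y HY.
  assert (H0 := Cmod_ge_0 t).
  assert (HY0 : 0 < Y) by (eapply Rlt_trans; [|exact HY]; apply Rdiv_lt_0_compat; nra).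
  apply (cderiv_0_const f (0, Y) Y).
  - intros z Hz. apply Hf. assert (Hi := im_le_Cmod (z - (0, Y))). replace (Im (z - (0, Y))) with (Im z - Y) in Hi by (destruct z; reflexivity).
    assert (Rabs (Im z - Y) < Y) by lra. apply Rabs_def2 in H. lra.
  - apply Rsqr_incrst_0; [|apply Cmod_ge_0|lra]. rewrite !Rsqr_pow2, Cmod2_alt.
    rewrite Cmod2_alt in HY. destruct t as [x y]. cbn [Re Im fst snd Cminus Cplus Copp] in *.
    assert (E : (x ^ 2 + y ^ 2 + 1) / (2 * y) * (2 * y) = x ^ 2 + y ^ 2 + 1) by (field; lra).
    assert ((x ^ 2 + y ^ 2 + 1) / (2 * y) * (2 * y) < Y * (2 * y)) by (apply Rmult_lt_compat_r; lra). nra.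
Qed.

Lemma qexp_iN : clim eventually (fun n => qexp (0, INR n)) 0.
Proof.
  intros eps He. destruct (INR_unbounded (/ eps)) as [N HN]. exists N. intros n Hn.
  replace (qexp (0, INR n) - 0)%C with (qexp (0, INR n)) by ring. rewrite qexp_mod. cbn [Im snd].
  assert (HP3 : 3 < PI) by (assert (H := PI2_3_2); lra).
  assert (Hie := Rinv_0_lt_compat _ He). assert (HnN : INR N <= INR n) by (apply le_INR; exact Hn).
  rewrite exp_Ropp. rewrite <- (Rinv_inv eps). apply Rinv_lt_contravar.
  - apply Rmult_lt_0_compat; [exact Hie|apply exp_pos].
  - assert (H := exp_ineq1_le (2 * PI * INR n)). nra.
Qed.

(** D Delta = E2 Delta, and E2 is also the logarithmic derivative of q e^(-24 L), where L is [Lq] at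
    q; the quotient [W] is therefore constant, and its value is the limit at i infinity. *)
Lemma Delta_product (t : C) : 0 < Im t -> Delta t = (1728 * qexp t * Cexp (- (24 * Lq (qexp t))))%C.
Proof.
  revert t. set (W := fun t => (Delta t / qexp t * Cexp (24 * Lq (qexp t)))%C).
  assert (HW : forall t, 0 < Im t -> cderiv W t 0).
  { intros t Ht. assert (Hq := qexp_lt1 t Ht). assert (N := qexp_neq0 t). eapply cderiv_val.
    - apply (cderiv_mult (fun t => Delta t / qexp t)%C (fun t => Cexp (24 * Lq (qexp t)))%C).
      + apply (cderiv_div Delta qexp); [exact N|now apply Delta_deriv|apply qexp_deriv].
      + apply (cderiv_comp Cexp (fun t => 24 * Lq (qexp t))%C); [apply Cexp_deriv|].
        apply cderiv_scal. now apply Lq_qexp_deriv.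
    - unfold E2. rewrite lambert_PS by exact Hq. field. exact N. }
  assert (HL : clim eventually (fun n => W (0, INR n)) 1728).
  { assert (P3 := polyg_shift _ (polyg_sigc 3)). assert (P5 := polyg_shift _ (polyg_sigc 5)).
    assert (H0 : Cmod 0 < 1) by (rewrite Cmod_0; lra).
    set (A := PS (fun n => sigc 3 (S n))). set (B := PS (fun n => sigc 5 (S n))).
    (* [W] as a function of q after cancelling the factor q of E4^3 - E6^2, with E4 = 1 + 240 q A
       and E6 = 1 - 504 q B. At q = 0 it gives 720 + 1008. *)
    set (V := fun q => ((720 * A q + 1008 * B q + q * (172800 * A q ^ 2 - 254016 * B q ^ 2) + q ^ 2 * (13824000 * A q ^ 3)) * Cexp (24 * Lq q))%C).
    assert (CA : ccont A 0) by (eapply cderiv_ccont, PS_deriv; assumption).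
    assert (CB : ccont B 0) by (eapply cderiv_ccont, PS_deriv; assumption).
    assert (CL : ccont Lq 0) by (eapply cderiv_ccont, PS_deriv; [apply polyg_lcoef|exact H0]).
    assert (CV : ccont V 0).
    { unfold V. apply ccont_mult.
      - repeat first [exact CA|exact CB|apply ccont_id|apply ccont_const|apply ccont_opp|apply ccont_plus|apply ccont_mult|apply ccont_pow].
      - apply (ccont_comp Cexp (fun q => 24 * Lq q)%C); [apply ccont_mult; [apply ccont_const|exact CL]|apply Cexp_cont]. }
    assert (V0 : V 0 = 1728).
    { unfold V, A, B, Lq. rewrite !PS_0 by (assumption || apply polyg_lcoef).
      assert (S1 : forall k, sigc k 1 = 1).
      { intros k. unfold sigc, sig. rewrite sumD_rsum. unfold divq. cbn. rewrite pow1. f_equal. ring. }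
      rewrite !S1. replace (lcoef 0) with (RtoC 0) by (unfold lcoef, sumD; reflexivity).
      rewrite Cmult_0_r, Cexp_0. ring. }
    rewrite <- V0. apply clim_ext with (fun n => V (qexp (0, INR n))).
    - exists 1%nat. intros n Hn. assert (Ht : 0 < Im (0, INR n)) by (apply lt_0_INR; exact Hn).
      assert (Hq := qexp_lt1 _ Ht). assert (N := qexp_neq0 (0, INR n)).
      unfold V, W. f_equal. unfold Delta, E4, E6. rewrite !lambert_PS by exact Hq.
      rewrite (PS_decr (sigc 3)), (PS_decr (sigc 5)) by (apply polyg_sigc || exact Hq). fold A B.
      replace (sigc 3 0) with (RtoC 0) by reflexivity. replace (sigc 5 0) with (RtoC 0) by reflexivity.
      set (q := qexp (0, INR n)) in *. field. exact N.
    - apply (clim_comp eventually (cnbhs 0) (fun n => qexp (0, INR n)) V); [|exact CV].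
      intros P [d [Hd HP]]. generalize (qexp_iN d Hd). apply filter_imp. intros n Hn. now apply HP. }
  intros t Ht. assert (N := qexp_neq0 t). assert (N' := Cexp_neq0 (24 * Lq (qexp t))).
  assert (E : W t = 1728).
  { destruct (H_const W HW t Ht) as [Y0 HY]. apply (clim_unique (F := eventually) (fun n => W (0, INR n))); [|exact HL].
    apply clim_ext with (fun _ => W t); [|apply clim_const]. destruct (INR_unbounded Y0) as [n0 Hn0].
    exists n0. intros n Hn. apply HY. eapply Rlt_le_trans; [exact Hn0|apply le_INR; exact Hn]. }
  rewrite Cexp_opp, <- E. unfold W. field. split; assumption.
Qed.

Lemma Delta_neq0 (t : C) : 0 < Im t -> Delta t <> 0.
Proof.
  intros Ht. rewrite Delta_product by exact Ht. repeat apply Cmult_neq_0.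
  - intros E. apply RtoC_inj in E. lra.
  - apply qexp_neq0.
  - apply Cexp_neq0.
Qed.

(** The coefficients of - log (1 - x). *)
Definition invc (n : nat) : C := match n with O => RtoC 0 | S _ => (/ RtoC (INR n))%C end.

Lemma polyg_invc : polyg invc.
Proof.
  exists 1, O. split; [lra|]. intros [|n]; cbn [invc pow]; [rewrite Cmod_0; lra|].
  rewrite Cmod_inv by (apply INR_neq0; lia). rewrite Cmod_R, Rabs_right by (apply Rle_ge, pos_INR).
  rewrite Rmult_1_r, <- Rinv_1. apply Rinv_le_contravar; [lra|]. apply (le_INR 1). lia.
Qed.

Lemma Cexp_log_series (x : C) : Cmod x < 1 -> Cexp (- PS invc x) = (1 - x)%C.
Proof.
  intros Hx. set (h := fun x => ((1 - x) * Cexp (PS invc x))%C).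
  assert (Hh : h x = h 0).
  { apply (cderiv_0_const h 0 1).
    - intros z Hz. replace (z - 0)%C with z in Hz by ring.
      assert (N : (1 - z)%C <> 0) by (apply C1_neq; intros E; rewrite E, Cmod_1 in Hz; lra).
      eapply cderiv_val.
      + apply (cderiv_mult (fun x => 1 - x)%C (fun x => Cexp (PS invc x))).
        * apply cderiv_minus; [apply cderiv_const|apply cderiv_id].
        * apply (cderiv_comp Cexp (PS invc)); [apply Cexp_deriv|]. apply PS_deriv; [apply polyg_invc|exact Hz].
      + rewrite (PS_unique (dcoef invc) z (/ (1 - z))); [field; exact N|].
        generalize (csum_geom z Hz). apply csum_ext. intros n. unfold dcoef, invc. field. apply INR_neq0. lia.
    - replace (x - 0)%C with x by ring. exact Hx. }
  assert (h0 : h 0 = 1) by (unfold h; rewrite PS_0 by apply polyg_invc; cbn [invc]; rewrite Cexp_0; ring).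
  rewrite h0 in Hh. unfold h in Hh. rewrite Cexp_opp. assert (N := Cexp_neq0 (PS invc x)).
  replace (1 - x)%C with ((1 - x) * Cexp (PS invc x) / Cexp (PS invc x))%C by (field; exact N).
  rewrite Hh. field. exact N.
Qed.

Lemma euler_product (q : C) : Cmod q < 1 -> CLim_seq (euler_prod q) = Cexp (- Lq q).
Proof.
  intros Hq. apply CLim_seq_clim.
  assert (HS : csum (fun m => PS invc (q ^ S m)) (Lq q)).
  { apply (lambert_grid (fun _ x => / INR x)); [apply growth_inv|exact Hq|]. intros m.
    assert (Hm := Cmod_pow_lt1 q (S m) Hq ltac:(lia)). assert (H := PS_csum invc _ polyg_invc Hm).
    replace (PS invc (q ^ S m)) with ((fun n => invc n * (q ^ S m) ^ n)%C O + PS invc (q ^ S m))%C in H by (cbn [invc]; ring).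
    apply csum_incr in H. revert H. apply csum_ext. intros d. cbn [invc].
    rewrite <- Cpow_mult_r, RtoC_inv; [reflexivity|]. apply not_0_INR. lia. }
  assert (E : forall N, euler_prod q N = Cexp (- psum (fun m => PS invc (q ^ S m)) N)).
  { induction N as [|N IH]; [cbn [euler_prod psum]; rewrite <- Cexp_0; f_equal; ring|].
    cbn [euler_prod psum]. rewrite IH, <- (Cexp_log_series (q ^ S N)) by (apply Cmod_pow_lt1; [exact Hq|lia]).
    rewrite <- Cexp_plus. f_equal. ring. }
  apply clim_ext_all with (fun N => Cexp (- psum (fun m => PS invc (q ^ S m)) N)); [intros; now rewrite E|].
  apply (clim_comp eventually (cnbhs (Lq q)) (psum (fun m => PS invc (q ^ S m))) (fun z => Cexp (- z))).
  - intros P [d [Hd HP]]. generalize (HS d Hd). apply filter_imp. intros n Hn. now apply HP.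
  - apply (ccont_comp Cexp (fun z => - z)%C); [apply ccont_opp, ccont_id|apply Cexp_cont].
Qed.

(** The constant for which the quotient of cube roots in the theorem turns out to be kappa Z^2 E4 /
    E6. *)
Definition kappa : C := (24 * RtoC (sqrt 3) * Ci * RtoC PI ^ 2 * eta rho ^ 4)%C.

Lemma Ci_sq : (Ci * Ci)%C = (- (1))%C.
Proof. unfold Ci, Cmult, Copp, RtoC; cbn. f_equal; ring. Qed.

(** [E] is the infinite product, real because q is. Since E4(rho) = 0, [Delta_product] gives
    E6(rho)^2 = 1728 e^(-PI sqrt 3) E^24; the positive root is the right one by [E6_rho], and 24
    sqrt 3 is the root of 1728. *)
Lemma eta_rho : exists E : R, 0 < E /\ eta rho = (Cexp (2 * PI * Ci * rho / 24) * RtoC E)%C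
  /\ E6 rho = RtoC (24 * sqrt 3 * exp (- (PI * sqrt 3 / 2)) * E ^ 12).
Proof.
  assert (Hq := qexp_lt1 rho rho_Im). assert (Hr := exp_rho_small).
  destruct (PS_real (fun n => sumD (fun _ x => / INR x) n) (- exp (- (PI * sqrt 3)))) as [y Hy].
  { apply polyg_lcoef. } { rewrite Rabs_Ropp, Rabs_right; lra. }
  assert (HL : Lq (qexp rho) = RtoC y) by (rewrite qexp_rho; exact Hy).
  assert (HE : Cexp (- Lq (qexp rho)) = RtoC (exp (- y))).
  { rewrite HL. unfold Cexp, RtoC; cbn. rewrite Ropp_0, cos_0, sin_0. f_equal; ring. }
  exists (exp (- y)). split; [apply exp_pos|]. split.
  - unfold eta. now rewrite euler_product, HE.
  - destruct E6_rho as [R0 [HR0 E6r]]. rewrite E6r. f_equal.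
    assert (HD := Delta_product rho rho_Im). unfold Delta in HD. rewrite E4_rho, E6r, HL, qexp_rho in HD.
    assert (H24 : Cexp (- (24 * RtoC y)) = RtoC (exp (- y) ^ 24)).
    { replace (- (24 * RtoC y))%C with (RtoC (INR 24) * RtoC (- y))%C by (rewrite RtoC_opp; replace (INR 24) with 24 by (cbn; ring); ring).
      rewrite <- Cexp_pow. rewrite RtoC_pow. f_equal. unfold Cexp, RtoC; cbn. rewrite cos_0, sin_0. f_equal; ring. }
    rewrite H24 in HD. set (e := exp (- y)) in *. assert (He : 0 < e) by apply exp_pos.
    assert (HD' : R0 ^ 2 = 1728 * exp (- (PI * sqrt 3)) * e ^ 24).
    { apply RtoC_inj. rewrite RtoC_pow. replace (RtoC R0 ^ 2)%C with (- (0 ^ 3 - RtoC R0 ^ 2))%C by ring.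
      rewrite HD, !RtoC_mult, RtoC_opp. generalize (RtoC (e ^ 24)) (RtoC (exp (- (PI * sqrt 3)))). intros u v. ring. }
    assert (Hh : exp (- (PI * sqrt 3)) = exp (- (PI * sqrt 3 / 2)) ^ 2).
    { cbn [pow]. rewrite Rmult_1_r, <- exp_plus. f_equal. field. }
    rewrite Hh in HD'. set (h := exp (- (PI * sqrt 3 / 2))) in *. assert (Hh0 : 0 < h) by apply exp_pos.
    assert (Hs := sqrt3_sq). assert (Hs0 := sqrt3_pos).
    assert (0 < e ^ 12) by now apply pow_lt.
    apply Rsqr_inj; [lra|repeat apply Rmult_le_pos; lra|]. rewrite !Rsqr_pow2, HD'.
    replace ((24 * sqrt 3 * h * e ^ 12) ^ 2) with (576 * (sqrt 3 * sqrt 3) * h ^ 2 * (e ^ 12) ^ 2) by ring.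
    rewrite Hs. ring.
Qed.

Lemma eta_rho_phase (n : nat) (a b : R) : INR n * sqrt 3 / 24 = a -> INR n / 24 = b ->
  (Cexp (2 * PI * Ci * rho / 24) ^ n)%C = (exp (- (PI * a)) * cos (PI * b), - (exp (- (PI * a)) * sin (PI * b))).
Proof.
  intros <- <-. rewrite Cexp_pow, rho_val.
  replace (RtoC (INR n) * (2 * PI * Ci * ((- (1 / 2))%R, (sqrt 3 / 2)%R) / 24))%C
    with ((- (PI * (INR n * sqrt 3 / 24)), - (PI * (INR n / 24))) : C).
  - unfold Cexp; cbn [Re Im fst snd]. rewrite cos_neg, sin_neg. f_equal. ring.
  - unfold Cdiv. rewrite <- RtoC_inv by lra. unfold Ci, Cmult, RtoC; cbn. f_equal; field.
Qed.

(** The phase is i e^(-i PI / 6) = e^(i PI / 3) = - rho^2; the choice of the branch of the cube root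
    depends on it. *)
Lemma kappa_val : exists k0 : R, 0 < k0 /\ kappa = (- RtoC k0 * rho ^ 2)%C.
Proof.
  destruct eta_rho as [E [HE [Heta _]]]. assert (Hs := sqrt3_sq). assert (Hs0 := sqrt3_pos). assert (HP := PI_RGT_0).
  exists (24 * sqrt 3 * PI ^ 2 * exp (- (PI * (sqrt 3 / 6))) * E ^ 4).
  assert (He := exp_pos (- (PI * (sqrt 3 / 6)))). assert (HE4 : 0 < E ^ 4) by now apply pow_lt.
  assert (HP2 : 0 < PI ^ 2) by (apply pow_lt; lra).
  split; [repeat (apply Rmult_lt_0_compat; [|assumption]); lra|].
  unfold kappa. rewrite Heta, Cpow_mult_l, (eta_rho_phase 4 (sqrt 3 / 6) (1 / 6)) by (cbn; field).
  replace (PI * (1 / 6)) with (PI / 6) by field. rewrite cos_PI6, sin_PI6.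
  replace (rho ^ 2)%C with (rho * rho)%C by ring. rewrite rho_quad, rho_val.
  rewrite <- !RtoC_pow. set (e := exp _) in *. set (E4' := E ^ 4) in *.
  unfold Ci, Cminus, Cplus, Cmult, Copp, RtoC; cbn. f_equal; field.
Qed.

(** Equivalent to E6(rho) = 24 sqrt 3 i eta(rho)^12, since eta(rho)^12 has phase - i. *)
Lemma kappa_cube : (kappa ^ 3)%C = (- (1728) * RtoC PI ^ 6 * E6 rho)%C.
Proof.
  destruct eta_rho as [E [HE [Heta HR]]]. assert (Hs := sqrt3_sq). rewrite HR.
  unfold kappa. replace ((24 * RtoC (sqrt 3) * Ci * RtoC PI ^ 2 * eta rho ^ 4) ^ 3)%C
    with (- (13824 * (RtoC (sqrt 3) * RtoC (sqrt 3)) * RtoC (sqrt 3) * RtoC PI ^ 6 * (Ci * eta rho ^ 12)))%C.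
  - rewrite <- RtoC_mult, Hs, Heta, Cpow_mult_l, (eta_rho_phase 12 (sqrt 3 / 2) (1 / 2)) by (cbn; field).
    replace (PI * (1 / 2)) with (PI / 2) by field. replace (PI * (sqrt 3 / 2)) with (PI * sqrt 3 / 2) by field.
    rewrite cos_PI2, sin_PI2. set (h := exp _).
    replace (h * 0, - (h * 1)) with (- Ci * RtoC h)%C by (unfold Ci, Cmult, Copp, RtoC; cbn; f_equal; ring).
    replace (Ci * (- Ci * RtoC h * RtoC E ^ 12))%C with (- (Ci * Ci) * (RtoC h * RtoC E ^ 12))%C by ring.
    rewrite Ci_sq, <- !RtoC_pow, !RtoC_mult. ring.
  - replace ((24 * RtoC (sqrt 3) * Ci * RtoC PI ^ 2 * eta rho ^ 4) ^ 3)%C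
      with (13824 * (RtoC (sqrt 3) * RtoC (sqrt 3)) * RtoC (sqrt 3) * (Ci * Ci) * RtoC PI ^ 6 * (Ci * eta rho ^ 12))%C by ring.
    rewrite Ci_sq. ring.
Qed.


(** * Hypergeometric series *)

Fixpoint hgc (a b c : R) (n : nat) : R :=
  match n with
  | O => 1
  | S m => hgc a b c m * ((a + INR m) * (b + INR m) / ((c + INR m) * (INR m + 1)))
  end.

Section Hypergeometric.
Variables a b c : R.
Hypotheses (Ha : 0 < a) (Hb : 0 < b) (Hc : 0 < c) (H1 : a * b <= c) (H2 : a + b <= c + 1).

Let h (n : nat) : C := RtoC (hgc a b c n).

(** [H1] and [H2] give (a + n) (b + n) <= (c + n) (n + 1), so consecutive coefficients have ratio at
    most 1. *)
Lemma hgc_bound (n : nat) : 0 <= hgc a b c n <= 1.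
Proof.
  induction n as [|n IH]; cbn [hgc]; [lra|]. assert (Hn := pos_INR n).
  assert (0 < (c + INR n) * (INR n + 1)) by nra.
  assert (0 <= (a + INR n) * (b + INR n) / ((c + INR n) * (INR n + 1)) <= 1); [|nra].
  split; [apply Rdiv_le_0_compat; nra|]. apply Rmult_le_reg_r with ((c + INR n) * (INR n + 1)); [assumption|].
  unfold Rdiv. rewrite Rmult_assoc, Rinv_l by lra. nra.
Qed.

Lemma polyg_hgc : polyg h.
Proof.
  exists 1, O. split; [lra|]. intros n. unfold h. rewrite Cmod_R. destruct (hgc_bound n).
  rewrite Rabs_right; cbn; lra.
Qed.

Lemma hyp2F1_PS (z : C) : hyp2F1 (RtoC a) (RtoC b) (RtoC c) z = PS h z.
Proof.
  apply CSeries_ext. intros n. unfold h.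
  assert (Hp : forall x, 0 < x -> forall k, pochhammer (RtoC x) k <> 0).
  { intros x Hx. induction k as [|k IH]; cbn [pochhammer]; [apply C1_neq0|].
    apply Cmult_neq_0; [exact IH|]. rewrite <- RtoC_plus. intros E. apply RtoC_inj in E. assert (H := pos_INR k). lra. }
  assert (Hf : forall k, RtoC (INR (fact k)) <> 0) by (intros k E; apply RtoC_inj in E; now apply (INR_fact_neq_0 k)).
  assert (E : (pochhammer a n * pochhammer b n / pochhammer c n / RtoC (INR (fact n)))%C = RtoC (hgc a b c n)).
  { induction n as [|n IH]; [cbn; field|].
    assert (Hn := pos_INR n).
    cbn [hgc]. rewrite RtoC_mult, <- IH, RtoC_div, !RtoC_mult, !RtoC_plus by nra.
    change (fact (S n)) with (S n * fact n)%nat. rewrite mult_INR, S_INR, RtoC_mult, RtoC_plus. cbn [pochhammer].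
    assert (N1 := Hp c Hc n). assert (N2 := Hp c Hc (S n)). cbn [pochhammer] in N2. assert (N3 := Hf n).
    assert (N4 : (c + RtoC (INR n))%C <> 0) by (rewrite <- RtoC_plus; intros E; apply RtoC_inj in E; lra).
    assert (N5 : (RtoC (INR n) + 1)%C <> 0) by (rewrite <- RtoC_plus; intros E; apply RtoC_inj in E; lra).
    field. repeat split; assumption. }
  rewrite <- E. field. split; [now apply Hp|apply Hf].
Qed.

Lemma hyp_ode (z : C) : Cmod z < 1 ->
  (z * (1 - z) * PS (dcoef (dcoef h)) z + (RtoC c - RtoC (a + b + 1) * z) * PS (dcoef h) z - RtoC (a * b) * PS h z)%C = 0.
Proof.
  intros Hz. assert (P0 := polyg_hgc). assert (P1 := polyg_dcoef _ P0). assert (P2 := polyg_dcoef _ P1).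
  assert (T0 := polyg_theta _ P0). assert (T1 := polyg_theta _ P1). assert (T2 := polyg_theta _ T0).
  assert (E1 := PS_theta h z P0 Hz). assert (E2 := PS_theta (dcoef h) z P1 Hz).
  assert (E3 : PS (theta (theta h)) z = (z * (PS (dcoef h) z + z * PS (dcoef (dcoef h)) z))%C).
  { apply (PS_theta_val (theta h) (fun u => u * PS (dcoef h) u)%C (fun u => PS (dcoef h) u + u * PS (dcoef (dcoef h)) u)%C); [exact T0| | |exact Hz].
    - intros u Hu. now apply PS_theta.
    - intros u Hu. eapply cderiv_val; [apply (cderiv_mult (fun u => u) (PS (dcoef h))); [apply cderiv_id|now apply PS_deriv]|].
      ring. }
  (* Written with theta instead of multiplications by z, the equation is a single power series whose
     coefficients vanish by the recursion for [hgc]. *)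
  transitivity (PS (theta (dcoef h)) z + (- (1)) * PS (theta (theta h)) z + (- RtoC (a + b)) * PS (theta h) z
    + RtoC c * PS (dcoef h) z + (- RtoC (a * b)) * PS h z)%C.
  - rewrite E1, E2, E3. rewrite !RtoC_plus. ring.
  - rewrite <- !PS_scal, <- !PS_plus by repeat (assumption || apply polyg_plus || apply polyg_scal).
    apply PS_unique. apply csum_ext with (fun _ => RtoC 0); [|apply csum_zero].
    intros n. unfold theta, dcoef, h. cbn [hgc]. rewrite S_INR.
    rewrite <- !RtoC_opp, <- ?RtoC_mult, <- ?RtoC_plus.
    assert (Hn := pos_INR n).
    match goal with |- _ = (RtoC ?e * _)%C => replace e with 0 end; [ring|]. field. nra.
Qed.

Lemma PS_hgc_real (x : R) : Rabs x < 1 -> exists y, PS h (RtoC x) = RtoC y.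
Proof. intros Hx. apply PS_real; [apply polyg_hgc|exact Hx]. Qed.

End Hypergeometric.


(** * The two solutions of the hypergeometric equation as functions of [tau] *)

(* The exponents at 0 of the hypergeometric equation are 0 and 1/3; up to the factor
   x^(1/3), the second solution is [PS h2]. *)
Definition h1 (n : nat) : C := RtoC (hgc (1 / 12) (7 / 12) (2 / 3) n).
Definition h2 (n : nat) : C := RtoC (hgc (5 / 12) (11 / 12) (4 / 3) n).

Lemma polyg_h1 : polyg h1.
Proof. apply polyg_hgc; lra. Qed.

Lemma polyg_h2 : polyg h2.
Proof. apply polyg_hgc; lra. Qed.

Definition xf (t : C) : C := (E4 t ^ 3 / E6 t ^ 2)%C.

(** Where the series in [xf t] converge and no denominator vanishes. Unlike [fund_domain] it
    contains rho, so constants can be evaluated there. *)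
Definition Om (t : C) : Prop := 0 < Im t /\ E6 t <> 0 /\ Cmod (xf t) < 1.

(* D E6 / (6 E6), where D = (1 / (2 i PI)) d/dtau. *)
Definition lgd (t : C) : C := ((E2 t - E4 t ^ 2 / E6 t) / 12)%C.

Definition Yf (t : C) : C := PS h1 (xf t).
(** This is lgd Y - DY, because D x = - (1 - x) E4^2 / E6. If Y is (A tau + B) E6^(1/6), then Z is a
    constant multiple of E6^(1/6). *)
Definition Zf (t : C) : C := (Yf t * lgd t + PS (dcoef h1) (xf t) * (1 - xf t) * (E4 t ^ 2 / E6 t))%C.
Definition Hf (t : C) : C := PS h2 (xf t).
(** The second solution x^(1/3) H equals E4 E6^(-2/3) H. Multiplying it by E6^(2/3) makes it
    single-valued and replaces E6^(1/6) by E6^(5/6), whence the factors 5 from here on. *)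
Definition Y2f (t : C) : C := (E4 t * Hf t)%C.
Definition Z2f (t : C) : C :=
  (5 * lgd t * Y2f t - (E2 t * E4 t - E6 t) / 3 * Hf t
    + E4 t ^ 3 / E6 t * (1 - xf t) * PS (dcoef h2) (xf t))%C.

Lemma E_cont (t : C) : 0 < Im t -> ccont E2 t /\ ccont E4 t /\ ccont E6 t.
Proof.
  intros Ht. repeat split; eapply cderiv_ccont; [apply E2_deriv|apply E4_deriv|apply E6_deriv]; exact Ht.
Qed.

Lemma xf_cont (t : C) : 0 < Im t -> E6 t <> 0 -> ccont xf t.
Proof.
  intros Ht HR. destruct (E_cont t Ht) as [_ [C4 C6]]. unfold xf.
  apply ccont_div; [now apply Cpow_nz|now apply ccont_pow|now apply ccont_pow].
Qed.

Lemma Om_open (t : C) : Om t -> cnbhs t Om.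
Proof.
  intros [Ht [HR Hx]]. destruct (E_cont t Ht) as [_ [_ C6]]. unfold Om.
  apply filter_and; [now apply Im_nbhs|]. apply filter_and; [now apply ccont_neq0|].
  apply ccont_mod_lt; [now apply xf_cont|exact Hx].
Qed.

Lemma xf_deriv (t : C) : Om t -> cderiv xf t (tpi * (- (1 - xf t) * (E4 t ^ 2 / E6 t)))%C.
Proof.
  intros [Ht [HR _]]. eapply cderiv_val.
  - apply (cderiv_div (fun t => E4 t ^ 3)%C (fun t => E6 t ^ 2)%C); [now apply Cpow_nz| |].
    + apply (cderiv_pow E4), E4_deriv, Ht.
    + apply (cderiv_pow E6), E6_deriv, Ht.
  - unfold xf. cbn [INR pred]. rewrite !RtoC_plus. field. exact HR.
Qed.

Lemma PS_xf_deriv (a : nat -> C) (t : C) : polyg a -> Om t ->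
  cderiv (fun t => PS a (xf t)) t (PS (dcoef a) (xf t) * (tpi * (- (1 - xf t) * (E4 t ^ 2 / E6 t))))%C.
Proof.
  intros Ha Ht. apply (cderiv_comp (PS a) xf); [|now apply xf_deriv]. apply PS_deriv; [exact Ha|apply Ht].
Qed.

Lemma Yf_deriv (t : C) : Om t -> cderiv Yf t (tpi * (lgd t * Yf t - Zf t))%C.
Proof.
  intros Ht. eapply cderiv_val; [apply (PS_xf_deriv h1 t polyg_h1 Ht)|]. unfold Zf. ring.
Qed.

Lemma E4E6_deriv (t : C) : Om t -> cderiv (fun t => E4 t ^ 2 / E6 t)%C t
  (tpi * (2 * E4 t * ((E2 t * E4 t - E6 t) / 3) / E6 t - E4 t ^ 2 * ((E2 t * E6 t - E4 t ^ 2) / 2) / E6 t ^ 2))%C.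
Proof.
  intros [Ht [HR _]]. eapply cderiv_val.
  - apply (cderiv_div (fun t => E4 t ^ 2)%C E6); [exact HR|apply (cderiv_pow E4), E4_deriv, Ht|now apply E6_deriv].
  - cbn [INR pred]. rewrite !RtoC_plus. field. exact HR.
Qed.

Lemma lgd_deriv (t : C) : Om t -> cderiv lgd t
  (tpi * ((E2 t ^ 2 - E4 t) / 12 - (2 * E4 t * ((E2 t * E4 t - E6 t) / 3) / E6 t - E4 t ^ 2 * ((E2 t * E6 t - E4 t ^ 2) / 2) / E6 t ^ 2)) / 12)%C.
Proof.
  intros Ht. eapply cderiv_val.
  - apply (cderiv_div (fun t => E2 t - E4 t ^ 2 / E6 t)%C (fun _ => 12)); [intros E; apply RtoC_inj in E; lra| |apply cderiv_const].
    apply cderiv_minus; [apply E2_deriv, Ht|now apply E4E6_deriv].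
  - cbn beta. assert (HR := proj1 (proj2 Ht)). field. exact HR.
Qed.

Lemma ode_h1 (z : C) : Cmod z < 1 ->
  (z * (1 - z) * PS (dcoef (dcoef h1)) z + (2 / 3 - 5 / 3 * z) * PS (dcoef h1) z - 7 / 144 * PS h1 z)%C = 0.
Proof.
  intros Hz. assert (H := hyp_ode (1 / 12) (7 / 12) (2 / 3) ltac:(lra) ltac:(lra) ltac:(lra) ltac:(lra) ltac:(lra) z Hz).
  fold h1 in H. rewrite <- H. rewrite RtoC_plus, RtoC_plus, RtoC_mult, !RtoC_div by lra. field.
Qed.

Lemma ode_h2 (z : C) : Cmod z < 1 ->
  (z * (1 - z) * PS (dcoef (dcoef h2)) z + (4 / 3 - 7 / 3 * z) * PS (dcoef h2) z - 55 / 144 * PS h2 z)%C = 0.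
Proof.
  intros Hz. assert (H := hyp_ode (5 / 12) (11 / 12) (4 / 3) ltac:(lra) ltac:(lra) ltac:(lra) ltac:(lra) ltac:(lra) z Hz).
  fold h2 in H. rewrite <- H. rewrite RtoC_plus, RtoC_plus, RtoC_mult, !RtoC_div by lra. field.
Qed.

(** This first-order equation is the hypergeometric equation itself, rewritten with Ramanujan's
    equations. *)
Lemma Zf_deriv (t : C) : Om t -> cderiv Zf t (tpi * (lgd t * Zf t))%C.
Proof.
  intros Ht. assert (HR := proj1 (proj2 Ht)). assert (ODE := ode_h1 (xf t) (proj2 (proj2 Ht))). eapply cderiv_val.
  - apply (cderiv_plus (fun t => Yf t * lgd t)%C (fun t => PS (dcoef h1) (xf t) * (1 - xf t) * (E4 t ^ 2 / E6 t))%C).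
    + apply (cderiv_mult Yf lgd); [now apply Yf_deriv|now apply lgd_deriv].
    + apply (cderiv_mult (fun t => PS (dcoef h1) (xf t) * (1 - xf t))%C (fun t => E4 t ^ 2 / E6 t)%C); [|now apply E4E6_deriv].
      apply (cderiv_mult (fun t => PS (dcoef h1) (xf t)) (fun t => 1 - xf t)%C).
      * apply (PS_xf_deriv (dcoef h1) t); [apply polyg_dcoef, polyg_h1|exact Ht].
      * apply cderiv_minus; [apply cderiv_const|now apply xf_deriv].
  - cbn beta. unfold Zf, Yf, lgd in *. revert ODE.
    generalize (PS (dcoef (dcoef h1)) (xf t)) (PS (dcoef h1) (xf t)) (PS h1 (xf t)). intros F'' F' F.
    unfold xf. intros ODE. set (P := E2 t) in *. set (Q := E4 t) in *. set (R := E6 t) in *.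
    (* The multiplier of the hypergeometric equation is read off from the coefficient of F''. *)
    match type of ODE with ?e = _ => match goal with |- _ = ?r =>
      transitivity (r + tpi * (- (1 - Q ^ 3 / R ^ 2) * Q) * e)%C; [|rewrite ODE; ring] end end.
    field. exact HR.
Qed.

Lemma Hf_deriv (t : C) : Om t -> cderiv Hf t (PS (dcoef h2) (xf t) * (tpi * (- (1 - xf t) * (E4 t ^ 2 / E6 t))))%C.
Proof. exact (PS_xf_deriv h2 t polyg_h2). Qed.

Lemma Y2f_deriv (t : C) : Om t -> cderiv Y2f t (tpi * (5 * lgd t * Y2f t - Z2f t))%C.
Proof.
  intros Ht. assert (HR := proj1 (proj2 Ht)). eapply cderiv_val.
  - apply (cderiv_mult E4 Hf); [apply E4_deriv, Ht|now apply Hf_deriv].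
  - unfold Z2f, Y2f. field. exact HR.
Qed.

Lemma Z2f_deriv (t : C) : Om t -> cderiv Z2f t (tpi * (5 * lgd t * Z2f t))%C.
Proof.
  intros Ht. assert (HR := proj1 (proj2 Ht)). assert (ODE := ode_h2 (xf t) (proj2 (proj2 Ht))). eapply cderiv_val.
  - apply cderiv_plus; [apply cderiv_minus|].
    + apply (cderiv_mult (fun t => 5 * lgd t)%C Y2f); [apply cderiv_scal; now apply lgd_deriv|now apply Y2f_deriv].
    + apply (cderiv_mult (fun t => (E2 t * E4 t - E6 t) / 3)%C Hf); [|now apply Hf_deriv].
      apply (cderiv_div (fun t => E2 t * E4 t - E6 t)%C (fun _ => 3)); [intros E; apply RtoC_inj in E; lra| |apply cderiv_const].
      apply cderiv_minus; [|apply E6_deriv, Ht].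
      apply cderiv_mult; [apply E2_deriv, Ht|apply E4_deriv, Ht].
    + apply (cderiv_mult (fun t => E4 t ^ 3 / E6 t * (1 - xf t))%C (fun t => PS (dcoef h2) (xf t))).
      * apply (cderiv_mult (fun t => E4 t ^ 3 / E6 t)%C (fun t => 1 - xf t)%C).
        -- apply (cderiv_div (fun t => E4 t ^ 3)%C E6); [exact HR|apply (cderiv_pow E4), E4_deriv, Ht|apply E6_deriv, Ht].
        -- apply cderiv_minus; [apply cderiv_const|now apply xf_deriv].
      * apply (PS_xf_deriv (dcoef h2) t); [apply polyg_dcoef, polyg_h2|exact Ht].
  - cbn beta. unfold Z2f, Y2f, Hf, lgd in *. cbn [INR pred]. rewrite !RtoC_plus. revert ODE.
    generalize (PS (dcoef (dcoef h2)) (xf t)) (PS (dcoef h2) (xf t)) (PS h2 (xf t)). intros F'' F' F.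
    unfold xf. intros ODE. set (P := E2 t) in *. set (Q := E4 t) in *. set (R := E6 t) in *.
    match type of ODE with ?e = _ => match goal with |- _ = ?r =>
      transitivity (r + tpi * (- (1 - Q ^ 3 / R ^ 2) * Q ^ 2) * e)%C; [|rewrite ODE; ring] end end.
    field. exact HR.
Qed.

Lemma E6_lgd_deriv (t : C) : Om t -> cderiv E6 t (tpi * (6 * lgd t * E6 t))%C.
Proof.
  intros Ht. assert (HR := proj1 (proj2 Ht)). eapply cderiv_val; [apply E6_deriv, Ht|]. unfold lgd. field. exact HR.
Qed.

(** [V1f] and [V2f] have the logarithmic derivatives of E6^(1/6) and E6^(5/6). Both vanish at rho,
    the first through E2(rho) and the second through E4(rho) = 0. *)
Definition V1f (t : C) : C := (tpi * (t - Cconj rho) * Zf t + Yf t)%C.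
Definition V2f (t : C) : C := (tpi * (t - rho) * Z2f t + Y2f t)%C.

Lemma V1f_deriv (t : C) : Om t -> cderiv V1f t (tpi * (lgd t * V1f t))%C.
Proof.
  intros Ht. eapply cderiv_val.
  - apply cderiv_plus; [|now apply Yf_deriv].
    apply (cderiv_mult (fun t => tpi * (t - Cconj rho))%C Zf); [|now apply Zf_deriv].
    apply cderiv_scal. apply cderiv_minus; [apply cderiv_id|apply cderiv_const].
  - unfold V1f. ring.
Qed.

Lemma V2f_deriv (t : C) : Om t -> cderiv V2f t (tpi * (5 * lgd t * V2f t))%C.
Proof.
  intros Ht. eapply cderiv_val.
  - apply cderiv_plus; [|now apply Y2f_deriv].
    apply (cderiv_mult (fun t => tpi * (t - rho))%C Z2f); [|now apply Z2f_deriv].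
    apply cderiv_scal. apply cderiv_minus; [apply cderiv_id|apply cderiv_const].
  - unfold V2f. ring.
Qed.

(* [f^m] and [g^k] have the same logarithmic derivative; integer powers avoid choosing a branch of E6^(1/6). *)
Lemma ratio_const (f g : C -> C) (k m : nat) (t : C) : Om t -> (1 <= k)%nat -> (1 <= m)%nat ->
  (forall t, Om t -> cderiv f t (tpi * (RtoC (INR k) * lgd t * f t))%C) ->
  (forall t, Om t -> cderiv g t (tpi * (RtoC (INR m) * lgd t * g t))%C) ->
  cnbhs t (fun w => g w <> 0) -> cnbhs t (fun w => (f w ^ m / g w ^ k)%C = (f t ^ m / g t ^ k)%C).
Proof.
  intros Ht Hk Hm Hf Hg Hg0. destruct (filter_and _ _ (Om_open t Ht) Hg0) as [d [Hd H]].
  exists d. split; [exact Hd|]. apply (cderiv_0_const (fun w => f w ^ m / g w ^ k)%C t d).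
  intros z Hz. destruct (H z Hz) as [Hz1 Hz2]. eapply cderiv_val.
  - apply (cderiv_div (fun w => f w ^ m)%C (fun w => g w ^ k)%C); [now apply Cpow_nz| |].
    + apply (cderiv_pow f), Hf, Hz1.
    + apply (cderiv_pow g), Hg, Hz1.
  - destruct k as [|k]; [lia|]. destruct m as [|m]; [lia|]. cbn [pred Cpow]. field. split; [now apply Cpow_nz|exact Hz2].
Qed.


(** * Values at rho and the relations between the two solutions *)

(** E2(rho) / 12, with E2(rho) = 2 sqrt 3 / PI. *)
Definition Z0 : R := / (2 * sqrt 3 * PI).

Lemma Z0_pos : 0 < Z0.
Proof.
  assert (H := sqrt3_pos). assert (HP := PI_RGT_0). apply Rinv_0_lt_compat. apply Rmult_lt_0_compat; lra.
Qed.

Lemma xf_rho : xf rho = 0.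
Proof. unfold xf. rewrite E4_rho. unfold Cdiv. ring. Qed.

Lemma E6_rho_neq0 : E6 rho <> 0.
Proof. destruct E6_rho as [R0 [HR ->]]. intros E. apply RtoC_inj in E. lra. Qed.

Lemma Om_rho : Om rho.
Proof.
  repeat split; [apply rho_Im|apply E6_rho_neq0|]. rewrite xf_rho, Cmod_0. lra.
Qed.

Lemma lgd_rho : lgd rho = RtoC Z0.
Proof.
  assert (T := tpi_neq0). assert (N := C1_neq _ rho_neq1).
  assert (Hs := sqrt3_pos). assert (HP := PI_RGT_0).
  unfold lgd. rewrite E4_rho. replace (0 ^ 2 / E6 rho)%C with (RtoC 0) by (field; apply E6_rho_neq0).
  assert (H := E2_rho).
  assert (N' : (rho - 1)%C <> 0) by (intros E; apply N; replace (1 - rho)%C with (- (rho - 1))%C by ring; rewrite E; ring).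
  replace ((E2 rho - 0) / 12)%C with (tpi * E2 rho * (rho - 1) / (12 * tpi * (rho - 1)))%C by (field; split; assumption).
  rewrite H.
  assert (E : (12 * rho ^ 2)%C = (RtoC Z0 * (12 * tpi * (rho - 1)))%C).
  { replace (rho ^ 2)%C with (rho * rho)%C by ring. rewrite rho_quad, rho_val.
    unfold tpi, Z0, Ci, Cminus, Cplus, Copp, Cmult, RtoC; cbn. assert (S3 := sqrt3_sq).
    f_equal.
    - field. split; lra.
    - apply Rmult_eq_reg_r with (sqrt 3); [|lra]. field_simplify; [|split; lra]. nra. }
  rewrite E. field. split; assumption.
Qed.

Lemma Yf_rho : Yf rho = 1.
Proof. unfold Yf. rewrite xf_rho, PS_0 by apply polyg_h1. reflexivity. Qed.

Lemma Hf_rho : Hf rho = 1.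
Proof. unfold Hf. rewrite xf_rho, PS_0 by apply polyg_h2. reflexivity. Qed.

Lemma Zf_rho : Zf rho = RtoC Z0.
Proof.
  unfold Zf. rewrite Yf_rho, lgd_rho, E4_rho. field. apply E6_rho_neq0.
Qed.

Lemma Z2f_rho : Z2f rho = (E6 rho / 3)%C.
Proof.
  unfold Z2f, Y2f. rewrite Hf_rho, E4_rho. field. apply E6_rho_neq0.
Qed.

Lemma rho_conj_diff : (rho - Cconj rho)%C = (Ci * RtoC (sqrt 3))%C.
Proof. rewrite rho_val. unfold Cconj, Ci, Cminus, Cplus, Copp, Cmult, RtoC; cbn. f_equal; field. Qed.

Lemma V1f_rho : V1f rho = 0.
Proof.
  unfold V1f. rewrite Zf_rho, Yf_rho, rho_conj_diff.
  replace (tpi * (Ci * RtoC (sqrt 3)) * RtoC Z0)%C with (Ci * Ci * RtoC (2 * PI * sqrt 3 * Z0))%C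
    by (unfold tpi; rewrite !RtoC_mult; ring).
  rewrite Ci_sq. replace (2 * PI * sqrt 3 * Z0) with 1; [ring|].
  unfold Z0. field. assert (H := sqrt3_pos). assert (HP := PI_RGT_0). split; lra.
Qed.

Lemma V2f_rho : V2f rho = 0.
Proof. unfold V2f, Y2f. rewrite E4_rho. ring. Qed.

(** Quotients that are locally constant without any choice of a root. [inv2] and [inv4] fix Z and Z2
    only up to sixth roots of unity; [inv5] ties the two choices together. *)
Definition inv1 (t : C) : C := (V1f t ^ 6 / E6 t ^ 1)%C.
Definition inv2 (t : C) : C := (Zf t ^ 6 / E6 t ^ 1)%C.
Definition inv3 (t : C) : C := (V2f t ^ 6 / E6 t ^ 5)%C.
Definition inv4 (t : C) : C := (Z2f t ^ 6 / E6 t ^ 5)%C.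
Definition inv5 (t : C) : C := (Zf t ^ 5 / Z2f t ^ 1)%C.

Lemma deriv_k1 (f : C -> C) : (forall t, Om t -> cderiv f t (tpi * (lgd t * f t))%C) ->
  forall t, Om t -> cderiv f t (tpi * (RtoC (INR 1) * lgd t * f t))%C.
Proof. intros H t Ht. eapply cderiv_val; [now apply H|]. cbn [INR]. ring. Qed.

Lemma INR5 : INR 5 = 5. Proof. cbn. ring. Qed.
Lemma INR6 : INR 6 = 6. Proof. cbn. ring. Qed.

Lemma E6_near (t : C) : Om t -> cnbhs t (fun w => E6 w <> 0).
Proof. intros Ht. apply ccont_neq0; [|apply Ht]. destruct (E_cont t (proj1 Ht)) as [_ [_ H]]. exact H. Qed.

Lemma inv_const (t : C) : Om t ->
  cnbhs t (fun w => inv1 w = inv1 t) /\ cnbhs t (fun w => inv2 w = inv2 t) /\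
  cnbhs t (fun w => inv3 w = inv3 t) /\ cnbhs t (fun w => inv4 w = inv4 t) /\
  (Z2f t <> 0 -> cnbhs t (fun w => inv5 w = inv5 t)).
Proof.
  intros Ht. assert (HR := E6_near t Ht).
  assert (DR : forall t, Om t -> cderiv E6 t (tpi * (RtoC (INR 6) * lgd t * E6 t))%C)
    by (rewrite INR6; apply E6_lgd_deriv).
  assert (DZ2 : forall t, Om t -> cderiv Z2f t (tpi * (RtoC (INR 5) * lgd t * Z2f t))%C)
    by (rewrite INR5; apply Z2f_deriv).
  repeat split.
  - apply (ratio_const V1f E6 1 6); auto; try lia. apply deriv_k1, V1f_deriv.
  - apply (ratio_const Zf E6 1 6); auto; try lia. apply deriv_k1, Zf_deriv.
  - apply (ratio_const V2f E6 5 6); auto; try lia. rewrite INR5. apply V2f_deriv.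
  - apply (ratio_const Z2f E6 5 6); auto; lia.
  - intros HZ. apply (ratio_const Zf Z2f 1 5); auto; try lia. { apply deriv_k1, Zf_deriv. }
    apply ccont_neq0; [|exact HZ]. eapply cderiv_ccont, Z2f_deriv, Ht.
Qed.

(** Stands for Z = c E6^(1/6) and Z2 = c' E6^(5/6), with constants fixed at rho, expressed through
    powers only. *)
Definition Rel (t : C) : Prop :=
  Yf t = (- (tpi * (t - Cconj rho) * Zf t))%C /\ Y2f t = (- (tpi * (t - rho) * Z2f t))%C /\
  (Zf t ^ 6 * E6 rho)%C = (RtoC Z0 ^ 6 * E6 t)%C /\ (Zf t ^ 5 * E6 rho)%C = (3 * RtoC Z0 ^ 5 * Z2f t)%C /\
  Zf t <> 0 /\ Z2f t <> 0.

Lemma Cpow_eq0 (z : C) (n : nat) : (z ^ n)%C = 0 -> z = 0.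
Proof. intros H. destruct (Ceq_dec z 0) as [E|E]; [exact E|]. exfalso. now apply (Cpow_nz z n E). Qed.

Lemma div_eq (a b c : C) : b <> 0 -> (a / b)%C = c -> a = (c * b)%C.
Proof. intros Hb <-. field. exact Hb. Qed.

Lemma Z0_neq0 : RtoC Z0 <> 0.
Proof. intros E. apply RtoC_inj in E. assert (H := Z0_pos). lra. Qed.

(** Has to come before [inv5] is used: the local constancy of [inv5] requires a nonzero Z2. *)
Lemma inv4_Z2 (t : C) : Om t -> inv4 t = inv4 rho -> Z2f t <> 0.
Proof.
  intros Ht E E0. unfold inv4 in E. rewrite E0, Z2f_rho in E. assert (HR := E6_rho_neq0).
  assert (N : (E6 t ^ 5)%C <> 0) by (apply Cpow_nz, Ht).
  replace (0 ^ 6 / E6 t ^ 5)%C with (RtoC 0) in E by (field; apply Ht).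
  assert (N2 : ((E6 rho / 3) ^ 6 / E6 rho ^ 5)%C <> 0).
  { replace ((E6 rho / 3) ^ 6 / E6 rho ^ 5)%C with (E6 rho * / 729)%C by (field; exact HR).
    apply Cmult_neq_0; [exact HR|]. rewrite <- RtoC_inv by lra. intros E'. apply RtoC_inj in E'. lra. }
  apply N2. now rewrite <- E.
Qed.

Lemma Rel_of_inv (t : C) : Om t -> inv1 t = inv1 rho -> inv2 t = inv2 rho -> inv3 t = inv3 rho ->
  inv4 t = inv4 rho -> inv5 t = inv5 rho -> Rel t.
Proof.
  intros Ht E1 E2' E3 E4' E5. assert (HZ2 := inv4_Z2 t Ht E4').
  assert (HR := E6_rho_neq0). assert (HRt := proj1 (proj2 Ht)).
  assert (HZ0 := Z0_neq0).
  unfold inv1 in E1. rewrite V1f_rho in E1. unfold inv3 in E3. rewrite V2f_rho in E3.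
  unfold inv2 in E2'. rewrite Zf_rho in E2'. unfold inv5 in E5. rewrite Zf_rho, Z2f_rho in E5.
  replace (0 ^ 6 / E6 rho ^ 1)%C with (RtoC 0) in E1 by (field; exact HR).
  replace (0 ^ 6 / E6 rho ^ 5)%C with (RtoC 0) in E3 by (field; exact HR).
  apply div_eq in E1; [|now apply Cpow_nz]. rewrite Cmult_0_l in E1. apply Cpow_eq0 in E1.
  apply div_eq in E3; [|now apply Cpow_nz]. rewrite Cmult_0_l in E3. apply Cpow_eq0 in E3.
  apply div_eq in E2'; [|now apply Cpow_nz]. apply div_eq in E5; [|now apply Cpow_nz].
  assert (HZ6 : (Zf t ^ 6 * E6 rho)%C = (RtoC Z0 ^ 6 * E6 t)%C) by (rewrite E2'; field; exact HR).
  repeat split; auto.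
  - unfold V1f in E1. replace (Yf t) with ((tpi * (t - Cconj rho) * Zf t + Yf t) - tpi * (t - Cconj rho) * Zf t)%C by ring.
    rewrite E1. ring.
  - unfold V2f in E3. replace (Y2f t) with ((tpi * (t - rho) * Z2f t + Y2f t) - tpi * (t - rho) * Z2f t)%C by ring.
    rewrite E3. ring.
  - rewrite E5. field. exact HR.
  - intros E. rewrite E in HZ6. replace (0 ^ 6 * E6 rho)%C with (RtoC 0) in HZ6 by ring.
    symmetry in HZ6. revert HZ6. apply Cmult_neq_0; [now apply Cpow_nz|exact HRt].
Qed.

Lemma Rel_near_rho : cnbhs rho (fun t => Om t /\ inv1 t = inv1 rho /\ inv2 t = inv2 rho /\ inv3 t = inv3 rho /\
  inv4 t = inv4 rho /\ inv5 t = inv5 rho).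
Proof.
  destruct (inv_const rho Om_rho) as [H1 [H2 [H3 [H4 H5]]]].
  assert (HZ : Z2f rho <> 0) by (apply (inv4_Z2 rho Om_rho); reflexivity).
  apply filter_and; [apply Om_open, Om_rho|]. repeat apply filter_and; auto.
Qed.

(** * The component of [J_small] at [rho] *)

Lemma cnbhs_locally (z : C) (P : C -> Prop) : cnbhs z P -> @locally C_UniformSpace z P.
Proof.
  intros [d [Hd H]]. assert (H2 := sqrt_lt_R0 2 ltac:(lra)).
  assert (Hd2 : 0 < d / sqrt 2) by (now apply Rdiv_lt_0_compat).
  exists (mkposreal _ Hd2). intros w Hw. apply H.
  apply (C_NormedModule_mixin_compat2 z w (mkposreal _ Hd2)) in Hw. cbn [pos] in Hw.
  change (minus w z) with (w - z)%C in Hw. replace (sqrt 2 * (d / sqrt 2)) with d in Hw by (field; lra). exact Hw.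
Qed.

Lemma interior_open (P : C -> Prop) : @open C_UniformSpace (fun z => cnbhs z P).
Proof. intros z Hz. apply cnbhs_locally. now apply cnbhs_nbhs. Qed.

(** The points of B around which [f] agrees, respectively disagrees, with [f x] on B; taking
    interiors turns these two sets into open sets of the plane. *)
Lemma connected_const {A : Type} (B : C -> Prop) (f : C -> A) : @connected C_UniformSpace B ->
  (forall z, B z -> cnbhs z (fun w => B w -> f w = f z)) -> forall x y, B x -> B y -> f x = f y.
Proof.
  intros HB Hf x y Hx Hy. apply NNPP. intros Hne.
  destruct (HB (fun z => cnbhs z (fun w => B w -> f w = f x)) (fun z => cnbhs z (fun w => B w -> f w <> f x)))
    as [z [Hz [Hu Hv]]].
  - apply interior_open.
  - apply interior_open.
  - intros z Hz. specialize (Hf z Hz). destruct (classic (f z = f x)) as [E|E]; [left|right];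
      (revert Hf; apply filter_imp; intros w Hw Hbw; now rewrite Hw).
  - exists x. split; [exact Hx|]. now apply Hf.
  - exists y. split; [exact Hy|]. generalize (Hf y Hy). apply filter_imp. intros w Hw Hbw E. apply Hne.
    rewrite <- E. now apply Hw.
  - apply (cnbhs_self _ _ Hv Hz). now apply (cnbhs_self _ _ Hu).
Qed.

Lemma Jinv_ratio (t : C) : 0 < Im t -> E6 t <> 0 -> (Jinv t / (Jinv t - 1))%C = xf t.
Proof.
  intros Ht HR. assert (HD := Delta_neq0 t Ht). unfold Delta in HD. unfold Jinv, xf. field.
  repeat split; try assumption.
  replace (E4 t ^ 3 - (E4 t ^ 3 - E6 t ^ 2))%C with (E6 t ^ 2)%C by ring. now apply Cpow_nz.
Qed.

(* Where [E6] vanishes, [Jinv] is 1 and the division by zero puts the point in [J_small];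
   it is isolated there because |J / (J - 1)| is large nearby. *)
Lemma E6_zero_isolated (t : C) : 0 < Im t -> E6 t = 0 -> cnbhs t (fun w => J_small w -> w = t).
Proof.
  intros Ht HR. destruct (E_cont t Ht) as [_ [C4 C6]]. assert (HD := Delta_neq0 t Ht). unfold Delta in HD. rewrite HR in HD.
  assert (HQ : E4 t <> 0) by (intros E; apply HD; rewrite E; ring).
  destruct (E6_deriv t Ht) as [g [G1 [G2 G3]]].
  assert (Hg : g t <> 0).
  { rewrite G2, HR. replace (tpi * ((E2 t * 0 - E4 t ^ 2) / 2))%C with (- (1) * (tpi * / 2 * E4 t ^ 2))%C by field.
    apply Cmult_neq_0; [|apply Cmult_neq_0; [apply Cmult_neq_0; [apply tpi_neq0|]|now apply Cpow_nz]].
    - intros E. assert (E' : (- - (1))%C = 0) by (rewrite E; ring). replace (- - (1))%C with (RtoC 1) in E' by ring.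
      now apply C1_neq0.
    - rewrite <- RtoC_inv by lra. intros E. apply RtoC_inj in E. lra. }
  assert (C3 : ccont (fun w => E6 w ^ 2 / E4 w ^ 3)%C t).
  { apply ccont_div; [now apply Cpow_nz|now apply ccont_pow|now apply ccont_pow]. }
  assert (Hsm := ccont_mod_lt _ t 1 C3). cbn beta in Hsm. rewrite HR in Hsm.
  replace (0 ^ 2 / E4 t ^ 3)%C with (RtoC 0) in Hsm by (field; exact HQ). rewrite Cmod_0 in Hsm.
  generalize (filter_and _ _ (filter_and _ _ G1 (ccont_neq0 g t G3 Hg)) (filter_and _ _ (Hsm Rlt_0_1)
     (filter_and _ _ (ccont_neq0 _ _ C4 HQ) (Im_nbhs t Ht)))).
  apply filter_imp. intros w [[W1 W2] [W3 [W4 W5]]] [_ HJ].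
  destruct (Ceq_dec w t) as [E|E]; [exact E|exfalso].
  assert (HRw : E6 w <> 0).
  { intros E0. rewrite E0, HR in W1. replace (0 - 0)%C with (RtoC 0) in W1 by ring. symmetry in W1. revert W1.
    apply Cmult_neq_0; [|exact W2]. intros E1. apply E. replace w with (w - t + t)%C by ring. rewrite E1. ring. }
  rewrite Jinv_ratio in HJ by assumption. unfold xf in HJ.
  rewrite Cmod_div in W3, HJ by now apply Cpow_nz.
  assert (P4 := proj1 (Cmod_gt_0 _) (Cpow_nz _ 3 W4)). assert (P6 := proj1 (Cmod_gt_0 _) (Cpow_nz _ 2 HRw)).
  apply (Rmult_lt_compat_r _ _ _ P4) in W3. apply (Rmult_lt_compat_r _ _ _ P6) in HJ.
  unfold Rdiv in W3, HJ. rewrite Rmult_assoc, Rinv_l in W3, HJ by lra. lra.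
Qed.

Lemma fund_domain_neq_rho (t : C) : fund_domain t -> t <> rho.
Proof.
  intros [_ [H _]] E. rewrite E, rho_val in H. cbn in H. rewrite Rabs_left in H; lra.
Qed.

(** Since rho is only in the closure of the component, this supplies a connected set joining t to
    points arbitrarily close to rho, on which E6 has no zero. *)
Lemma C_rho_path (t : C) : C_rho t -> forall N, cnbhs rho N ->
  exists (B : C -> Prop) (y : C), @connected C_UniformSpace B /\ B t /\ B y /\ N y /\
    forall z, B z -> fund_domain z /\ Om z.
Proof.
  intros [HJ Hcl] N HN.
  (* The neighbourhood of rho is shrunk to omit t, so that B contains two distinct points. *)
  destruct (Hcl (fun z => cnbhs z (fun w => N w /\ w <> t))) as [y [[B [HB [HBJ [Ht Hy]]]] HNy]].
  - apply interior_open.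
  - apply cnbhs_nbhs in HN. apply cnbhs_self in HN. apply filter_and; [exact HN|].
    assert (Hne : (rho - t)%C <> 0).
    { intros E. apply (fund_domain_neq_rho t (proj1 HJ)). replace t with (rho - (rho - t))%C by ring. rewrite E. ring. }
    assert (Hc : ccont (fun w => w - t)%C rho) by (apply ccont_minus; [apply ccont_id|apply ccont_const]).
    generalize (ccont_neq0 _ _ Hc Hne). apply filter_imp. intros w Hw E. apply Hw. rewrite E. ring.
  - apply cnbhs_self in HNy. destruct HNy as [HNy Hyt].
    exists B, y. repeat (split; [assumption|]). intros z Hz.
    assert (HJz := HBJ z Hz). split; [apply HJz|].
    assert (Hz0 := proj1 (proj1 HJz)).
    assert (HRz : E6 z <> 0).
    (* A zero z of E6 is isolated in [J_small], so being equal to z is locally constant on B and B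
       would reduce to z. *)
    { intros E0. assert (Hiso := E6_zero_isolated z Hz0 E0).
      assert (Hcst := connected_const B (fun w => if Ceq_dec w z then true else false) HB).
      assert (Hall : forall v, B v -> v = z).
      { intros v Hv. assert (E : (if Ceq_dec v z then true else false) = (if Ceq_dec z z then true else false)).
        { apply Hcst; [|exact Hv|exact Hz]. intros u Hu. destruct (Ceq_dec u z) as [E|E].
          - subst u. revert Hiso. apply filter_imp. intros w Hw Hbw. rewrite (Hw (HBJ w Hbw)).
            now destruct (Ceq_dec z z).
          - assert (Hc : ccont (fun w => w - z)%C u) by (apply ccont_minus; [apply ccont_id|apply ccont_const]).
            assert (Hne : (u - z)%C <> 0) by (intros E'; apply E; replace u with (u - z + z)%C by ring; rewrite E'; ring).
            generalize (ccont_neq0 _ _ Hc Hne). apply filter_imp. intros w Hw _.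
            destruct (Ceq_dec w z) as [E'|E']; [|reflexivity]. exfalso. apply Hw. rewrite E'. ring. }
        destruct (Ceq_dec v z); [assumption|]. now destruct (Ceq_dec z z). }
      apply Hyt. rewrite (Hall y Hy), (Hall t Ht). reflexivity. }
    repeat split; [exact Hz0|exact HRz|]. rewrite <- Jinv_ratio by assumption. apply HJz.
Qed.

Lemma Rel_on_connected (B : C -> Prop) (y : C) : @connected C_UniformSpace B -> B y ->
  (forall z, B z -> Om z) ->
  (inv1 y = inv1 rho /\ inv2 y = inv2 rho /\ inv3 y = inv3 rho /\ inv4 y = inv4 rho /\ inv5 y = inv5 rho) ->
  forall z, B z -> Rel z.
Proof.
  intros HB Hy HO [E1 [E2' [E3 [E4' E5]]]] z Hz.
  assert (F : forall f : C -> C, (forall u, B u -> cnbhs u (fun w => f w = f u)) -> forall u, B u -> f u = f y).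
  { intros f Hf u Hu. apply (connected_const B f HB); auto. intros v Hv. generalize (Hf v Hv). apply filter_imp. auto. }
  assert (G4 : forall u, B u -> inv4 u = inv4 rho).
  { intros u Hu. rewrite <- E4'. apply F; [|exact Hu]. intros v Hv. apply (inv_const v (HO v Hv)). }
  apply Rel_of_inv; [now apply HO| | | |now apply G4|]; [rewrite <- E1|rewrite <- E2'|rewrite <- E3|rewrite <- E5];
    (apply F; [intros v Hv; assert (I := inv_const v (HO v Hv))|exact Hz]); try apply I.
  apply (inv4_Z2 v (HO v Hv)). now apply G4.
Qed.


(** * Location of the values of [Jinv] *)

(** The disc coordinate centred at rho: geodesics through rho become diameters, and the rotation of
    order 3 about rho becomes multiplication by a cube root of unity. *)
Definition wf (t : C) : C := ((t - rho) / (t - Cconj rho))%C.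

Lemma rho_conj_neq (t : C) : 0 < Im t -> (t - Cconj rho)%C <> 0.
Proof.
  intros Ht E. assert (H := rho_Im). apply (f_equal Im) in E.
  replace (Im (t - Cconj rho)) with (Im t + Im rho) in E by (destruct t, rho; cbn; ring).
  change (Im (RtoC 0)) with 0 in E. lra.
Qed.

Lemma Yf_neq0 (t : C) : 0 < Im t -> Rel t -> Yf t <> 0.
Proof.
  intros Ht [E [_ [_ [_ [HZ _]]]]]. rewrite E. intros E0.
  assert (N : (tpi * (t - Cconj rho) * Zf t)%C <> 0).
  { apply Cmult_neq_0; [apply Cmult_neq_0; [apply tpi_neq0|now apply rho_conj_neq]|exact HZ]. }
  apply N. replace (tpi * (t - Cconj rho) * Zf t)%C with (- - (tpi * (t - Cconj rho) * Zf t))%C by ring. rewrite E0. ring.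
Qed.

(** The cube of the quotient of the two hypergeometric solutions; cubing removes the factor
    x^(1/3). *)
Definition kk (x : C) : C := (x * (PS h2 x ^ 3 / PS h1 x ^ 3))%C.

(** Dividing the first two relations of [Rel] gives w = E4 H Z / (Y Z2); Z2 and E6 are then replaced
    by multiples of Z^5 and Z^6, and all powers of Z cancel. *)
Lemma wf_cube (t : C) : Om t -> Rel t -> (wf t ^ 3 * E6 rho)%C = (27 * RtoC Z0 ^ 3 * kk (xf t))%C.
Proof.
  intros [Ht [HR _]] HRel. assert (HY := Yf_neq0 t Ht HRel). destruct HRel as [E1 [E2' [E3 [E4' [HZ HZ2]]]]].
  assert (HR0 := E6_rho_neq0). assert (HZ0 := Z0_neq0). assert (T := tpi_neq0).
  assert (Hd := rho_conj_neq t Ht).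
  unfold kk. fold (Yf t). fold (Hf t). unfold Y2f in E2'.
  set (Y := Yf t) in *. set (Z := Zf t) in *. set (Z2 := Z2f t) in *. set (H := Hf t) in *.
  set (Q := E4 t) in *. set (R := E6 t) in *. set (R0 := E6 rho) in *. set (z := RtoC Z0) in *.
  assert (W : wf t = (Q * H * Z / (Y * Z2))%C).
  { unfold wf. rewrite E1, E2'. field. repeat split; assumption. }
  assert (EZ2 : Z2 = (Z ^ 5 * R0 / (3 * z ^ 5))%C) by (rewrite E4'; field; exact HZ0).
  assert (ER : R = (Z ^ 6 * R0 / z ^ 6)%C) by (rewrite E3; field; exact HZ0).
  rewrite W. unfold xf. fold Q R. rewrite EZ2, ER. field. repeat split; assumption.
Qed.

(** Multiplying numerator and denominator by the conjugate denominator produces A - B rho with real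
    A and B, both positive on the fundamental domain. *)
Lemma wf_fund (t : C) : 0 < Im t -> exists N : R, 0 < N /\
  wf t = ((RtoC (Cmod t ^ 2 - 1) - RtoC (2 * Re t + 1) * rho) / RtoC N)%C /\
  RtoC N = ((t - Cconj rho) * Cconj (t - Cconj rho))%C.
Proof.
  intros Ht. assert (Hd := rho_conj_neq t Ht). exists (Cmod (t - Cconj rho) ^ 2).
  assert (Hp := proj1 (Cmod_gt_0 _) Hd). split; [now apply pow_lt|].
  assert (EN : RtoC (Cmod (t - Cconj rho) ^ 2) = ((t - Cconj rho) * Cconj (t - Cconj rho))%C)
    by apply Cmod2_conj.
  split; [|exact EN]. rewrite EN. unfold wf.
  assert (Hc : Cconj (t - Cconj rho) <> 0).
  { intros E. apply (f_equal Cmod) in E. rewrite Cmod_conj, Cmod_0 in E. lra. }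
  assert (Hnum : (RtoC (Cmod t ^ 2 - 1) - RtoC (2 * Re t + 1) * rho)%C = ((t - rho) * Cconj (t - Cconj rho))%C).
  { rewrite Cmod2_alt, rho_val. assert (S3 := sqrt3_sq). destruct t as [u v].
    unfold Cconj, Cminus, Cplus, Copp, Cmult, RtoC; cbn. f_equal; nra. }
  rewrite Hnum. field. split; assumption.
Qed.

(* Im (A - B rho)^3 = - (3 sqrt 3 / 2) A B (A + B) *)
Lemma wf_cube_Im (t : C) : fund_domain t -> Im (wf t ^ 3) < 0.
Proof.
  intros [Ht [Hre Hmod]]. destruct (wf_fund t Ht) as [N [HN [E _]]]. rewrite E.
  set (A := Cmod t ^ 2 - 1). set (B := 2 * Re t + 1).
  assert (HA : 0 < A) by (unfold A; nra).
  assert (HB : 0 < B) by (apply Rabs_def2 in Hre; unfold B; lra).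
  assert (HN0 : RtoC N <> 0) by (intros E0; apply RtoC_inj in E0; lra).
  replace (((RtoC A - RtoC B * rho) / RtoC N) ^ 3)%C with
    (RtoC (/ N ^ 3) * (RtoC (A ^ 3 - B ^ 3 - 3 * A * B ^ 2) - RtoC (3 * A * B * (A + B)) * rho))%C.
  - rewrite rho_val. assert (H3 := sqrt3_pos). assert (0 < / N ^ 3) by (apply Rinv_0_lt_compat, pow_lt; exact HN).
    assert (0 < A * B * (A + B)) by (repeat apply Rmult_lt_0_compat; lra).
    unfold Cminus, Cplus, Copp, Cmult, RtoC; cbn.
    assert (0 < A * B * (A + B) * sqrt 3) by (apply Rmult_lt_0_compat; assumption). cbn in H.
    match goal with |- ?e < 0 => replace e with (- (3 / 2) * (/ (N * (N * (N * 1))) * (A * B * (A + B) * sqrt 3))) by (field; lra) end.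
    assert (0 < / (N * (N * (N * 1))) * (A * B * (A + B) * sqrt 3)) by (apply Rmult_lt_0_compat; assumption). lra.
  - assert (C3 := rho_cub). assert (Q2 := rho_quad).
    replace (((RtoC A - RtoC B * rho) / RtoC N) ^ 3)%C
      with (/ RtoC N ^ 3 * (RtoC A ^ 3 - 3 * RtoC A ^ 2 * RtoC B * rho + 3 * RtoC A * RtoC B ^ 2 * (rho * rho) - RtoC B ^ 3 * rho ^ 3))%C
      by (field; exact HN0).
    rewrite C3, Q2, RtoC_inv by (apply pow_nonzero; lra).
    rewrite !RtoC_minus, !RtoC_mult, !RtoC_pow, !RtoC_plus. ring.
Qed.

Lemma kk_real (x : R) : Rabs x < 1 -> Im (kk (RtoC x)) = 0.
Proof.
  intros Hx. unfold kk.
  destruct (PS_hgc_real (1 / 12) (7 / 12) (2 / 3) ltac:(lra) ltac:(lra) ltac:(lra) ltac:(lra) ltac:(lra) x Hx) as [y1 Hy1].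
  destruct (PS_hgc_real (5 / 12) (11 / 12) (4 / 3) ltac:(lra) ltac:(lra) ltac:(lra) ltac:(lra) ltac:(lra) x Hx) as [y2 Hy2].
  fold h1 in Hy1. fold h2 in Hy2. rewrite Hy1, Hy2, <- !RtoC_pow.
  (* For a vanishing denominator the convention for division still yields imaginary part 0. *)
  destruct (Req_dec (y1 ^ 3) 0) as [E|E].
  - rewrite E. unfold Cdiv, Cinv, Cmult, RtoC; cbn. unfold Rdiv. ring.
  - rewrite <- RtoC_div, <- RtoC_mult by exact E. reflexivity.
Qed.

Lemma cderiv_vertical (f : C -> C) (u s : R) (l : C) : cderiv f (u, s) l ->
  derivable_pt_lim (fun s => Im (f (u, s))) s (Re l).
Proof.
  intros [g [H1 [H2 H3]]] eps He. destruct (filter_and _ _ H1 (clim_re g _ eps He H3)) as [d [Hd H]].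
  exists (mkposreal d Hd). intros h Hh Hhd. cbn [pos] in Hhd.
  assert (E0 : ((u, (s + h)%R) - (u, s))%C = (0, h)) by (unfold Cminus, Cplus, Copp; cbn; f_equal; ring).
  assert (Hm : Cmod ((u, (s + h)%R) - (u, s)) < d).
  { rewrite E0. unfold Cmod; cbn [fst snd]. replace (0 ^ 2 + h ^ 2) with (Rsqr h) by (unfold Rsqr; ring).
    rewrite sqrt_Rsqr_abs. exact Hhd. }
  destruct (H _ Hm) as [Ha Hb]. rewrite E0 in Ha. apply (f_equal Im) in Ha.
  replace (Im (f (u, (s + h)%R) - f (u, s))) with (Im (f (u, s + h)) - Im (f (u, s))) in Ha by reflexivity.
  rewrite Ha. replace (Im ((0, h) * g (u, (s + h)%R))) with (h * Re (g (u, s + h))).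
  - rewrite <- H2. replace (h * Re (g (u, s + h)) / h) with (Re (g (u, s + h))) by (field; exact Hh). exact Hb.
  - destruct (g (u, s + h)) as [p q]. cbn. ring.
Qed.

(** kk'(0) = 1, so Re kk' > 1/2 near 0 and Im kk increases along upward vertical segments starting
    on the real axis, where it is 0. Thus Im x >= 0 would force Im (kk x) >= 0. *)
Lemma kk_sign : cnbhs 0 (fun x => Im (kk x) < 0 -> Im x < 0).
Proof.
  assert (P1 := polyg_h1). assert (P2 := polyg_h2). assert (D1 := polyg_dcoef _ P1). assert (D2 := polyg_dcoef _ P2).
  assert (H01 : Cmod 0 < 1) by (rewrite Cmod_0; lra).
  set (F := PS h1). set (H := PS h2). set (F' := PS (dcoef h1)). set (H' := PS (dcoef h2)).
  set (k' := fun x => (H x ^ 3 / F x ^ 3 + x * ((3 * H x ^ 2 * H' x * F x ^ 3 - H x ^ 3 * (3 * F x ^ 2 * F' x)) / (F x ^ 3) ^ 2))%C).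
  assert (CF : forall z, Cmod z < 1 -> ccont F z) by (intros z Hz; eapply cderiv_ccont, PS_deriv; assumption).
  assert (F0 : F 0 = 1) by (unfold F; rewrite PS_0 by exact P1; reflexivity).
  assert (H0 : H 0 = 1) by (unfold H; rewrite PS_0 by exact P2; reflexivity).
  assert (HFn : F 0 <> 0) by (rewrite F0; apply C1_neq0).
  assert (Hk : cnbhs 0 (fun x => cderiv kk x (k' x))).
  { generalize (filter_and _ _ (ccont_neq0 F 0 (CF 0 H01) HFn) (ccont_mod_lt (fun x => x) 0 1 (ccont_id 0) H01)).
    apply filter_imp. intros z [Hz1 Hz2]. eapply cderiv_val.
    - apply (cderiv_mult (fun x => x) (fun x => H x ^ 3 / F x ^ 3)%C); [apply cderiv_id|].
      apply (cderiv_div (fun x => H x ^ 3)%C (fun x => F x ^ 3)%C); [now apply Cpow_nz| |].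
      + apply (cderiv_pow H). apply PS_deriv; assumption.
      + apply (cderiv_pow F). apply PS_deriv; assumption.
    - unfold k', F', H'. cbn [INR pred]. rewrite !RtoC_plus. field. exact Hz1. }
  assert (Ck : ccont k' 0).
  { assert (CH : ccont H 0) by (eapply cderiv_ccont, PS_deriv; assumption).
    assert (CH' : ccont H' 0) by (eapply cderiv_ccont, PS_deriv; assumption).
    assert (CF' : ccont F' 0) by (eapply cderiv_ccont, PS_deriv; assumption).
    assert (CF0 := CF 0 H01). unfold k'.
    apply ccont_plus; [|apply ccont_mult; [apply ccont_id|]].
    - apply ccont_div; [now apply Cpow_nz|apply ccont_pow, CH|apply ccont_pow, CF0].
    - apply ccont_div; [now apply Cpow_nz, Cpow_nz| |apply ccont_pow, ccont_pow, CF0].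
      apply ccont_minus.
      + apply ccont_mult; [|apply ccont_pow, CF0]. apply ccont_mult; [|exact CH'].
        apply ccont_mult; [apply ccont_const|apply ccont_pow, CH].
      + apply ccont_mult; [apply ccont_pow, CH|]. apply ccont_mult; [|exact CF'].
        apply ccont_mult; [apply ccont_const|apply ccont_pow, CF0]. }
  assert (k0 : k' 0 = 1).
  { unfold k'. rewrite F0, H0, Cmult_0_l. field. }
  assert (Hhalf : 0 < 1 / 2) by lra. assert (Hpos := clim_re k' _ (1 / 2) Hhalf Ck). rewrite k0 in Hpos.
  destruct (filter_and _ _ (filter_and _ _ Hk Hpos) (ccont_mod_lt (fun x => x) 0 1 (ccont_id 0) H01)) as [d [Hd HH]].
  exists d. split; [exact Hd|]. intros [u v] Hx Him. cbn [Im snd].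
  replace (Cminus (u, v) (RtoC 0)) with ((u, v) : C) in Hx by (unfold Cminus, Cplus, Copp, RtoC; cbn; f_equal; ring).
  apply Rnot_le_lt. intros Hv.
  assert (Hin : forall s, 0 <= s <= v -> Cmod ((u, s) - 0) < d).
  { intros s Hs. eapply Rle_lt_trans; [|exact Hx]. unfold Cmod; cbn [fst snd Cminus Cplus Copp RtoC].
    apply sqrt_le_1_alt. nra. }
  assert (Hu1 : Rabs u < 1).
  { destruct (HH _ (Hin 0 ltac:(lra))) as [_ H1]. eapply Rle_lt_trans; [|exact H1]. apply (re_le_Cmod (u, 0)). }
  assert (Hk0 := kk_real u Hu1). change (RtoC u) with ((u, 0) : C) in Hk0.
  destruct (Req_dec v 0) as [E|E]; [subst v; lra|].
  destruct (MVT_cor2 (fun s => Im (kk (u, s))) (fun s => Re (k' (u, s))) 0 v) as [c [Hc Hc2]]; [lra| |].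
  - intros s Hs. apply cderiv_vertical. apply HH. now apply Hin.
  - rewrite Hk0 in Hc. destruct (HH _ (Hin c ltac:(lra))) as [[_ H1] _]. cbn [Re RtoC fst] in H1. apply Rabs_def2 in H1. nra.
Qed.

(* A real value of [xf] would make the cube of [wf] real, i.e. put [t] on a geodesic through
   [rho] bounding the six triangles there. *)
Lemma xf_not_real (t : C) : fund_domain t -> Om t -> Rel t -> Im (xf t) <> 0.
Proof.
  intros HF HO HRel E. assert (H := wf_cube t HO HRel). assert (HI := wf_cube_Im t HF).
  destruct E6_rho as [R0 [HR0 ER]]. rewrite ER in H. apply (f_equal Im) in H.
  assert (Ex : xf t = RtoC (Re (xf t))) by (destruct (xf t); cbn in *; now subst).
  assert (Hk := kk_real (Re (xf t))). rewrite <- Ex in Hk.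
  assert (Hx : Rabs (Re (xf t)) < 1) by (eapply Rle_lt_trans; [apply re_le_Cmod|apply HO]). specialize (Hk Hx).
  rewrite <- RtoC_pow, <- RtoC_mult in H.
  replace (Im (wf t ^ 3 * RtoC R0)) with (Im (wf t ^ 3) * R0) in H by (destruct (wf t ^ 3)%C; cbn; ring).
  replace (Im (RtoC (27 * Z0 ^ 3) * kk (xf t))) with (27 * Z0 ^ 3 * Im (kk (xf t))) in H by (destruct (kk (xf t)); cbn; ring).
  rewrite Hk in H. nra.
Qed.

(** w^3 is a positive multiple of kk(x) and has negative imaginary part on the domain; near x = 0
    that sign passes to x. *)
Lemma xf_Im_near_rho : cnbhs rho (fun t => fund_domain t -> Om t -> Rel t -> Im (xf t) < 0).
Proof.
  assert (Hc := xf_cont rho rho_Im E6_rho_neq0). assert (Hs := kk_sign). rewrite <- xf_rho in Hs.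
  generalize (ccont_nbhs xf rho _ Hc Hs). apply filter_imp. intros t Ht HF HO HRel. apply Ht.
  assert (H := wf_cube t HO HRel). assert (HI := wf_cube_Im t HF).
  destruct E6_rho as [R0 [HR0 ER]]. rewrite ER in H. apply (f_equal Im) in H.
  rewrite <- RtoC_pow, <- RtoC_mult in H.
  replace (Im (wf t ^ 3 * RtoC R0)) with (Im (wf t ^ 3) * R0) in H by (destruct (wf t ^ 3)%C; cbn; ring).
  replace (Im (RtoC (27 * Z0 ^ 3) * kk (xf t))) with (27 * Z0 ^ 3 * Im (kk (xf t))) in H by (destruct (kk (xf t)); cbn; ring).
  assert (HZ := pow_lt Z0 3 Z0_pos). nra.
Qed.


(** * Principal cube roots *)

Lemma ccont_R_comp (p : C -> R) (f : R -> R) (z : C) : continuity_pt f (p z) ->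
  ccont (fun w => RtoC (p w)) z -> ccont (fun w => RtoC (f (p w))) z.
Proof.
  intros Hf Hp eps He. destruct (Hf eps He) as [d [Hd H]].
  generalize (Hp d Hd). apply filter_imp. intros w Hw.
  rewrite <- RtoC_minus, Cmod_R in *. destruct (Req_dec (p w) (p z)) as [E|E].
  - rewrite E, Rminus_diag, Rabs_R0. exact He.
  - apply H. split; [|exact Hw]. split; [exact I|]. now apply not_eq_sym.
Qed.

Lemma ccont_Re (z : C) : ccont (fun w => RtoC (Re w)) z.
Proof.
  intros eps He. exists eps. split; [exact He|]. intros w Hw. rewrite <- RtoC_minus, Cmod_R.
  eapply Rle_lt_trans; [apply (re_le_Cmod (w - z))|exact Hw].
Qed.

Lemma ccont_Im (z : C) : ccont (fun w => RtoC (Im w)) z.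
Proof.
  intros eps He. exists eps. split; [exact He|]. intros w Hw. rewrite <- RtoC_minus, Cmod_R.
  eapply Rle_lt_trans; [apply (im_le_Cmod (w - z))|exact Hw].
Qed.

Lemma ccont_Cmod (z : C) : ccont (fun w => RtoC (Cmod w)) z.
Proof.
  intros eps He. exists eps. split; [exact He|]. intros w Hw. rewrite <- RtoC_minus, Cmod_R.
  eapply Rle_lt_trans; [|exact Hw]. apply Rabs_le. split.
  - assert (H := Cmod_triangle w (- (w - z))). rewrite Cmod_opp in H.
    replace (w + - (w - z))%C with z in H by ring. lra.
  - assert (H := Cmod_triangle (w - z) z). replace (w - z + z)%C with w in H by ring. lra.
Qed.

(* [0 < Cmod z + Re z] says that [z] is off the cut (-oo, 0]. *)
Lemma Carg_slit (z : C) : 0 < Cmod z + Re z -> Carg z = 2 * atan (Im z / (Cmod z + Re z)).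
Proof.
  intros H. unfold Carg. destruct (Req_EM_T (Im z) 0) as [E|E]; [|reflexivity].
  rewrite E. unfold Rdiv. rewrite Rmult_0_l, atan_0, Rmult_0_r.
  destruct (Rlt_dec (Re z) 0) as [L|L]; [exfalso|reflexivity].
  assert (E2 := Cmod2_alt z). rewrite E in E2. nra.
Qed.

Lemma slit_Im (z : C) : Im z <> 0 -> 0 < Cmod z + Re z.
Proof.
  intros H. assert (E := Cmod2_alt z). assert (H0 := Cmod_ge_0 z).
  assert (0 < Im z ^ 2) by (assert (H1 := pow2_gt_0 _ H); exact H1). nra.
Qed.

Lemma slit_nbhs (z : C) : 0 < Cmod z + Re z -> cnbhs z (fun w => 0 < Cmod w + Re w).
Proof.
  intros H. assert (Hc := ccont_plus _ _ z (ccont_Cmod z) (ccont_Re z)).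
  generalize (Hc _ H). apply filter_imp. intros w Hw.
  rewrite <- !RtoC_plus, <- RtoC_minus, Cmod_R in Hw. apply Rabs_def2 in Hw. lra.
Qed.

Lemma slit_neq0 (z : C) : 0 < Cmod z + Re z -> z <> 0.
Proof. intros H E. rewrite E, Cmod_0 in H. cbn in H. lra. Qed.

(** Off the cut one half-angle formula covers both cases of [Carg], including the positive axis,
    where 1 - J(rho) = 1 lies. *)
Lemma Croot_cont (n : nat) (z : C) : (0 < n)%nat -> 0 < Cmod z + Re z -> ccont (Croot n) z.
Proof.
  intros Hn Hz. assert (Hz0 := slit_neq0 z Hz). assert (Hm := proj1 (Cmod_gt_0 z) Hz0).
  assert (Hnr : RtoC (INR n) <> 0) by now apply INR_neq0.
  set (f := fun w => Cexp ((RtoC (ln (Cmod w)) + Ci * RtoC (2 * atan (Im w / (Cmod w + Re w)))) / RtoC (INR n))%C).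
  assert (E : forall w, 0 < Cmod w + Re w -> f w = Croot n w).
  { intros w Hw. unfold f, Croot. destruct (Ceq_dec w 0) as [E|_]; [now apply slit_neq0 in Hw|].
    f_equal. f_equal. unfold Clog. rewrite Carg_slit by exact Hw. unfold Ci, Cplus, Cmult, RtoC; cbn. f_equal; ring. }
  unfold ccont. rewrite <- E by exact Hz. apply clim_ext with f.
  - generalize (slit_nbhs z Hz). apply filter_imp. exact E.
  - change (ccont f z). unfold f. apply (ccont_comp Cexp); [|apply Cexp_cont].
    apply ccont_div; [exact Hnr| |apply ccont_const].
    apply ccont_plus.
    + apply (ccont_R_comp Cmod ln); [|apply ccont_Cmod]. apply derivable_continuous_pt. exists (/ Cmod z). now apply derivable_pt_lim_ln.
    + apply ccont_mult; [apply ccont_const|].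
      apply (ccont_R_comp (fun w => Im w / (Cmod w + Re w)) (fun x => 2 * atan x)).
      * apply derivable_continuous_pt. apply derivable_pt_scal, derivable_pt_atan.
      * assert (HN : RtoC (Cmod z + Re z) <> 0) by (intros E'; apply RtoC_inj in E'; lra).
        apply clim_ext with (fun w => RtoC (Im w) / RtoC (Cmod w + Re w))%C.
        -- generalize (slit_nbhs z Hz). apply filter_imp. intros w Hw. rewrite RtoC_div by lra. reflexivity.
        -- rewrite RtoC_div by lra. apply clim_div; [exact HN|apply ccont_Im|].
           rewrite RtoC_plus. apply clim_ext_all with (fun w => RtoC (Cmod w) + RtoC (Re w))%C; [intros; now rewrite RtoC_plus|].
           apply clim_plus; [apply ccont_Cmod|apply ccont_Re].
Qed.

Lemma Croot_pow (n : nat) (z : C) : (0 < n)%nat -> z <> 0 -> (Croot n z ^ n)%C = z.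
Proof.
  intros Hn Hz. unfold Croot. destruct (Ceq_dec z 0) as [E|_]; [contradiction|].
  rewrite Cexp_pow. replace (RtoC (INR n) * (Clog z / RtoC (INR n)))%C with (Clog z) by (field; now apply INR_neq0).
  symmetry. now apply Carg_correct.
Qed.

Lemma Croot_neq0 (n : nat) (z : C) : z <> 0 -> Croot n z <> 0.
Proof. intros Hz. unfold Croot. destruct (Ceq_dec z 0) as [E|_]; [contradiction|apply Cexp_neq0]. Qed.

Lemma Croot_1 (n : nat) : (0 < n)%nat -> Croot n 1 = 1.
Proof.
  intros Hn. unfold Croot. destruct (Ceq_dec 1 0) as [E|_]; [now apply C1_neq0 in E|].
  unfold Clog. rewrite Cmod_1, ln_1, Carg_slit by (rewrite Cmod_1; cbn; lra).
  cbn [Im RtoC snd]. unfold Rdiv. rewrite Rmult_0_l, atan_0, Rmult_0_r.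
  replace ((0, 0) / RtoC (INR n))%C with (RtoC 0) by (change (0, 0) with (RtoC 0); field; now apply INR_neq0).
  apply Cexp_0.
Qed.

(* As - rho^2 = e^(i PI / 3), the right-hand side describes the sector 0 < arg < PI / 3. *)
Lemma Croot3_sector (z : C) : 0 < Im z -> exists p q : R, 0 < p /\ 0 < q /\ Croot 3 z = (RtoC p - RtoC q * rho ^ 2)%C.
Proof.
  intros Hz. assert (Hs := slit_Im z ltac:(lra)). assert (Hz0 := slit_neq0 z Hs).
  assert (Harg : 0 < Carg z < PI).
  { rewrite Carg_slit by exact Hs. assert (Hb := atan_bound (Im z / (Cmod z + Re z))).
    assert (H : 0 < atan (Im z / (Cmod z + Re z))) by (rewrite <- atan_0; apply atan_increasing; now apply Rdiv_lt_0_compat). lra. }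
  unfold Croot. destruct (Ceq_dec z 0) as [E|_]; [contradiction|].
  assert (E3 : (Clog z / RtoC (INR 3))%C = (ln (Cmod z) / 3, Carg z / 3)).
  { replace (INR 3) with 3 by (cbn; ring). unfold Cdiv. rewrite <- RtoC_inv by lra.
    unfold Clog, Cmult, RtoC; cbn. f_equal; field. }
  rewrite E3. unfold Cexp; cbn [Re Im fst snd]. set (r := exp (ln (Cmod z) / 3)). set (th := Carg z / 3).
  assert (Hr : 0 < r) by apply exp_pos. assert (Hth : 0 < th < PI / 3) by (unfold th; lra).
  assert (Hs0 := sqrt3_pos). assert (S3 := sqrt3_sq). assert (HP := PI_RGT_0).
  assert (H1 : 0 < sin th) by (apply sin_gt_0; lra).
  assert (H2 : 0 < sin (PI / 3 - th)) by (apply sin_gt_0; lra).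
  rewrite sin_minus, sin_PI3, cos_PI3 in H2.
  exists (2 / sqrt 3 * (r * (sqrt 3 / 2 * cos th - 1 / 2 * sin th))), (2 / sqrt 3 * (r * sin th)).
  assert (0 < 2 / sqrt 3) by (apply Rdiv_lt_0_compat; lra).
  split; [|split]; [apply Rmult_lt_0_compat; [assumption|apply Rmult_lt_0_compat; assumption]..|].
  replace (rho ^ 2)%C with (rho * rho)%C by ring. rewrite rho_quad, rho_val.
  unfold Cminus, Cplus, Copp, Cmult, RtoC; cbn. f_equal; field; lra.
Qed.

Lemma cube_root_of_1 (u : C) : (u ^ 3)%C = 1 -> u = 1 \/ Re u = - (1 / 2).
Proof.
  intros H. destruct (Ceq_dec u 1) as [E|E]; [now left|right].
  assert (N : (u - 1)%C <> 0) by (intros E'; apply E; replace u with (u - 1 + 1)%C by ring; rewrite E'; ring).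
  assert (Q : (u * u + u + 1)%C = 0).
  { replace (u * u + u + 1)%C with ((u ^ 3 - 1) / (u - 1))%C by (field; exact N). rewrite H. field. exact N. }
  destruct u as [p q]. unfold Cplus, Cmult, RtoC in Q; cbn in Q. injection Q as Q1 Q2. cbn.
  destruct (Req_dec q 0) as [E0|E0]; [subst; nra|]. assert (q * (2 * p + 1) = 0) by lra.
  apply Rmult_integral in H0. destruct H0; [contradiction|lra].
Qed.

(** A nontrivial cube root of 1 has real part -1/2, hence distance at least 3/2 from 1. *)
Lemma cube_root_close (u v : C) : (u ^ 3)%C = 1 -> (v ^ 3)%C = 1 -> Cmod (u - v) < 1 -> u = v.
Proof.
  intros Hu Hv H.
  assert (Hv0 : v <> 0) by (intros E; rewrite E in Hv; apply C1_neq0; rewrite <- Hv; ring).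
  assert (Hvm : Cmod v = 1).
  { apply (f_equal Cmod) in Hv. rewrite Cmod_pow, Cmod_1 in Hv. assert (H0 := Cmod_ge_0 v).
    assert ((Cmod v - 1) * (Cmod v ^ 2 + Cmod v + 1) = 0) by (ring_simplify; lra).
    apply Rmult_integral in H1. destruct H1 as [H1|H1]; [lra|nra]. }
  destruct (cube_root_of_1 (u / v)) as [E|E].
  - replace ((u / v) ^ 3)%C with (u ^ 3 / v ^ 3)%C by (field; exact Hv0). rewrite Hu, Hv. field.
  - replace u with (u / v * v)%C by (field; exact Hv0). rewrite E. ring.
  - exfalso. replace (u - v)%C with (v * (u / v - 1))%C in H by (field; exact Hv0).
    rewrite Cmod_mult, Hvm, Rmult_1_l in H. assert (H1 := re_le_Cmod (u / v - 1)).
    replace (Re (u / v - 1)) with (Re (u / v) - 1) in H1 by reflexivity.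
    rewrite E, Rabs_left in H1; lra.
Qed.

(** [a] and [b] lie in a common sector of opening PI / 3, and [sg] has argument below arctan (1/2) <
    PI / 6 in absolute value, so a / (b sg) has argument below PI / 2. *)
Lemma sector_ratio (p q r s s1 s2' : R) (a b sg : C) : 0 < p -> 0 < q -> 0 < r -> 0 < s -> 2 * Rabs s2' < s1 ->
  a = (RtoC p - RtoC q * rho ^ 2)%C -> b = (RtoC r - RtoC s * rho ^ 2)%C -> sg = (s1, s2') ->
  0 < Re (a * Cconj (b * sg)).
Proof.
  intros Hp Hq Hr Hs H2 -> -> ->. replace (rho ^ 2)%C with (rho * rho)%C by ring. rewrite rho_quad, rho_val.
  assert (H3 := sqrt3_sq). assert (Hs3 := sqrt3_pos).
  set (P := p * r + q * s + (p * s + q * r) / 2). set (Qq := sqrt 3 / 2 * (q * r - p * s)).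
  assert (Hpr : 0 < p * r) by now apply Rmult_lt_0_compat. assert (Hqs : 0 < q * s) by now apply Rmult_lt_0_compat.
  assert (Hps : 0 < p * s) by now apply Rmult_lt_0_compat. assert (Hqr : 0 < q * r) by now apply Rmult_lt_0_compat.
  replace (Re _) with (P * s1 + Qq * s2').
  - assert (HQ : Rabs Qq <= 2 * P).
    { assert (sqrt 3 < 2) by nra. unfold Qq. rewrite Rabs_mult, (Rabs_right (sqrt 3 / 2)) by lra.
      assert (Rabs (q * r - p * s) <= q * r + p * s) by (apply Rabs_le; lra).
      assert (0 <= Rabs (q * r - p * s)) by apply Rabs_pos. unfold P. nra. }
    assert (HP : 0 < P) by (unfold P; lra).
    assert (Rabs (Qq * s2') < P * s1).
    { rewrite Rabs_mult. assert (Rabs Qq * Rabs s2' <= 2 * P * Rabs s2') by (apply Rmult_le_compat_r; [apply Rabs_pos|exact HQ]). nra. }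
    apply Rabs_def2 in H. lra.
  - unfold P, Qq, Cconj, Cminus, Cplus, Copp, Cmult, RtoC; cbn. 
    match goal with |- ?l = ?r => assert (E : l - r = (3 - sqrt 3 * sqrt 3) * (q * s * s1 / 4)) by field end.
    rewrite H3 in E. lra.
Qed.


(** * The branch of the cube root *)

Definition cbrt_ratio (t : C) : C := (Croot 3 (Jinv t) / Croot 3 (1 - Jinv t))%C.
Definition Kf (t : C) : C := (kappa * Zf t ^ 2 * E4 t / E6 t)%C.
(** Principal value over predicted value: a continuous function with values among the cube roots of
    1, to be shown equal to 1. *)
Definition gf (t : C) : C := (cbrt_ratio t / Kf t)%C.

Lemma Im_1minus (z : C) : Im (1 - z) = - Im z.
Proof. destruct z. cbn. ring. Qed.

Lemma xf_neq1 (t : C) : Cmod (xf t) < 1 -> (xf t - 1)%C <> 0.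
Proof.
  intros H E. assert (E' : xf t = 1) by (replace (xf t) with (xf t - 1 + 1)%C by ring; rewrite E; ring).
  rewrite E', Cmod_1 in H. lra.
Qed.

Lemma Jinv_xf (t : C) : Om t -> Jinv t = (xf t / (xf t - 1))%C.
Proof.
  intros [Ht [HR Hx]]. assert (HD := Delta_neq0 t Ht). unfold Delta in HD. unfold Jinv, xf. field.
  repeat split; assumption.
Qed.

Lemma Im_Jinv (t : C) : Om t -> exists m, 0 < m /\ Im (Jinv t) = - Im (xf t) * m.
Proof.
  intros HO. assert (N := xf_neq1 t (proj2 (proj2 HO))). rewrite Jinv_xf by exact HO.
  assert (Hm := proj1 (Cmod_gt_0 _) N). assert (Hm2 := pow_lt _ 2 Hm). rewrite Cmod2_alt in Hm2.
  exists (/ (Re (xf t - 1) ^ 2 + Im (xf t - 1) ^ 2)). split; [now apply Rinv_0_lt_compat|].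
  destruct (xf t) as [u v]. cbn in *. field. lra.
Qed.

Lemma Jinv_cont (t : C) : Om t -> ccont Jinv t.
Proof.
  intros [Ht [HR _]]. assert (HD := Delta_neq0 t Ht). unfold Delta in HD.
  destruct (E_cont t Ht) as [_ [C4 C6]]. unfold Jinv.
  apply ccont_div; [exact HD|now apply ccont_pow|]. apply ccont_minus; now apply ccont_pow.
Qed.

Lemma Jinv_off_reals (t : C) : fund_domain t -> Om t -> Rel t -> Im (Jinv t) <> 0.
Proof.
  intros HF HO HRel. destruct (Im_Jinv t HO) as [m [Hm E]]. rewrite E.
  assert (H := xf_not_real t HF HO HRel). intros E0. apply Rmult_integral in E0. lra.
Qed.

Lemma Zf_cont (t : C) : Om t -> ccont Zf t.
Proof. intros H. eapply cderiv_ccont, Zf_deriv, H. Qed.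

Lemma kappa_neq0 : kappa <> 0.
Proof.
  destruct kappa_val as [k0 [Hk ->]]. apply Cmult_neq_0; [|now apply Cpow_nz, rho_neq0].
  rewrite <- RtoC_opp. intros E. apply RtoC_inj in E. lra.
Qed.

Lemma good_neq0 (t : C) : fund_domain t -> Om t -> Rel t -> E4 t <> 0 /\ Jinv t <> 0 /\ (1 - Jinv t)%C <> 0 /\ Kf t <> 0.
Proof.
  intros HF HO HRel. assert (HJ := Jinv_off_reals t HF HO HRel).
  assert (H4 : E4 t <> 0).
  { intros E. apply HJ. unfold Jinv. rewrite E. replace (0 ^ 3)%C with (RtoC 0) by ring. unfold Cdiv. rewrite Cmult_0_l. reflexivity. }
  repeat split; [exact H4| | |].
  - intros E. apply HJ. rewrite E. reflexivity.
  - intros E. apply HJ. replace (Jinv t) with (1 - (1 - Jinv t))%C by ring. rewrite E. cbn. ring.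
  - unfold Kf, Cdiv. apply Cmult_neq_0; [apply Cmult_neq_0; [apply Cmult_neq_0|exact H4]|].
    + apply kappa_neq0.
    + apply Cpow_nz, HRel.
    + apply Cmod_gt_0. rewrite Cmod_inv by apply HO. apply Rinv_0_lt_compat, Cmod_gt_0, HO.
Qed.

(** As J / (1 - J) = - x, this makes [Kf] one of the admissible cube roots. It combines Z^6 E6(rho)
    = Z0^6 E6, [kappa_cube] and 1728 PI^6 Z0^6 = 1. *)
Lemma Kf_cube (t : C) : Om t -> Rel t -> (Kf t ^ 3)%C = (- xf t)%C.
Proof.
  intros HO HRel. destruct HRel as [_ [_ [E3 _]]]. assert (HR := proj1 (proj2 HO)). assert (HR0 := E6_rho_neq0).
  unfold Kf, xf.
  replace ((kappa * Zf t ^ 2 * E4 t / E6 t) ^ 3)%C with (kappa ^ 3 * (Zf t ^ 6 * E6 rho) * E4 t ^ 3 / (E6 t ^ 3 * E6 rho))%C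
    by (field; split; assumption).
  rewrite E3, kappa_cube.
  assert (HZ : (1728 * RtoC PI ^ 6 * RtoC Z0 ^ 6)%C = 1).
  { rewrite <- !RtoC_pow, <- !RtoC_mult. f_equal. unfold Z0. assert (S3 := sqrt3_sq). assert (Hs := sqrt3_pos). assert (HP := PI_RGT_0).
    replace (1728 * PI ^ 6 * (/ (2 * sqrt 3 * PI)) ^ 6) with (27 / ((sqrt 3 * sqrt 3) * (sqrt 3 * sqrt 3) * (sqrt 3 * sqrt 3)))
      by (field; split; lra). rewrite S3. field. }
  replace (- (1728) * RtoC PI ^ 6 * E6 rho * (RtoC Z0 ^ 6 * E6 t) * E4 t ^ 3 / (E6 t ^ 3 * E6 rho))%C
    with (- (1728 * RtoC PI ^ 6 * RtoC Z0 ^ 6) * E4 t ^ 3 / E6 t ^ 2)%C by (field; split; assumption).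
  rewrite HZ. field. exact HR.
Qed.

Lemma gf_cube (t : C) : fund_domain t -> Om t -> Rel t -> (gf t ^ 3)%C = 1.
Proof.
  intros HF HO HRel. destruct (good_neq0 t HF HO HRel) as [H4 [HJ [HJ1 HK]]].
  assert (N1 := Croot_neq0 3 _ HJ1). assert (N := xf_neq1 t (proj2 (proj2 HO))).
  unfold gf, cbrt_ratio.
  replace ((Croot 3 (Jinv t) / Croot 3 (1 - Jinv t) / Kf t) ^ 3)%C
    with (Croot 3 (Jinv t) ^ 3 / (Croot 3 (1 - Jinv t) ^ 3 * Kf t ^ 3))%C by (field; split; assumption).
  rewrite !Croot_pow by (lia || assumption). rewrite Kf_cube by assumption.
  assert (Hx : xf t <> 0).
  { intros E. apply HJ. rewrite Jinv_xf, E by assumption. unfold Cdiv. apply Cmult_0_l. }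
  rewrite Jinv_xf in * by assumption. field. repeat split; try assumption.
  intros E. apply C1_neq0. replace (RtoC 1) with (- (xf t - 1 - xf t))%C by ring. rewrite E. ring.
Qed.

Lemma gf_cont (t : C) : fund_domain t -> Om t -> Rel t -> ccont gf t.
Proof.
  intros HF HO HRel. destruct (good_neq0 t HF HO HRel) as [H4 [HJ [HJ1 HK]]].
  assert (HI := Jinv_off_reals t HF HO HRel).
  destruct (E_cont t (proj1 HO)) as [_ [C4 C6]].
  assert (CJ := Jinv_cont t HO). unfold gf, cbrt_ratio.
  apply ccont_div; [exact HK| |].
  - apply ccont_div; [now apply Croot_neq0| |].
    + apply (ccont_comp (Croot 3) Jinv); [exact CJ|]. apply Croot_cont; [lia|now apply slit_Im].
    + apply (ccont_comp (Croot 3) (fun w => 1 - Jinv w)%C); [apply ccont_minus; [apply ccont_const|exact CJ]|].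
      apply Croot_cont; [lia|]. apply slit_Im. rewrite Im_1minus. lra.
  - unfold Kf. apply ccont_div; [apply HO| |exact C6]. apply ccont_mult; [|exact C4].
    apply ccont_mult; [apply ccont_const|apply ccont_pow, Zf_cont, HO].
Qed.

(* Up to the factor [A - B rho] of [wf_fund], the function [Kf] is nearly a positive multiple of
   - rho^2 = e^(i PI / 3) close to [rho]. *)
Definition sgf (t : C) : C :=
  (Croot 3 (1 - Jinv t) * ((t - Cconj rho) * (tpi * kappa * Zf t ^ 2 * Z2f t / (E6 t * Hf t)))
    / ((t - Cconj rho) * Cconj (t - Cconj rho)) / rho ^ 2)%C.

Lemma Jinv_rho : Jinv rho = 0.
Proof. unfold Jinv. rewrite E4_rho. replace (0 ^ 3)%C with (RtoC 0) by ring. unfold Cdiv. apply Cmult_0_l. Qed.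

(** The phases cancel: i from rho - conj rho, i from [tpi], and -1 from kappa / rho^2. *)
Lemma sgf_rho : exists s0 : R, 0 < s0 /\ sgf rho = RtoC s0.
Proof.
  destruct kappa_val as [k0 [Hk Ek]].
  exists (2 * PI * sqrt 3 * Z0 ^ 2 * k0 / 9). assert (HP := PI_RGT_0). assert (Hs := sqrt3_pos). assert (HZ := pow_lt _ 2 Z0_pos).
  split.
  - apply Rdiv_lt_0_compat; [|lra]. repeat (apply Rmult_lt_0_compat; [|assumption]). lra.
  - unfold sgf. rewrite Jinv_rho, rho_conj_diff, Zf_rho, Z2f_rho, Hf_rho, Ek.
    replace (1 - 0)%C with (RtoC 1) by ring. rewrite Croot_1 by lia.
    assert (S3 := sqrt3_sq). assert (HR := E6_rho_neq0). assert (Hr := rho_neq0).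
    assert (Ec : Cconj (Ci * RtoC (sqrt 3)) = (- Ci * RtoC (sqrt 3))%C)
      by (unfold Cconj, Ci, Copp, Cmult, RtoC; cbn; f_equal; ring).
    rewrite Ec. replace (Ci * RtoC (sqrt 3) * (- Ci * RtoC (sqrt 3)))%C with (RtoC 3).
    2:{ replace (Ci * RtoC (sqrt 3) * (- Ci * RtoC (sqrt 3)))%C with (- (Ci * Ci) * (RtoC (sqrt 3) * RtoC (sqrt 3)))%C by ring.
        rewrite Ci_sq, <- RtoC_mult, S3. ring. }
    unfold tpi. rewrite RtoC_div, !RtoC_mult, RtoC_pow by lra.
    replace (1 * (Ci * RtoC (sqrt 3) * (2 * RtoC PI * Ci * (- RtoC k0 * rho ^ 2) * RtoC Z0 ^ 2 * (E6 rho / 3) / (E6 rho * 1))) / 3 / rho ^ 2)%C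
      with (- (Ci * Ci) * (2 * RtoC PI * RtoC (sqrt 3) * RtoC Z0 ^ 2 * RtoC k0 / 9))%C by (field; split; assumption).
    rewrite Ci_sq. field.
Qed.

Lemma sgf_cont : ccont sgf rho.
Proof.
  assert (HO := Om_rho). assert (Hd := rho_conj_neq rho rho_Im).
  destruct (E_cont rho rho_Im) as [_ [C4 C6]].
  assert (HH : Hf rho <> 0) by (rewrite Hf_rho; apply C1_neq0).
  assert (CH : ccont Hf rho) by (eapply cderiv_ccont, Hf_deriv, HO).
  assert (CZ2 : ccont Z2f rho) by (eapply cderiv_ccont, Z2f_deriv, HO).
  assert (Cd : ccont (fun t => t - Cconj rho)%C rho) by (apply ccont_minus; [apply ccont_id|apply ccont_const]).
  assert (Cdc : ccont (fun t => Cconj (t - Cconj rho)) rho) by now apply clim_conj.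
  assert (Hdc : Cconj (rho - Cconj rho) <> 0).
  { intros E. apply Hd. apply Cmod_eq_0. rewrite <- Cmod_conj, E. apply Cmod_0. }
  unfold sgf. apply ccont_div; [apply Cpow_nz, rho_neq0| |apply ccont_const].
  apply ccont_div; [now apply Cmult_neq_0| |now apply ccont_mult].
  apply ccont_mult.
  - apply (ccont_comp (Croot 3) (fun t => 1 - Jinv t)%C).
    + apply ccont_minus; [apply ccont_const|now apply Jinv_cont].
    + apply Croot_cont; [lia|]. rewrite Jinv_rho. replace (1 - 0)%C with (RtoC 1) by ring. rewrite Cmod_1. cbn. lra.
  - apply ccont_mult; [exact Cd|].
    apply ccont_div; [apply Cmult_neq_0; [apply HO|exact HH]| |now apply ccont_mult].
    apply ccont_mult; [|exact CZ2]. apply ccont_mult; [apply ccont_const|apply ccont_pow, Zf_cont, HO].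
Qed.

(** Im J > 0 puts the numerator of [gf] in the sector 0 < arg < PI / 3, and the denominator is a
    point of the same sector times the nearly positive [sgf]. So [gf] has positive real part, unlike
    the nontrivial cube roots of 1. *)
Lemma gf_near_rho : cnbhs rho (fun t => fund_domain t -> Om t -> Rel t -> gf t = 1).
Proof.
  destruct sgf_rho as [s0 [Hs0 Es]]. assert (Cs := sgf_cont).
  (* Within s0 / 3 of s0 one has s1 > 2 s0 / 3 and |s2'| < s0 / 3, the inequality [sector_ratio]
     asks for. *)
  assert (He : 0 < s0 / 3) by lra.
  assert (HH : Hf rho <> 0) by (rewrite Hf_rho; apply C1_neq0).
  assert (CH : ccont Hf rho) by (eapply cderiv_ccont, Hf_deriv, Om_rho).
  generalize (filter_and _ _ (filter_and _ _ (Cs _ He) (ccont_neq0 _ _ CH HH)) xf_Im_near_rho). apply filter_imp.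
  intros t [[H1 H2] H3] HF HO HRel. specialize (H3 HF HO HRel).
  destruct (good_neq0 t HF HO HRel) as [H4 [HJ [HJ1 HK]]].
  assert (HIJ : 0 < Im (Jinv t)) by (destruct (Im_Jinv t HO) as [m [Hm ->]]; nra).
  destruct (Croot3_sector (Jinv t) HIJ) as [p [q [Hp [Hq Ea]]]].
  destruct (wf_fund t (proj1 HO)) as [N [HN [Ew EN]]].
  set (A := Cmod t ^ 2 - 1) in *. set (B := 2 * Re t + 1) in *.
  destruct HF as [Ht [Hre Hmod]].
  assert (HA : 0 < A) by (unfold A; nra).
  assert (HB : 0 < B) by (apply Rabs_def2 in Hre; unfold B; lra).
  assert (HN0 : RtoC N <> 0) by (intros E0; apply RtoC_inj in E0; lra).
  assert (Hr := rho_neq0). assert (Hd := rho_conj_neq t Ht). assert (HR := proj1 (proj2 HO)).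
  assert (N1 := Croot_neq0 3 _ HJ1).
  (* Multiplication by - rho^2 carries A - B rho into the sector, because rho^3 = 1. *)
  set (b := (RtoC B - RtoC A * rho ^ 2)%C).
  assert (Eb : b = (- rho ^ 2 * (RtoC A - RtoC B * rho))%C).
  { unfold b. replace (- rho ^ 2 * (RtoC A - RtoC B * rho))%C with (RtoC B * rho ^ 3 - RtoC A * rho ^ 2)%C by ring.
    rewrite rho_cub. ring. }
  assert (Etw : (t - rho)%C = ((RtoC A - RtoC B * rho) / RtoC N * (t - Cconj rho))%C).
  { rewrite <- Ew. unfold wf. field. exact Hd. }
  assert (EQ : E4 t = (- (tpi * (t - rho) * Z2f t) / Hf t)%C).
  { destruct HRel as [_ [E2' _]]. rewrite <- E2'. unfold Y2f. field. exact H2. }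
  assert (Eden : (Croot 3 (1 - Jinv t) * Kf t)%C = (b * sgf t)%C).
  { unfold sgf, Kf. rewrite <- EN, Eb, EQ, Etw. field. repeat split; assumption. }
  assert (Hbs : (b * sgf t)%C <> 0) by (rewrite <- Eden; now apply Cmult_neq_0).
  assert (Eg : gf t = (Croot 3 (Jinv t) / (b * sgf t))%C).
  { rewrite <- Eden. unfold gf, cbrt_ratio. field. split; assumption. }
  destruct (sgf t) as [s1 s2'] eqn:Esg.
  assert (Hsec : 0 < Re (Croot 3 (Jinv t) * Cconj (b * ((s1, s2') : C)))).
  { rewrite Es in H1.
    assert (Hr1 := Rle_lt_trans _ _ _ (re_le_Cmod _) H1). assert (Hi1 := Rle_lt_trans _ _ _ (im_le_Cmod _) H1).
    cbn in Hr1, Hi1. apply Rabs_def2 in Hr1. rewrite Ropp_0, Rplus_0_r in Hi1.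
    apply (sector_ratio p q B A s1 s2' _ _ (s1, s2')); auto. lra. }
  destruct (cube_root_of_1 (gf t)) as [E|E]; [|exact E|].
  - apply gf_cube; try assumption. now repeat split.
  - exfalso. assert (Ep : Croot 3 (Jinv t) = (gf t * (b * ((s1, s2') : C)))%C) by (rewrite Eg; field; split; [|intros E0; apply Hbs; rewrite E0; ring]; intros E0; apply Hbs; rewrite E0; ring).
    rewrite Ep in Hsec.
    replace (gf t * (b * ((s1, s2') : C)) * Cconj (b * ((s1, s2') : C)))%C
      with (gf t * (b * ((s1, s2') : C) * Cconj (b * ((s1, s2') : C))))%C in Hsec by ring.
    rewrite <- Cmod2_conj in Hsec.
    assert (HM := proj1 (Cmod_gt_0 _) Hbs). assert (HM2 := pow_lt _ 2 HM).
    set (M := Cmod (b * ((s1, s2') : C)) ^ 2) in *.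
    replace (Re (gf t * RtoC M)) with (Re (gf t) * M) in Hsec by (destruct (gf t); cbn; ring).
    rewrite E in Hsec. nra.
Qed.

(** On the connected set reaching towards rho, [gf] is continuous with values in a discrete set,
    hence keeps the value 1 it has near rho. *)
Lemma cbrt_ratio_val (t : C) : C_rho t -> fund_domain t /\ Om t /\ Rel t /\ cbrt_ratio t = Kf t.
Proof.
  intros HC. destruct (C_rho_path t HC _ (filter_and _ _ Rel_near_rho gf_near_rho)) as [B [y [HB [Ht [Hy [[Hinv Hg] Hall]]]]]].
  assert (HO : forall z, B z -> Om z) by (intros z Hz; now apply Hall).
  assert (HRel := Rel_on_connected B y HB Hy HO (proj2 Hinv)).
  assert (HF : forall z, B z -> fund_domain z) by (intros z Hz; now apply Hall).
  assert (Hgy : gf y = 1) by (apply Hg; auto).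
  assert (Hgt : gf t = gf y).
  { apply (connected_const B gf HB); auto. intros z Hz.
    generalize (gf_cont z (HF z Hz) (HO z Hz) (HRel z Hz) 1 Rlt_0_1). apply filter_imp. intros w Hw Hbw.
    apply cube_root_close; [apply gf_cube|apply gf_cube|exact Hw]; auto. }
  repeat split; try apply (HF t Ht); try apply (HO t Ht); try apply (HRel t Ht).
  destruct (good_neq0 t (HF t Ht) (HO t Ht) (HRel t Ht)) as [_ [_ [_ HK]]].
  replace (cbrt_ratio t) with (gf t * Kf t)%C by (unfold gf; field; exact HK). rewrite Hgt, Hgy. ring.
Qed.


(** * The square root of -d, the derivative in J, and the final identity *)

Lemma Croot2_real (x : R) : (exists s, 0 < s /\ Croot 2 (RtoC x) = (0, s)) \/ Im (Croot 2 (RtoC x)) = 0.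
Proof.
  unfold Croot. destruct (Ceq_dec (RtoC x) 0) as [E|E]; [now right|].
  unfold Clog, Carg. cbn [Im Re RtoC fst snd]. destruct (Req_EM_T 0 0) as [_|N]; [|lra].
  replace (INR 2) with 2 by (cbn; ring). unfold Cdiv. rewrite <- RtoC_inv by lra.
  destruct (Rlt_dec x 0) as [L|L].
  - left. exists (exp (ln (Cmod (RtoC x)) / 2)). split; [apply exp_pos|].
    replace ((ln (Cmod (RtoC x)), PI) * RtoC (/ 2))%C with ((ln (Cmod (RtoC x)) / 2, PI / 2) : C)
      by (unfold Cmult, RtoC; cbn; f_equal; field).
    unfold Cexp; cbn [Re Im fst snd]. rewrite cos_PI2, sin_PI2. f_equal; ring.
  - right. unfold Cexp, Cmult, RtoC; cbn. replace (ln (Cmod (x, 0)) * 0 + 0 * / 2) with 0 by ring. rewrite sin_0. ring.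
Qed.

(** For x = j / (j - 1) one has x - 1 = 1 / (j - 1), so dx/dj = - (x - 1)^2. *)
Lemma hyp_deriv_J (t : C) : Om t ->
  C_derive (fun j => hyp2F1 (1 / 12) (7 / 12) (2 / 3) (j / (j - 1)) ^ 2)%C (Jinv t)
  = (2 * Yf t * (PS (dcoef h1) (xf t) * (- (xf t - 1) ^ 2)))%C.
Proof.
  intros HO. assert (N := xf_neq1 t (proj2 (proj2 HO))). assert (EJ := Jinv_xf t HO).
  assert (Ext : (Jinv t / (Jinv t - 1))%C = xf t) by (apply Jinv_ratio; apply HO).
  assert (NJ : (Jinv t - 1)%C <> 0).
  { rewrite EJ. replace (xf t / (xf t - 1) - 1)%C with (/ (xf t - 1))%C by (field; exact N).
    apply Cmod_gt_0. rewrite Cmod_inv by exact N. now apply Rinv_0_lt_compat, Cmod_gt_0. }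
  apply cderiv_C_derive.
  apply cderiv_ext with (fun j => PS h1 (j / (j - 1)) ^ 2)%C.
  - intros j. f_equal. symmetry. rewrite <- !RtoC_div by lra. apply hyp2F1_PS; lra.
  - assert (D : cderiv (fun j => PS h1 (j / (j - 1)))%C (Jinv t) (PS (dcoef h1) (xf t) * (- (xf t - 1) ^ 2))%C).
    { apply (cderiv_comp (PS h1) (fun j => j / (j - 1))%C).
      - rewrite Ext. apply PS_deriv; [apply polyg_h1|apply HO].
      - eapply cderiv_val.
        + apply (cderiv_div (fun j => j) (fun j => j - 1)%C); [exact NJ|apply cderiv_id|].
          apply cderiv_minus; [apply cderiv_id|apply cderiv_const].
        + cbn beta. replace (- (xf t - 1) ^ 2)%C with (- (Jinv t / (Jinv t - 1) - 1) ^ 2)%C by now rewrite Ext.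
          field. exact NJ. }
    eapply cderiv_val; [apply (cderiv_pow (fun j => PS h1 (j / (j - 1)))%C), D|].
    cbn [INR pred]. rewrite RtoC_plus. unfold Yf. rewrite Ext. ring.
Qed.

Theorem theorem1p2 (a b c d : Z) :
  (0 < a)%Z ->
  (- d = b ^ 2 - 4 * a * c)%Z ->
  let sqrt_md : C := Croot 2 (RtoC (IZR (- d))) in
  let tau : C := ((- RtoC (IZR b) + sqrt_md) / (2 * RtoC (IZR a)))%C in
  C_rho tau ->
  let J : C := Jinv tau in
  let Ffun : C -> C := fun j => hyp2F1 (1 / 12) (7 / 12) (2 / 3) (j / (j - 1))%C in
  let F : C := Ffun J in
  let alpha : C := (Ci * eta rho ^ 2 * RtoC (sqrt 3))%C in
  (- ((tau - Cconj rho) / (2 * PI * alpha ^ 2 * RtoC (sqrt 3)))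
   * (Croot 3 J / Croot 3 (1 - J))
   * (RtoC (IZR a) * ((tau - Cconj rho) / sqrt_md) - 1))%C
  = (F ^ 2 * (J / (6 * (1 - J)) + s2 tau / 6)
     + J * C_derive (fun j => Ffun j ^ 2) J)%C.
Proof.
  intros Ha _ sqrt_md tau HC J Ffun F alpha.
  destruct (cbrt_ratio_val tau HC) as [HF [HO [HRel HK]]].
  assert (Ht := proj1 HO). assert (HR := proj1 (proj2 HO)).
  assert (Ha' : 0 < IZR a) by now apply IZR_lt.
  assert (Ha0 : RtoC (IZR a) <> 0) by (intros E; apply RtoC_inj in E; lra).
  assert (Him : Im tau = Im sqrt_md / (2 * IZR a)).
  { unfold tau, Cdiv. rewrite <- RtoC_mult, <- RtoC_inv by lra. destruct sqrt_md as [u v]. cbn. field. lra. }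
  destruct (Croot2_real (IZR (- d))) as [[s [Hs Es]]|E0];
    [|exfalso; fold sqrt_md in E0; rewrite Him, E0 in Ht; unfold Rdiv in Ht; rewrite Rmult_0_l in Ht; lra].
  fold sqrt_md in Es. rewrite Es in Him. cbn [Im snd] in Him.
  (* Taking imaginary parts in the formula for tau; a (tau - conj rho) / sqrt_md thereby becomes an
     expression in tau alone. *)
  assert (Esq : sqrt_md = (Ci * (2 * RtoC (IZR a) * RtoC (Im tau)))%C).
  { rewrite Es, Him. rewrite <- !RtoC_mult. unfold Ci, Cmult, RtoC; cbn. f_equal; field; lra. }
  set (y := RtoC (Im tau)) in *.
  assert (Hy0 : y <> 0) by (intros E; apply RtoC_inj in E; lra).
  change (Croot 3 J / Croot 3 (1 - J))%C with (cbrt_ratio tau). rewrite HK.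
  assert (EF : F = Yf tau).
  { unfold F, Ffun, J. rewrite Jinv_ratio by assumption. unfold Yf.
    rewrite <- !RtoC_div by lra. apply hyp2F1_PS; lra. }
  rewrite EF. unfold Ffun, J. rewrite hyp_deriv_J by exact HO.
  assert (Nx := xf_neq1 tau (proj2 (proj2 HO))). rewrite (Jinv_xf tau HO).
  assert (EZ : Zf tau = (Yf tau * lgd tau + PS (dcoef h1) (xf tau) * (1 - xf tau) * (E4 tau ^ 2 / E6 tau))%C) by reflexivity.
  destruct HRel as [EY _].
  assert (Hpi : RtoC PI <> 0) by (intros E; apply RtoC_inj in E; assert (H := PI_RGT_0); lra).
  assert (Es2 : s2 tau = (E4 tau / E6 tau * (E2 tau - 3 / (RtoC PI * y)))%C).
  { unfold s2, y. rewrite RtoC_div, RtoC_mult; [reflexivity|]. apply Rmult_integral_contrapositive_currified; [assert (H := PI_RGT_0); lra|lra]. }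
  assert (Heta : eta rho <> 0).
  { intros E. apply kappa_neq0. unfold kappa. rewrite E. ring. }
  assert (Hs3 : RtoC (sqrt 3) <> 0) by (intros E; apply RtoC_inj in E; assert (H := sqrt3_pos); lra).
  assert (Ealpha : (alpha ^ 2)%C = (- (3) * eta rho ^ 4)%C).
  { unfold alpha. replace ((Ci * eta rho ^ 2 * RtoC (sqrt 3)) ^ 2)%C with ((Ci * Ci) * (RtoC (sqrt 3) * RtoC (sqrt 3)) * eta rho ^ 4)%C by ring.
    rewrite Ci_sq, <- RtoC_mult, sqrt3_sq. ring. }
  assert (HCi : Ci <> 0) by (intros E; apply (f_equal Im) in E; cbn in E; lra).
  set (T := (tau - Cconj rho)%C) in *. set (Z := Zf tau) in *. set (Y := Yf tau) in *.
  set (x := xf tau) in *. set (Yx := PS (dcoef h1) x) in *.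
  (* The common value of both sides. [Ci] is an indeterminate for [field], hence the explicit
     [Ci * Ci]. *)
  transitivity (E4 tau / E6 tau * Z ^ 2 * T * (4 * RtoC PI) * (- Ci - T / (2 * y) * (Ci * Ci)))%C.
  - rewrite Ealpha, Esq. unfold Kf, kappa. fold Z.
    transitivity (E4 tau / E6 tau * Z ^ 2 * T * (4 * RtoC PI) * (T / (2 * y) - Ci))%C.
    + field. repeat split; assumption.
    + rewrite Ci_sq. ring.
  - rewrite Es2.
    assert (Ex : (x * E6 tau ^ 2)%C = (E4 tau ^ 3)%C) by (unfold x, xf; field; exact HR).
    (* The definition of Z, multiplied by E4 / E6, is solved for the derivative of the
       hypergeometric series. *)
    assert (EYx : (x * (1 - x) * Yx)%C = (Z * E4 tau / E6 tau - Y * (E2 tau * E4 tau / E6 tau - x) / 12)%C).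
    { rewrite EZ. unfold lgd. transitivity (Yx * (1 - x) * (E4 tau ^ 3 / E6 tau ^ 2) + Y * (x - E4 tau ^ 3 / E6 tau ^ 2) / 12)%C.
      - rewrite <- Ex. field. exact HR.
      - field. exact HR. }
    replace (x / (x - 1) * (2 * Y * (Yx * (- (x - 1) ^ 2))))%C with (2 * Y * (x * (1 - x) * Yx))%C by (field; exact Nx).
    rewrite EYx.
    (* The terms in E2 and in x cancel between s2, J / (6 (1 - J)) and the derivative; the
       non-holomorphic term of s2 remains, and then Y = - 2 i PI (tau - conj rho) Z is inserted. *)
    transitivity (Y ^ 2 * (E4 tau / E6 tau) * (- (3) / (6 * RtoC PI * y)) + 2 * Y * Z * E4 tau / E6 tau)%C.
    + rewrite EY. unfold tpi. field_simplify_eq; [|repeat split; assumption].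
      replace (Ci ^ 2)%C with (Ci * Ci)%C by ring. rewrite Ci_sq. ring.
    + field. repeat split; try assumption.
      intros E. apply C1_neq0. replace (RtoC 1) with (- (x - 1 - x))%C by ring. rewrite E. ring.
Qed.
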